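(* Let $X$ be a finite-dimensional CAT(0) cube complex and let $\Gamma$ be a discrete group acting properly on $X$ by cubical automorphisms. Then either $\Gamma$ is \{locally finite\}-by-\{virtually Abelian\} or $\Gamma$ contains a non-Abelian free subgroup.
   Context: A CAT(0) cube complex is a simply connected cell complex all of whose cells are Euclidean cubes with edge length one and such that the link of each vertex is a flag complex; it is endowed with the induced length metric, which is CAT(0). It is finite-dimensional if the supremum of the dimensions of its cubes is finite (no local compactness is assumed). A group is locally finite if each of its finitely generated subgroups is finite. A group $\Gamma$ is \{locally finite\}-by-\{virtually Abelian\} if it has a locally finite normal subgroup $N$ such that $\Gamma/N$ is virtually Abelian. *)

(* Defs.v *)
From HB Require Import structures.
From mathcomp Require Import all_boot all_order all_algebra.
From mathcomp Require Import generic_quotient.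
From mathcomp Require Import all_classical all_reals all_analysis.

Set Implicit Arguments.
Unset Strict Implicit.
Unset Printing Implicit Defensive.

Import Order.TTheory GRing.Theory Num.Theory.
Import numFieldNormedType.Exports.

Local Open Scope classical_set_scope.
Local Open Scope ring_scope.

Section Cubes.
Context {R : realType}.

(* The norm of the library on row vectors is the sup norm, hence a separate
   Euclidean distance. *)
Definition euclidean_dist n (u v : 'rV[R]_n) : R :=
  Num.sqrt (\sum_(i < n) (u 0 i - v 0 i) ^+ 2).

Definition unit_cube n : set 'rV[R]_n :=
  [set u | forall i, 0 <= u 0 i <= 1].

(* A nonempty face of the n-cube is encoded by the coordinates that are frozen
   on it ([Some b]: frozen to 0 or 1; [None]: free). *)
Definition face_code n := 'I_n -> option bool.

Definition face n (F : face_code n) : set 'rV[R]_n :=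
  [set u | unit_cube u /\ forall i b, F i = Some b -> u 0 i = b%:R].

Definition face_interior n (F : face_code n) : set 'rV[R]_n :=
  [set u | forall i, if F i is Some b then u 0 i = b%:R else 0 < u 0 i < 1].

Definition isometry_onto m n (A : set 'rV[R]_m) (B : set 'rV[R]_n)
    (h : 'rV[R]_m -> 'rV[R]_n) : Prop :=
  h @` A = B /\
  forall u v, A u -> A v ->
    euclidean_dist (h u) (h v) = euclidean_dist u v.

Definition cube_vertex n (e : 'I_n -> bool) : 'rV[R]_n :=
  \row_i (e i)%:R.

(* The part, close to the vertex [e], of the relative interior of the face that
   contains [e] and whose edges at [e] have the directions in [J]. *)
Definition open_corner n (e : 'I_n -> bool) (J : {set 'I_n}) : set 'rV[R]_n :=
  [set u | unit_cube u /\
    forall i, if i \in J then is_true (0 < `|u 0 i - (e i)%:R| < 2^-1)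
              else u 0 i = (e i)%:R].

End Cubes.

Section CubeStrings.
Context {R : realType} {X I : Type} (dim : I -> nat).
Variable chart : forall c : I, 'rV[R]_(dim c) -> X.

(* [string_length x y l]: some finite sequence of points from x to y, each
   lying with its successor in a common cube, has total length l, the length
   of a step being measured in the cube. *)
Inductive string_length : X -> X -> R -> Prop :=
| string_nil x : string_length x x 0
| string_cons c (u v : 'rV[R]_(dim c)) y l :
    unit_cube u -> unit_cube v -> string_length (chart v) y l ->
    string_length (chart u) y (euclidean_dist u v + l).

End CubeStrings.

(* A complex of unit Euclidean cubes, as in Bridson-Haefliger, Def. I.7.37: X is
   the quotient of a disjoint union of cubes, [chart c] being the restriction
   of the quotient map to the c-th cube; its values off the cube are
   irrelevant. As in I.7.4, the distance of X is the induced length metric. The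
   faces of the cubes need not themselves be indexed by [cell]. *)
Record cube_complex (R : realType) (X : metricType R) := CubeComplex {
  cell : Type;
  cell_dim : cell -> nat;
  chart : forall c : cell, 'rV[R]_(cell_dim c) -> X;
  chart_cover : forall x : X, exists c u, unit_cube u /\ @chart c u = x;
  chart_inj : forall c (F : face_code (cell_dim c)),
    set_inj (face_interior F) (@chart c);
  chart_glue : forall c c' (F : face_code (cell_dim c))
      (F' : face_code (cell_dim c')) u u',
    face_interior F u -> face_interior F' u' -> @chart c u = @chart c' u' ->
    exists h, isometry_onto (face F) (face F') h /\
              forall v, face F v -> @chart c v = @chart c' (h v);
  length_metric : forall x y : X,
    ((mdist x y)%:E = ereal_inf (EFin @` string_length chart x y))%E
}.

Section CubeComplexes.
Context {R : realType} {X : metricType R} (K : cube_complex X).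

Definition finite_dimensional : Prop :=
  exists N : nat, forall c : cell K, (cell_dim c <= N)%N.

(* The cells of the link of a vertex v correspond to the germs at v of the faces
   containing v; such a germ is represented by the image of an open corner. *)
Definition corner_germ (c : cell K) (e : 'I_(cell_dim c) -> bool)
    (J : {set 'I_(cell_dim c)}) : set X :=
  @chart _ _ K c @` open_corner e J.

Definition corner_vertices (c : cell K) (e : 'I_(cell_dim c) -> bool)
    (J : {set 'I_(cell_dim c)}) : set (set X) :=
  [set corner_germ e [set i]%SET | i in [set` J]].

Definition corner_at (v : X) (c : cell K) (e : 'I_(cell_dim c) -> bool) : Prop :=
  chart (cube_vertex e) = v.

Definition is_vertex (v : X) : Prop :=
  exists c (e : 'I_(cell_dim c) -> bool), corner_at v e.

Definition link_vertex (v : X) (A : set X) : Prop :=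
  exists c (e : 'I_(cell_dim c) -> bool) i,
    corner_at v e /\ A = corner_germ e [set i]%SET.

(* [s] is the vertex set of a cell of the link of v. *)
Definition link_simplex (v : X) (s : set (set X)) : Prop :=
  exists c (e : 'I_(cell_dim c) -> bool) (J : {set 'I_(cell_dim c)}),
    [/\ corner_at v e, (0 < #|J|)%N & s = corner_vertices e J].

(* The link is a simplicial complex: the vertices of a cell are distinct and
   determine the cell. *)
Definition link_simplicial (v : X) : Prop :=
  (forall c (e : 'I_(cell_dim c) -> bool), corner_at v e ->
     injective (fun i => corner_germ e [set i]%SET)) /\
  (forall c (e : 'I_(cell_dim c) -> bool) (J : {set 'I_(cell_dim c)})
          c' (e' : 'I_(cell_dim c') -> bool) (J' : {set 'I_(cell_dim c')}),
     corner_at v e -> corner_at v e' ->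
     corner_vertices e J = corner_vertices e' J' ->
     corner_germ e J = corner_germ e' J').

Definition link_flag (v : X) : Prop :=
  link_simplicial v /\
  forall s : set (set X),
    finite_set s -> s !=set0 -> s `<=` link_vertex v ->
    (forall A B, s A -> s B -> A <> B -> link_simplex v [set A; B]) ->
    link_simplex v s.

Definition cubical_map (g : X -> X) : Prop :=
  forall c : cell K, exists (c' : cell K) (F : face_code (cell_dim c')) h,
    isometry_onto (@unit_cube R (cell_dim c)) (face F) h /\
    forall u, unit_cube u -> g (@chart _ _ K c u) = chart (h u).

Definition cubical_automorphism (g : X -> X) : Prop :=
  exists g' : X -> X,
    [/\ cancel g g', cancel g' g, cubical_map g & cubical_map g'].

End CubeComplexes.

Section SimplyConnected.
Context (R : realType) (T : topologicalType).

Local Notation I := (`[(0 : R), 1]%classic).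

Definition path_connected : Prop :=
  forall x y : T, exists p : R -> T,
    [/\ {within I, continuous p}, p 0 = x & p 1 = y].

Definition null_homotopic (p : R -> T) : Prop :=
  exists H : R * R -> T,
    [/\ {within I `*` I, continuous H},
        forall s, I s -> H (s, 0) = p s,
        forall s, I s -> H (s, 1) = p 0 &
        forall t, I t -> H (0, t) = p 0 /\ H (1, t) = p 0].

Definition simply_connected : Prop :=
  [/\ [set: T] !=set0, path_connected &
      forall p : R -> T,
        {within I, continuous p} -> p 0 = p 1 -> null_homotopic p].

End SimplyConnected.

Definition CAT0_cube_complex (R : realType) (X : metricType R)
    (K : cube_complex X) : Prop :=
  simply_connected R X /\ forall v, is_vertex K v -> link_flag K v.

Section Subgroups.
Context {G : groupType}.
Local Open Scope group_scope.

Definition subgroup (H : set G) : Prop :=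
  [/\ H 1, forall x y, H x -> H y -> H (x * y) & forall x, H x -> H x^-1].

Definition abelian_set (H : set G) : Prop :=
  forall x y, H x -> H y -> commute x y.

Definition generated (S : set G) : set G :=
  \bigcap_(H in [set H | subgroup H /\ S `<=` H]) H.

Definition locally_finite (H : set G) : Prop :=
  forall S, finite_set S -> S `<=` H -> finite_set (generated S).

Definition finite_index (H : set G) : Prop :=
  finite_set [set [set g * h | h in H] | g in [set: G]].

(* A letter (x, true) stands for x and (x, false) for its inverse. *)
Definition word_value (w : seq (G * bool)) : G :=
  \prod_(p <- w) (if p.2 then p.1 else p.1^-1).

Definition reduced (w : seq (G * bool)) : bool :=
  sorted (fun p q => ~~ ((p.1 == q.1) && (p.2 != q.2))) w.

Definition free_basis (S H : set G) : Prop :=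
  [/\ S `<=` H, generated S = H &
      forall w, reduced w -> w != [::] -> (forall p, p \in w -> S p.1) ->
        word_value w <> 1].

Definition free_subgroup (H : set G) : Prop :=
  subgroup H /\ exists S, free_basis S H.

End Subgroups.

Definition virtually_abelian (G : groupType) : Prop :=
  exists A : set G, [/\ subgroup A, finite_index A & abelian_set A].

Definition contains_nonabelian_free_subgroup (G : groupType) : Prop :=
  exists H : set G, free_subgroup H /\ ~ abelian_set H.

Record normal_subgroup (G : groupType) := NormalSubgroup {
  nset : set G;
  nset_subgroup : subgroup nset;
  nset_normal : forall x g, nset x -> nset (x ^ g)%g
}.

Section Quotient.
Context {G : groupType} (N : normal_subgroup G).
Local Open Scope group_scope.
Local Open Scope quotient_scope.

Definition coset_rel (x y : G) : bool := `[< nset N (x^-1 * y) >].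

Lemma coset_rel_refl : reflexive coset_rel.
Proof. by move=> x; apply/asboolP; rewrite mulVg; case: (nset_subgroup N). Qed.

Lemma coset_rel_sym : symmetric coset_rel.
Proof.
have [_ _ NV] := nset_subgroup N.
by move=> x y; apply/asboolP/asboolP => /NV; rewrite invgM invgK.
Qed.

Lemma coset_rel_trans : transitive coset_rel.
Proof.
have [_ NM _] := nset_subgroup N.
move=> y x z /asboolP Nxy /asboolP Nyz; apply/asboolP.
by have := NM _ _ Nxy Nyz; rewrite -mulgA mulVKg.
Qed.

Definition coset_equiv :=
  EquivRel coset_rel coset_rel_refl coset_rel_sym coset_rel_trans.

Definition quotient_group := {eq_quot coset_equiv}.

HB.instance Definition _ := Choice.on quotient_group.
HB.instance Definition _ := EqQuotient.on quotient_group.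

Definition quotient_proj (x : G) : quotient_group := \pi_quotient_group x.

Lemma quotient_projP x y : quotient_proj x = quotient_proj y <-> nset N (x^-1 * y).
Proof.
split; first by move/eqmodP => /asboolP.
by move=> Nxy; apply/eqmodP/asboolP.
Qed.

Lemma quotient_proj_repr (a : quotient_group) : quotient_proj (repr a) = a.
Proof. exact: reprK. Qed.

Definition quotient_mul (a b : quotient_group) := quotient_proj (repr a * repr b).
Definition quotient_inv (a : quotient_group) := quotient_proj (repr a)^-1.

Lemma quotient_projM x y :
  quotient_proj (x * y) = quotient_mul (quotient_proj x) (quotient_proj y).
Proof.
have [_ NM _] := nset_subgroup N.
have /quotient_projP Nx := esym (quotient_proj_repr (quotient_proj x)).
have /quotient_projP Ny := esym (quotient_proj_repr (quotient_proj y)).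
apply/quotient_projP; move: Nx Ny.
set x' := repr _; set y' := repr _ => Nx Ny.
have := NM _ _ (nset_normal y Nx) Ny.
by rewrite conjgE invgM -!mulgA mulVKg.
Qed.

Lemma quotient_projV x :
  quotient_proj x^-1 = quotient_inv (quotient_proj x).
Proof.
have [_ _ NV] := nset_subgroup N.
have /quotient_projP := esym (quotient_proj_repr (quotient_proj x)).
set x' := repr _ => Nx; apply/quotient_projP.
have := nset_normal x^-1 (NV _ Nx).
by rewrite conjgE !invgM !invgK -!mulgA mulgV mulg1.
Qed.

Lemma quotient_mulA : associative quotient_mul.
Proof.
move=> a b c; rewrite -[a]quotient_proj_repr -[b]quotient_proj_repr.
by rewrite -[c]quotient_proj_repr -!quotient_projM mulgA.
Qed.

Lemma quotient_mul1 : left_id (quotient_proj 1) quotient_mul.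
Proof.
by move=> a; rewrite -[a]quotient_proj_repr -quotient_projM mul1g.
Qed.

Lemma quotient_mulr1 : right_id (quotient_proj 1) quotient_mul.
Proof.
by move=> a; rewrite -[a]quotient_proj_repr -quotient_projM mulg1.
Qed.

Lemma quotient_mulV :
  left_inverse (quotient_proj 1) quotient_inv quotient_mul.
Proof.
move=> a; rewrite -[a]quotient_proj_repr -quotient_projV.
by rewrite -quotient_projM mulVg.
Qed.

Lemma quotient_mulrV :
  right_inverse (quotient_proj 1) quotient_inv quotient_mul.
Proof.
move=> a; rewrite -[a]quotient_proj_repr -quotient_projV.
by rewrite -quotient_projM mulgV.
Qed.

HB.instance Definition _ := isGroup.Build quotient_group quotient_mulA
  quotient_mul1 quotient_mulr1 quotient_mulV quotient_mulrV.

End Quotient.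

Definition locally_finite_by_virtually_abelian (G : groupType) : Prop :=
  exists N : normal_subgroup G,
    locally_finite (nset N) /\ virtually_abelian (quotient_group N).

Section Actions.
Context {G : groupType}.

Definition group_action (X : Type) (act : G -> X -> X) : Prop :=
  (forall x, act 1%g x = x) /\
  (forall g h x, act (g * h)%g x = act g (act h x)).

(* Properness of an action of a discrete group, as in Bridson-Haefliger,
   Def. I.8.2; X is not assumed to be locally compact. *)
Definition proper_action (R : realType) (X : metricType R)
    (act : G -> X -> X) : Prop :=
  forall x : X, exists2 r : R, 0 < r &
    finite_set [set g | (act g @` ball x r) `&` ball x r !=set0].

End Actions.

(* Main.v *)
Require Import Defs.
From mathcomp Require Import all_boot all_order all_algebra.
From mathcomp Require Import finmap.
From mathcomp Require Import all_classical all_reals all_analysis.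
From mathcomp Require Import zify ring lra.

(* The 1-skeleton of the complex, with its squares, is a flag square complex in
   which every closed walk bounds: a null homotopy of the walk, subdivided into
   squares so small that each lies in one ball of the developing map, contracts
   the walk combinatorially. In such a complex reduced walks are geodesics, and
   the parallelism classes of edges cut the vertices into halfspaces, of which
   at most dim X are pairwise crossing.

   Let U be a maximal invariant filter of halfspaces; an undecided halfspace h
   then has a translate disjoint from it. If three undecided halfspaces are
   pairwise disjoint, a ping-pong argument gives a free group. Otherwise the
   descending sequences of undecided halfspaces have finitely many limits of
   least dimension; a subgroup of finite index fixes one, which decides more
   halfspaces, and by induction on the dimension some subgroup A of finite index
   fixes an orientation xi of all the halfspaces.

   Up to finite sets, the halfspaces of xi that avoid a given vertex form
   finitely many classes (ends). In the subgroup of A that fixes the ends, the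
   signed numbers of halfspaces that an element gains in each end are characters.
   A finitely generated subgroup of their common kernel fixes an orientation
   at finite distance from a vertex, hence a vertex, and is finite by
   properness. *)

Set Implicit Arguments.
Unset Strict Implicit.
Unset Printing Implicit Defensive.

Local Open Scope classical_set_scope.

(** * Words in a square complex *)

(** No local finiteness is available: links may be infinite, and the group need not be finitely
    generated. Every finiteness statement comes either from the bound on families of pairwise
    transverse halfspaces or from the fact that finitely many halfspaces separate two vertices.
    CAT(0) geometry (convexity, projections) is replaced by combinatorics of words: only simple
    connectivity, flag links and the length metric enter. The limit of a descending sequence of
    halfspaces acts as a point at infinity: what it leaves undecided is transverse to all late
    terms, so the dimension drops. Limits of least dimension are taken because inclusion between two
    of them forces equality; distinct ones are then opposite or transverse, and Ramsey's theorem
    applies when no three are pairwise opposite. The characters are transfers: an end and its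
    translate are infinite sets with finite differences, and their relative index is additive. An
    element of the kernel preserves the height along each end, so finitely many of them preserve the
    part of the end beyond a large height; all but finitely many halfspaces of the end lie in it. *)

(* [square e f e' f'] : the edges e and f issue from the same corner of a
   square, e' is the edge opposite to e (it starts where f ends) and f' the edge
   opposite to f. *)
Record square_complex := SquareComplex {
  vert : Type;
  edge : Type;
  src : edge -> vert;
  tgt : edge -> vert;
  inv : edge -> edge;
  square : edge -> edge -> edge -> edge -> Prop;
  invK : involutive inv;
  src_inv : forall e, src (inv e) = tgt e;
  square_src : forall e f e' f', square e f e' f' -> src f = src e;
  square_srcl : forall e f e' f', square e f e' f' -> src e' = tgt f;
  square_sym : forall e f e' f', square e f e' f' -> square f e f' e';
  square_rot : forall e f e' f',
    square e f e' f' -> square (inv e) f' (inv e') f;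
  square_neq : forall e f e' f', square e f e' f' -> e <> f;
  square_uniq : forall e f e1 f1 e2 f2,
    square e f e1 f1 -> square e f e2 f2 -> e1 = e2 /\ f1 = f2;
  square_cube : forall e f g e1 f1 e2 g1 f2 g2,
    square e f e1 f1 -> square e g e2 g1 -> square f g f2 g2 ->
    exists e3 f3 g3,
      [/\ square e1 g2 e3 g3, square f1 g1 f3 g3 & square e2 f2 e3 f3]
}.

Section Words.
Context {C : square_complex}.
Local Notation E := (edge C).
Local Notation V := (vert C).
Implicit Types (e f g : E) (w u v : seq E).

Lemma tgt_inv e : tgt (inv e) = src e.
Proof. by rewrite -src_inv invK. Qed.

Lemma inv_inj : injective (@inv C).
Proof. exact: can_inj (@invK C). Qed.

Lemma square_srcr e f e' f' : square e f e' f' -> src f' = tgt e.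
Proof. by move/square_sym/square_srcl. Qed.

Lemma square_tgt e f e' f' : square e f e' f' -> tgt e' = tgt f'.
Proof.
move=> /square_rot /square_sym /square_rot /square_src.
by rewrite !src_inv.
Qed.

Lemma square_rotr e f e' f' : square e f e' f' -> square e' (inv f) e (inv f').
Proof. by move/square_sym/square_rot/square_sym. Qed.

Lemma square_neq_inv e f e' f' : square e f e' f' -> e' <> inv f.
Proof. by move/square_rotr/square_neq. Qed.

Fixpoint walk (x : V) w (y : V) : Prop :=
  if w is e :: w' then src e = x /\ walk (tgt e) w' y else x = y.

Inductive swap : seq E -> seq E -> Prop :=
| swap_head e f e' f' w :
    square e f e' f' -> swap (e :: f' :: w) (f :: e' :: w)
| swap_cons e w w' : swap w w' -> swap (e :: w) (e :: w').

Inductive sw : seq E -> seq E -> Prop :=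
| sw_refl w : sw w w
| sw_step w1 w2 w3 : swap w1 w2 -> sw w2 w3 -> sw w1 w3.

Inductive homotopic : seq E -> seq E -> Prop :=
| hom_refl w : homotopic w w
| hom_sym w w' : homotopic w w' -> homotopic w' w
| hom_trans w1 w2 w3 : homotopic w1 w2 -> homotopic w2 w3 -> homotopic w1 w3
| hom_cons e w w' : homotopic w w' -> homotopic (e :: w) (e :: w')
| hom_cancel e w : homotopic (e :: inv e :: w) w
| hom_square e f e' f' w :
    square e f e' f' -> homotopic (e :: f' :: w) (f :: e' :: w).

Lemma swap_sym w w' : swap w w' -> swap w' w.
Proof.
elim=> [e f e' f' w1 S|e w1 w2 _ IH]; last exact: swap_cons.
exact/swap_head/square_sym.
Qed.

Lemma sw_trans w1 w2 w3 : sw w1 w2 -> sw w2 w3 -> sw w1 w3.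
Proof.
by elim=> [//|a b c ab _ IH /IH]; apply: sw_step.
Qed.

Lemma swap_sw w w' : swap w w' -> sw w w'.
Proof. by move/sw_step; apply; apply: sw_refl. Qed.

Lemma sw_sym w w' : sw w w' -> sw w' w.
Proof.
elim=> [a|a b c ab _ IH]; first exact: sw_refl.
exact: sw_trans IH (swap_sw (swap_sym ab)).
Qed.

Lemma sw_cons e w w' : sw w w' -> sw (e :: w) (e :: w').
Proof.
elim=> [a|a b c ab _ IH]; first exact: sw_refl.
exact: sw_step (swap_cons e ab) IH.
Qed.

Lemma sw_head e f e' f' w : square e f e' f' -> sw (e :: f' :: w) (f :: e' :: w).
Proof. by move/swap_head => S; apply: swap_sw. Qed.

Lemma swap_catr w w' u : swap w w' -> swap (w ++ u) (w' ++ u).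
Proof.
by elim=> [e f e' f' w1 S|e w1 w2 _ IH] /=; [apply: swap_head|apply: swap_cons].
Qed.

Lemma sw_catr w w' u : sw w w' -> sw (w ++ u) (w' ++ u).
Proof.
elim=> [a|a b c ab _ IH]; first exact: sw_refl.
exact: sw_step (swap_catr _ ab) IH.
Qed.

Lemma sw_catl u w w' : sw w w' -> sw (u ++ w) (u ++ w').
Proof. by move=> ww'; elim: u => [//|e u IH] /=; apply: sw_cons. Qed.

Lemma swap_size w w' : swap w w' -> size w = size w'.
Proof. by elim=> [//|e w1 w2 _ IH] /=; rewrite IH. Qed.

Lemma sw_size w w' : sw w w' -> size w = size w'.
Proof. by elim=> [//|a b c /swap_size -> _]. Qed.

Lemma swap_walk x y w w' : swap w w' -> walk x w y -> walk x w' y.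
Proof.
move=> ww'; elim: ww' x => [e f e' f' w1 S|e w1 w2 _ IH] x /=.
  move=> [<- [_ W]]; split; first exact: square_src S.
  by split; [exact: square_srcl S|rewrite (square_tgt S)].
by move=> [<- /IH].
Qed.

Lemma sw_walk x y w w' : sw w w' -> walk x w y -> walk x w' y.
Proof. by elim=> [//|a b c /swap_walk ab _ IH /ab]. Qed.

Lemma homotopic_catl u w w' : homotopic w w' -> homotopic (u ++ w) (u ++ w').
Proof. by move=> H; elim: u => [//|e u IH] /=; apply: hom_cons. Qed.

Lemma homotopic_catr w w' u : homotopic w w' -> homotopic (w ++ u) (w' ++ u).
Proof.
elim=> /= [a|a b _|a b c _ ab _|e a b _|e a|*].
- exact: hom_refl.
- exact: hom_sym.
- exact: hom_trans.
- exact: hom_cons.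
- exact: hom_cancel.
- exact: hom_square.
Qed.

Lemma homotopic_cat w w' u u' :
  homotopic w w' -> homotopic u u' -> homotopic (w ++ u) (w' ++ u').
Proof. by move=> /(homotopic_catr u) A /(homotopic_catl w'); apply: hom_trans. Qed.

Lemma walk_cat x y w w' :
  walk x (w ++ w') y <-> exists z, walk x w z /\ walk z w' y.
Proof.
elim: w x => [|e w IH] x /=; first by split=> [W|[z [->]]//]; exists x.
split=> [[<- /IH[z [A B]]]|[z [[<- A] B]]]; first by exists z.
by split=> //; apply/IH; exists z.
Qed.

Definition rev_word w := rev (map (@inv C) w).

Lemma rev_word_cons e w : rev_word (e :: w) = rev_word w ++ [:: inv e].
Proof. by rewrite /rev_word /= rev_cons cats1. Qed.

Lemma rev_word_cat w w' : rev_word (w ++ w') = rev_word w' ++ rev_word w.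
Proof. by rewrite /rev_word map_cat rev_cat. Qed.

Lemma rev_wordK : involutive rev_word.
Proof.
by move=> w; rewrite /rev_word map_rev revK mapK //; apply: invK.
Qed.

Lemma walk_rev x w y : walk x w y -> walk y (rev_word w) x.
Proof.
elim: w x => [|e w IH] x /=; first by move=> ->.
move=> [<- /IH W]; rewrite rev_word_cons walk_cat; exists (tgt e).
by split=> //=; rewrite src_inv tgt_inv.
Qed.

Lemma homotopic_revr w : homotopic (w ++ rev_word w) [::].
Proof.
elim: w => [|e w IH]; first exact: hom_refl.
rewrite rev_word_cons /= catA.
apply: hom_trans (hom_cons e (homotopic_catr [:: inv e] IH)) _.
exact: hom_cancel.
Qed.

Lemma homotopic_revl w : homotopic (rev_word w ++ w) [::].
Proof. by rewrite -{2}(rev_wordK w); apply: homotopic_revr. Qed.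

Definition exch w w' : Prop :=
  match w, w' with
  | [::], [::] => True
  | e :: u, f :: v => e = f /\ sw u v \/
      exists e' f' z, [/\ square e f e' f', sw u (f' :: z) & sw v (e' :: z)]
  | _, _ => False
  end.

Lemma exch_refl w : exch w w.
Proof. by case: w => //= e w; left; split=> //; apply: sw_refl. Qed.

Lemma exch_swap w w' : swap w w' -> exch w w'.
Proof.
case=> /= [e f e' f' w1 S|e w1 w2 S]; last by left; split=> //; apply: swap_sw.
by right; exists e', f', w1; split=> //; apply: sw_refl.
Qed.

(** After two exchanges the tails [a0 :: z] and [b2 :: y] are equivalent and shorter, so the
    induction compares them. If [a0 = b2], the two squares share a corner and coincide, so the outer
    letters agree. Otherwise [inv e1], [a0] and [b2] pairwise span squares at the tip of [e1], and
    the cube they span contains the square of the outer letters. *)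
Lemma exch_trans n w1 w2 w3 :
  (forall w w', (size w < n)%N -> sw w w' -> exch w w') ->
  (size w1 <= n)%N -> sw w1 w2 -> exch w1 w2 -> exch w2 w3 -> exch w1 w3.
Proof.
move=> IH.
case: w1 w2 w3 => [|e0 u0] [|e1 u1] [|e2 u2] //= le_n /sw_size /= [sz].
case=> [[-> u01]|[a0 [a1 [z [Sa ua za]]]]].
  case=> [[-> u12]|[a0 [a1 [z [Sa ua za]]]]].
    by left; split=> //; apply: sw_trans u12.
  by right; exists a0, a1, z; split=> //; apply: sw_trans ua.
case=> [[<- u12]|[b1 [b2 [y [Sb ub yb]]]]].
  right; exists a0, a1, z; split=> //.
  exact: sw_trans (sw_sym u12) za.
have zy : sw (a0 :: z) (b2 :: y) by exact: sw_trans (sw_sym za) ub.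
have := IH _ _ _ zy; case.
- by rewrite -(sw_size za) -sz.
- move=> [ab zy']; subst b2; left.
  have Sa' := square_rot (square_sym Sa).
  have Sb' := square_rot Sb.
  have [/inv_inj E1 E2] := square_uniq Sa' Sb'; subst.
  split=> //; apply: sw_trans ua _; apply: sw_trans (sw_sym yb).
  exact: sw_cons.
move=> [c0 [c2 [x [Sc zc yc]]]]; right.
have [e3 [f3 [g3 [S1 S2 S3]]]] :=
  square_cube (square_rot (square_sym Sa)) (square_rot Sb) Sc.
exists f3, g3, (inv e3 :: x); split=> //.
  apply: sw_trans ua _; apply: sw_trans (sw_cons a1 zc) _.
  by move/square_rot: S1; rewrite invK => /sw_head; apply.
apply: sw_trans yb _; apply: sw_trans (sw_cons b1 yc) _.
by move/square_rot: S3; rewrite invK => /sw_head; apply.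
Qed.

Lemma sw_exch w w' : sw w w' -> exch w w'.
Proof.
have [n le_n] := ubnP (size w); elim: n => // n IHn in w w' le_n *.
move=> S; elim: S le_n => [w1 _|w1 w2 w3 S12 S23 IH le_n]; first exact: exch_refl.
apply: (@exch_trans n _ _ _ _ le_n (swap_sw S12) (exch_swap S12)) => //.
by apply: IH; rewrite -(swap_size S12).
Qed.

Lemma exchange e f u v : sw (e :: u) (f :: v) ->
  e = f /\ sw u v \/
  exists e' f' z, [/\ square e f e' f', sw u (f' :: z) & sw v (e' :: z)].
Proof. exact: sw_exch. Qed.

Lemma square_opp e f e' f' :
  square e f e' f' -> square (inv e') (inv f') (inv e) (inv f).
Proof. by move/square_rot/square_rotr/square_sym/square_sym; rewrite ?invK. Qed.

Lemma sw_cancel e u v : sw (e :: u) (e :: v) -> sw u v.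
Proof.
move=> /exchange[[]//|[e' [f' [z [S _ _]]]]].
by have := square_neq S.
Qed.

Definition backtracks w := exists u e v, w = u ++ e :: inv e :: v.

Definition reduced_word w := forall w', sw w w' -> ~ backtracks w'.

Lemma backtracks_cons e w :
  backtracks (e :: w) -> (exists v, w = inv e :: v) \/ backtracks w.
Proof.
move=> [[|f u] [g [v /= []]]]; first by move=> -> ->; left; exists v.
by move=> _ ->; right; exists u, g, v.
Qed.

Lemma backtracks_catl u w : backtracks w -> backtracks (u ++ w).
Proof. by move=> [a [e [b ->]]]; exists (u ++ a), e, b; rewrite catA. Qed.

Lemma backtracks_catr u w : backtracks w -> backtracks (w ++ u).
Proof. by move=> [a [e [b ->]]]; exists a, e, (b ++ u); rewrite -catA. Qed.

Lemma reduced_sw w w' : sw w w' -> reduced_word w -> reduced_word w'.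
Proof. by move=> ww' red u w'u; apply: red; apply: sw_trans w'u. Qed.

Lemma reduced_catr u w : reduced_word (u ++ w) -> reduced_word w.
Proof.
move=> red w' ww' bt; apply: (red (u ++ w')); first exact: sw_catl.
exact: backtracks_catl.
Qed.

Lemma reduced_catl u w : reduced_word (w ++ u) -> reduced_word w.
Proof.
move=> red w' ww' bt; apply: (red (w' ++ u)); first exact: sw_catr.
exact: backtracks_catr.
Qed.

Lemma reduced_nil : reduced_word [::].
Proof. by move=> [|e w] /sw_size // _ [[|f u] [g [v]]]. Qed.

Lemma reduced_not_inv e w v : reduced_word (e :: w) -> ~ sw w (inv e :: v).
Proof.
by move=> red /(sw_cons e) /red; apply; exists [::], e, v.
Qed.

(** A new first letter can only create a backtrack by cancelling itself. The exchange property moves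
    [e] past the first letter of the rearranged word, and the induction applies to the opposite edge
    [e'] and the shorter word [z]. *)
Lemma reduced_cons e w :
  reduced_word w -> (forall v, ~ sw w (inv e :: v)) -> reduced_word (e :: w).
Proof.
have [n le_n] := ubnP (size w); elim: n => // n IHn in e w le_n *.
move=> red no [|g u'] ewu; first by have := sw_size ewu.
move=> bt; have [[eg wu']|[e' [g' [z [S wz uz]]]]] := exchange ewu.
  subst g; have [[v uv]|bt'] := backtracks_cons bt; last exact: red bt'.
  by apply: (no v); rewrite -uv.
have [[v uv]|bt'] := backtracks_cons bt.
  subst u'; have [[E _]|[h [k [y [S1 vy zy]]]]] := exchange uz.
    by apply: (square_neq_inv S); rewrite E.
  have [E _] := square_uniq S1 (square_rot (square_sym S)); subst h.
  apply: (red (g' :: inv g' :: y)); last by exists [::], g', y.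
  exact: sw_trans wz (sw_cons g' zy).
have redz : reduced_word z.
  by apply: (@reduced_catr [:: g']); apply: reduced_sw red.
have szn : (size z < n)%N by move: le_n; rewrite (sw_size wz).
have [[y zy]|ne] := pselect (exists y, sw z (inv e' :: y)).
  apply: (no (g :: y)); apply: sw_trans wz _.
  apply: sw_trans (sw_cons g' zy) _.
  exact/sw_head/square_sym/square_rot.
apply: (IHn e' z szn redz _ _ (sw_sym uz)) bt' => y zy.
by apply: ne; exists y.
Qed.

(* Van der Waerden's trick: edges act on reduced words, so that homotopic words
   have normal forms that only differ by swaps. *)
Fixpoint nf w :=
  if w is e :: w' then
    if pselect (exists v, sw (nf w') (inv e :: v)) is left H
    then projT1 (cid H) else e :: nf w'
  else [::].

Lemma nf_consP e w :
  sw (nf w) (inv e :: nf (e :: w)) \/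
  (forall v, ~ sw (nf w) (inv e :: v)) /\ nf (e :: w) = e :: nf w.
Proof.
rewrite /=; case: pselect => [H|H]; first by left; case: cid.
by right; split=> // v Hv; apply: H; exists v.
Qed.

Lemma nf_cons_sw e w w' : sw (nf w) (nf w') -> sw (nf (e :: w)) (nf (e :: w')).
Proof.
move=> ww'; have [A|[A ->]] := nf_consP e w; have [B|[B ->]] := nf_consP e w'.
- apply: (@sw_cancel (inv e)); apply: sw_trans (sw_sym A) _.
  exact: sw_trans ww' B.
- by case: (B _ (sw_trans (sw_sym ww') A)).
- by case: (A _ (sw_trans ww' B)).
- exact: sw_cons.
Qed.

Lemma nf_reduced w : reduced_word (nf w).
Proof.
elim: w => [|e w IH]; first exact: reduced_nil.
have [A|[A ->]] := nf_consP e w; last exact: reduced_cons.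
exact: (@reduced_catr [:: inv e]) (reduced_sw A IH).
Qed.

Lemma nf_cancel e w : sw (nf (e :: inv e :: w)) (nf w).
Proof.
have [A|[A ->]] := nf_consP e (inv e :: w).
  have [B|[B E]] := nf_consP (inv e) w; last first.
    by rewrite E in A; apply/sw_sym/(sw_cancel A).
  rewrite invK in B; have red := reduced_sw B (@nf_reduced w).
  by case: (reduced_not_inv red A).
have [B|[B E]] := nf_consP (inv e) w; last first.
  by case: (A (nf w)); rewrite E; apply: sw_refl.
by rewrite invK in B; apply: sw_sym.
Qed.

Lemma nf_square_aux e f e' f' w : square e f e' f' ->
  sw (nf w) (inv f' :: nf (f' :: w)) ->
  (forall v, ~ sw (nf w) (inv e' :: v)) ->
  nf (e' :: w) = e' :: nf w ->
  sw (nf (e :: f' :: w)) (nf (f :: e' :: w)).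
Proof.
move=> S A B E; set r1 := nf (f' :: w) in A.
have F : sw (nf (e' :: w)) (inv f :: e :: r1).
  rewrite E; apply: sw_trans (sw_cons e' A) _.
  exact/sw_sym/sw_head/square_rot/square_sym.
have F1 : sw (nf (f :: e' :: w)) (e :: r1).
  have [A1|[A1 _]] := nf_consP f (e' :: w); last by case: (A1 _ F).
  exact: sw_cancel (sw_trans (sw_sym A1) F).
have [A2|[_ ->]] := nf_consP e (f' :: w); last exact: sw_sym.
case: (B (inv f :: nf (e :: f' :: w))).
apply: sw_trans A _; apply: sw_trans (sw_cons _ A2) _.
exact/sw_head/square_sym/square_opp.
Qed.

(** The relation that makes edges act on reduced words. If [f'] and [e'] both cancel, the normal
    form starts by crossing the square backwards along either side, and both products leave the same
    rest [z]. If neither cancels, [e] and [f] do not cancel afterwards. The mixed case is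
    [nf_square_aux]. *)
Lemma nf_square e f e' f' w :
  square e f e' f' -> sw (nf (e :: f' :: w)) (nf (f :: e' :: w)).
Proof.
move=> S; have S' := square_sym S; have So := square_sym (square_opp S).
have [A|[A EA]] := nf_consP f' w; have [B|[B EB]] := nf_consP e' w.
- have [[F _]|[h [k [z [S1 z1 z2]]]]] := exchange (sw_trans (sw_sym A) B).
    by have := square_neq So.
  have [E1 E2] := square_uniq S1 So; subst.
  apply: (@sw_trans _ z); last apply: sw_sym.
    have [A2|[A2 _]] := nf_consP e (f' :: w); last by case: (A2 _ z1).
    exact: sw_cancel (sw_trans (sw_sym A2) z1).
  have [A2|[A2 _]] := nf_consP f (e' :: w); last by case: (A2 _ z2).
  exact: sw_cancel (sw_trans (sw_sym A2) z2).
- exact: nf_square_aux A B EB.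
- by apply: sw_sym; apply: nf_square_aux B A EA.
suff aux e1 f1 e1' f1' : square e1 f1 e1' f1' ->
    (forall v, ~ sw (nf w) (inv e1' :: v)) ->
    nf (f1' :: w) = f1' :: nf w -> nf (e1 :: f1' :: w) = e1 :: f1' :: nf w.
  by rewrite (aux _ _ _ _ S) // (aux _ _ _ _ S') //; apply: sw_head.
move=> {S S' So}S no E; have [A1|[_ ->]] := nf_consP e1 (f1' :: w); last by rewrite E.
rewrite E in A1; have [[F _]|[h [k [z [S1 z1 _]]]]] := exchange A1.
  by case: (square_neq_inv (square_sym S)).
have [_ E2] := square_uniq S1 (square_sym (square_rot S)); subst k.
by case: (no _ z1).
Qed.

Lemma nf_homotopic w w' : homotopic w w' -> sw (nf w) (nf w').
Proof.
elim=> [a|a b _ IH|a b c _ ab _ bc|e a b _ IH|e a|*].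
- exact: sw_refl.
- exact: sw_sym.
- exact: sw_trans ab bc.
- exact: nf_cons_sw.
- exact: nf_cancel.
- exact: nf_square.
Qed.

Lemma nf_id w : reduced_word w -> sw (nf w) w.
Proof.
elim: w => [|e w IH] red; first exact: sw_refl.
have /IH ww : reduced_word w by apply: (@reduced_catr [:: e]).
have [A|[_ ->]] := nf_consP e w; last exact: sw_cons.
by case: (reduced_not_inv red (sw_trans (sw_sym ww) A)).
Qed.

Lemma walk_nf x y w : walk x w y -> walk x (nf w) y.
Proof.
elim: w x => // e w IH x [<- /IH W].
have [A|[_ ->//]] := nf_consP e w.
by have [_] := sw_walk A W; rewrite tgt_inv.
Qed.

(* [transport e p e' p'] : a strip of squares along the path p, with end edges e
   and e' and with p' on its other side. *)
Fixpoint transport e p e' p' : Prop :=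
  match p, p' with
  | [::], [::] => e = e'
  | f :: p1, f1 :: p1' => exists2 e1, square e f e1 f1 & transport e1 p1 e' p1'
  | _, _ => False
  end.

(** The square of the swap and the two squares of the strip meet at the middle vertex of the swapped
    part; the cube they span has the new strip on its other faces. *)
Lemma transport_swap e p e' p' q : transport e p e' p' -> swap p q ->
  exists2 q', transport e q e' q' & swap p' q'.
Proof.
move=> T pq; elim: pq e p' T => [f g f' g' w S|f u v uv IH] e p'.
  case: p' => [|h [|k p']] //=; first by case.
  move=> [e1 S1 [e2 S2 T]].
  have [e3 [f3 [g3 [Sa Sb Sc]]]] :=
    square_cube (square_rot (square_sym S1)) (square_rot S) S2.
  exists (g3 :: inv e3 :: p').
    exists f3 => //; exists e2 => //.
    by have := square_sym (square_rot Sc); rewrite invK.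
  by apply: swap_head; have := square_rot Sa; rewrite invK.
case: p' => [|h p'] //= [e1 S1 /IH[q' T1 pq']].
by exists (h :: q'); [exists e1|apply: swap_cons].
Qed.

Lemma transport_sw e p e' p' q : transport e p e' p' -> sw p q ->
  exists2 q', transport e q e' q' & sw p' q'.
Proof.
move=> T pq; elim: pq p' T => [a|a b c ab _ IH] p' T.
  by exists p' => //; apply: sw_refl.
have [q' /IH[r' T' s1] s2] := transport_swap T ab.
by exists r' => //; apply: sw_step s1.
Qed.

Lemma transport_cat e p e1 p1 q e2 q2 : transport e p e1 p1 ->
  transport e1 q e2 q2 -> transport e (p ++ q) e2 (p1 ++ q2).
Proof.
elim: p e p1 => [|f p IH] e [|f1 p1] //=; first by move=> ->.
by move=> [e3 S T] /(IH _ _ T); exists e3.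
Qed.

Lemma transport_catP e p q e2 r : transport e (p ++ q) e2 r ->
  exists e1 p1 q2, [/\ r = p1 ++ q2, transport e p e1 p1 & transport e1 q e2 q2].
Proof.
elim: p e r => [|f p IH] e r; first by move=> T; exists e, [::], r.
case: r => //= f1 r [e3 S /IH[e1 [p1 [q2 [-> T1 T2]]]]].
by exists e1, (f1 :: p1), q2; split=> //; exists e3.
Qed.

Lemma transport_rev e p e' p' :
  transport e p e' p' -> transport e' (rev_word p) e (rev_word p').
Proof.
elim: p e p' => [|f p IH] e [|f1 p1] //= [e1 S /IH T].
rewrite !rev_word_cons; apply: transport_cat T _ => /=.
by exists e => //; apply: square_rotr.
Qed.

Lemma transport_inv e p e' p' :
  transport e p e' p' -> transport (inv e) p' (inv e') p.
Proof.
elim: p e p' => [|f p IH] e [|f1 p1] //=; first by move=> ->.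
by move=> [e1 S /IH T]; exists (inv e1) => //; apply: square_rot.
Qed.

Lemma transport_walk e p e' p' : transport e p e' p' -> walk (src e) p (src e').
Proof.
elim: p e p' => [|f p IH] e [|f1 p1] //=; first by move=> ->.
by move=> [e1 S /IH]; rewrite (square_srcl S); split=> //; exact: square_src S.
Qed.

Lemma transport_nf e p e' p' :
  transport e p e' p' -> exists q', transport e (nf p) e' q'.
Proof.
elim: p e p' => [|f p IH] e [|f1 p1] //=; first by move=> ->; exists [::].
move=> [e1 S /IH[q1 T]]; rewrite -/(nf (f :: p)).
have [A|[_ ->]] := nf_consP f p; last by exists (f1 :: q1); exists e1.
have [[//|f2 q2] [e2 S2 T2] _] := transport_sw T A; exists q2.
by have [-> _] := square_uniq (square_rotr S) S2.
Qed.

Lemma transport_sw_word e p e' p' :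
  transport e p e' p' -> sw (e :: p') (p ++ [:: e']).
Proof.
elim: p e p' => [|f p IH] e [|f1 p1] //=; first by move=> ->; exact: sw_refl.
move=> [e1 S /IH T].
exact: sw_trans (sw_head _ S) (sw_cons f T).
Qed.

(** The last square of such a strip would be folded onto itself. This excludes, below, that a walk
    meets a parallelism class against its orientation. *)
Lemma transport_last e p g p' : ~ transport e (p ++ [:: g]) (inv g) p'.
Proof.
move=> /transport_catP[e1 [p1 [[|h [|? ?]] [_ _ //=]]]]; last by case.
by move=> [e2 /square_neq_inv + E]; rewrite E.
Qed.

Definition par e e' := exists p p', transport e p e' p'.

Lemma par_refl e : par e e.
Proof. by exists [::], [::]. Qed.

Lemma par_sym e e' : par e e' -> par e' e.
Proof. by move=> [p [p' /transport_rev T]]; do 2!eexists; exact: T. Qed.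

Lemma par_trans e1 e2 e3 : par e1 e2 -> par e2 e3 -> par e1 e3.
Proof.
move=> [p [p' T]] [q [q' /(transport_cat T) T']].
by do 2!eexists; exact: T'.
Qed.

Lemma par_square e f e' f' : square e f e' f' -> par e e'.
Proof. by exists [:: f], [:: f']; exists e'. Qed.

Lemma par_inv e e' : par e e' -> par (inv e) (inv e').
Proof. by move=> [p [p' /transport_inv T]]; do 2!eexists; exact: T. Qed.

Definition upar e f := par e f \/ par e (inv f).

Lemma upar_refl e : upar e e. Proof. by left; apply: par_refl. Qed.

Lemma upar_invr e f : upar e (inv f) <-> upar e f.
Proof. by rewrite /upar invK; split=> -[]; [right|left|right|left]. Qed.

Lemma upar_sym e f : upar e f -> upar f e.
Proof.
move=> [/par_sym|/par_sym /par_inv]; first by left.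
by rewrite invK; right.
Qed.

Lemma upar_trans e f g : upar e f -> upar f g -> upar e g.
Proof.
move=> [ef|ef] [fg|fg]; first by left; apply: par_trans fg.
- by right; apply: par_trans fg.
- by right; apply: par_trans (par_inv fg).
- by left; apply: par_trans ef _; rewrite -[g]invK; apply: par_inv.
Qed.

Lemma reduced_word1 e : reduced_word [:: e].
Proof.
apply: reduced_cons; first exact: reduced_nil.
by move=> v /sw_size.
Qed.

End Words.

(** * Halfspaces *)

Fixpoint allP T (P : T -> Prop) (s : seq T) : Prop :=
  if s is x :: s' then P x /\ allP P s' else True.

Fixpoint pairP T (r : T -> T -> Prop) (s : seq T) : Prop :=
  if s is x :: s' then allP (r x) s' /\ pairP r s' else True.

Definition corner (C : square_complex) (v : vert C) (L : seq (edge C)) :=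
  allP (fun e => src e = v) L /\
  pairP (fun e f => exists e' f', square e f e' f') L.

(* The 2-skeleton of a CAT(0) cube complex of dimension at most [dimension]. *)
Record cat0_skeleton := Cat0Skeleton {
  skeleton :> square_complex;
  walk_connected : forall x y : vert skeleton, exists w, walk x w y;
  walk_homotopic : forall (x y : vert skeleton) w w',
    walk x w y -> walk x w' y -> homotopic w w';
  dimension : nat;
  corner_size : forall (v : vert skeleton) L, corner v L -> (size L <= dimension)%N
}.

Section Halfspaces.
Context {C : cat0_skeleton}.
Local Notation E := (edge C).
Local Notation V := (vert C).
Implicit Types (e f g : E) (w u v : seq E).

(** The carrier of a hyperplane is convex. A strip along some walk survives normalisation, all
    reduced walks with the same ends differ by swaps, and strips follow swaps. *)
Lemma ladder e e' q : par e e' -> reduced_word q -> walk (src e) q (src e') ->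
  exists q', transport e q e' q'.
Proof.
move=> [p [p' T]] red W; have [q1 T1] := transport_nf T.
have pq := walk_homotopic (transport_walk T) W.
have [q' T' _] := transport_sw T1 (sw_trans (nf_homotopic pq) (nf_id red)).
by exists q'.
Qed.

Lemma par_src_eq e f : par e f -> src e = src f -> e = f.
Proof. by move=> /ladder L /(L _ reduced_nil)[[]]. Qed.

(** No hyperplane crosses itself: [ladder] is applied to the empty walk or to [f] alone, where the
    possible strips can be inspected. *)
Lemma square_not_upar e f e' f' : square e f e' f' -> ~ upar e f.
Proof.
move=> S [/par_src_eq|/ladder L].
  by rewrite (square_src S) => /(_ erefl); apply: square_neq S.
have [|q T] := L _ (@reduced_word1 _ f).
  by split; [exact: square_src S|rewrite src_inv].
exact: (@transport_last _ e [::] f q).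
Qed.

Definition count_par e w := count (fun f => `[<upar e f>]) w.

Lemma count_par_cons e f w : count_par e (f :: w) = `[<upar e f>] + count_par e w.
Proof. by []. Qed.

Lemma count_par_cat e w w' : count_par e (w ++ w') = count_par e w + count_par e w'.
Proof. exact: count_cat. Qed.

Lemma asbool_upar_inv e f : `[<upar e (inv f)>] = `[<upar e f>].
Proof. exact/asbool_equiv_eq/upar_invr. Qed.

Lemma asbool_upar_r e f g : upar f g -> `[<upar e f>] = `[<upar e g>].
Proof.
move=> fg; apply: asbool_equiv_eq; split=> [|h]; first by move/upar_trans; apply.
exact: upar_trans h (upar_sym fg).
Qed.

(** A cancellation removes two edges of one class and a square exchanges edges with parallel ones.
    As all walks with the same ends are homotopic, each class separates the vertices into two
    sides. *)
Lemma count_par_homotopic e w w' :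
  homotopic w w' -> odd (count_par e w) = odd (count_par e w').
Proof.
elim=> [//|a b _ -> //|a b c _ -> _ -> //|f a b _ IH|f a|f g f' g' a S].
- by rewrite !count_par_cons !oddD IH.
- by rewrite !count_par_cons asbool_upar_inv !oddD addbA addbb.
- rewrite !count_par_cons !oddD.
  rewrite (asbool_upar_r e (or_introl (par_square S))).
  by rewrite (asbool_upar_r e (or_introl (par_square (square_sym S)))) addbCA.
Qed.

Definition halfspace e : set V :=
  [set y | exists2 w, walk (tgt e) w y & ~~ odd (count_par e w)].

Lemma halfspaceE e w y :
  walk (tgt e) w y -> `[<halfspace e y>] = ~~ odd (count_par e w).
Proof.
move=> W; apply/asboolP/idP => [[u U]|]; last by exists w.
by rewrite (count_par_homotopic e (walk_homotopic U W)).
Qed.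

Lemma halfspace_walk e x w y : walk x w y ->
  `[<halfspace e y>] = `[<halfspace e x>] (+) odd (count_par e w).
Proof.
move=> W; have [u U] := walk_connected (tgt e) x.
have UW : walk (tgt e) (u ++ w) y by apply/walk_cat; exists x.
by rewrite (halfspaceE UW) (halfspaceE U) count_par_cat oddD addNb.
Qed.

Lemma halfspace_tgt e : halfspace e (tgt e).
Proof. by exists [::]. Qed.

Lemma halfspace_src e : ~ halfspace e (src e).
Proof.
have W : walk (src e) [:: e] (tgt e) by [].
have := halfspace_walk e W; rewrite (asboolT (halfspace_tgt e)).
rewrite count_par_cons (asboolT (upar_refl e)) /=.
by case: asboolP.
Qed.

Lemma halfspace_eq e f : (forall g, upar e g <-> upar f g) ->
  halfspace e (tgt f) -> halfspace e = halfspace f.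
Proof.
move=> ef tf; apply/seteqP; suff H y : `[<halfspace e y>] = `[<halfspace f y>].
  by split=> y /asboolP; [rewrite H|rewrite -H] => /asboolP.
have [w W] := walk_connected (tgt f) y.
rewrite (halfspace_walk e W) (halfspaceE W) (asboolT tf) addTb; congr (~~ odd _).
by apply: eq_count => g; apply: asbool_equiv_eq.
Qed.

Lemma halfspace_inv e : halfspace (inv e) = ~` halfspace e.
Proof.
apply/seteqP; suff H y : `[<halfspace (inv e) y>] = ~~ `[<halfspace e y>].
  split=> y Hy; first by have := asboolT Hy; rewrite H => /asboolPn.
  by apply/asboolP; rewrite H; apply/asboolPn.
have [w W] := walk_connected (src e) y.
rewrite (halfspaceE (w := w)) ?tgt_inv // (halfspace_walk e W).
rewrite (asboolF (@halfspace_src e)) addFb; congr (~~ odd _).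
apply: eq_count => g; apply: asbool_equiv_eq.
have ee : upar e (inv e) by apply/upar_invr; exact: upar_refl.
split; exact: upar_trans (upar_sym _) || exact: upar_trans ee.
Qed.

Lemma halfspace_par e e' : par e e' -> halfspace e = halfspace e'.
Proof.
move=> [p [p']]; elim: p e p' => [|f p IH] e [|f1 p'] //=; first by move=> ->.
move=> [e1 S /IH <-]; have ee1 := par_square S.
apply: halfspace_eq => [g|].
  split=> eg; apply: upar_trans eg; [left; exact: par_sym|by left].
have W : walk (tgt e) [:: f1] (tgt e1).
  by split; [exact: square_srcr S|exact/esym/(square_tgt S)].
apply/asboolP; rewrite (halfspaceE W) count_par_cons addn0 oddb.
apply/asboolPn => ef1; apply: (square_not_upar S); apply: upar_trans ef1 _.
by left; apply: par_sym; apply: par_square (square_sym S).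
Qed.

Lemma upar_halfspace e f :
  upar e f -> halfspace e = halfspace f \/ halfspace e = ~` halfspace f.
Proof.
by move=> [|] /halfspace_par ->; [left|right; rewrite halfspace_inv].
Qed.

Lemma count_par_split e w : odd (count_par e w) ->
  exists a f b, w = a ++ f :: b /\ upar e f.
Proof.
elim: w => // f w IH; rewrite count_par_cons.
case: asboolP => [ef _|_]; first by exists [::], f, w.
by rewrite add0n => /IH[a [g [b [-> eg]]]]; exists (f :: a), g, b.
Qed.

Lemma crossing_split e x w y : walk x w y -> ~ (halfspace e x <-> halfspace e y) ->
  exists a f b, w = a ++ f :: b /\ upar e f.
Proof.
move=> /(halfspace_walk e) H nxy; apply: count_par_split.
apply: contra_notT nxy => /negPf E; rewrite E addbF in H.
by split=> /asboolP; [rewrite -H|rewrite H] => /asboolP.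
Qed.

(** The walk must meet the class of [g]; the strip from [g] to that edge lies along the initial part
    of the walk, and swapping across its squares brings [g] to the front. *)
Lemma reduced_first g r z : reduced_word r -> walk (src g) r z -> halfspace g z ->
  exists r', sw r (g :: r').
Proof.
move=> red W Hz; have [|a [h [b [E gh]]]] := crossing_split (e := g) W.
  by move=> [_ /(_ Hz)]; apply: halfspace_src.
subst r; move: W; rewrite -cat1s catA => /walk_cat[y [Wh _]].
move: red; rewrite -cat1s catA => /reduced_catl redh.
case: gh => gh.
  have [q T] : exists q, transport g a h q.
    apply: ladder => //; first exact: reduced_catl redh.
    by move/walk_cat: Wh => [s [Wa [-> _]]].
  by exists (q ++ b); rewrite -cat_cons; apply/sw_catr/sw_sym/transport_sw_word.
have [q T] : exists q, transport g (a ++ [:: h]) (inv h) q.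
  apply: ladder => //; rewrite src_inv.
  by apply/walk_cat; move/walk_cat: Wh => [s [Wa [E _]]]; exists s.
by case: (transport_last T).
Qed.

(** A reduced walk crosses each hyperplane at most once: between two crossings it would carry a
    strip, and swapping across the strip makes a backtrack appear. *)
Lemma reduced_upar x h w g v y :
  reduced_word (h :: w ++ g :: v) -> walk x (h :: w ++ g :: v) y -> ~ upar h g.
Proof.
rewrite -[g :: v]cat1s catA -cat_cons => /reduced_catl red [_].
move=> /walk_cat[z [/walk_cat[s [W [sE _]]] _]] [hg|/par_inv hg].
  have [q T] : exists q, transport h (h :: w) g q.
    apply: ladder => //; last by rewrite sE.
    exact: (@reduced_catl _ [:: g]).
  by case: q T => // q1 q [e1 /square_neq].
rewrite invK in hg; subst s.
have [q T] : exists q, transport (inv h) w g q.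
  apply: ladder => //; last by rewrite src_inv.
  by apply: (@reduced_catr _ [:: h]); apply: (@reduced_catl _ [:: g]).
apply: (red (h :: inv h :: q)); last by exists [::], h, q.
exact/sw_cons/sw_sym/transport_sw_word.
Qed.

Lemma reduced_crossing x a g b y : reduced_word (a ++ g :: b) ->
  walk x (a ++ g :: b) y -> ~ halfspace g x /\ halfspace g y.
Proof.
move=> red W; have /walk_cat[z [Wa [sz Wb]]] := W; subst z; split.
  move=> gx; have [|a1 [h [a2 [E gh]]]] := crossing_split (e := g) Wa.
    by move=> [/(_ gx) + _]; apply: halfspace_src.
  subst a; rewrite -catA in red W; have /walk_cat[s [_ W2]] := W.
  exact: (reduced_upar (reduced_catr red) W2) (upar_sym gh).
apply: contrapT => gy; have [|b1 [h [b2 [E gh]]]] := crossing_split (e := g) Wb.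
  by move=> [/(_ (halfspace_tgt g))].
subst b; have /walk_cat[s [_ W2]] := W.
exact: (reduced_upar (reduced_catr red) W2) gh.
Qed.

(** For a vertex in [halfspace f] outside [halfspace e], a reduced walk from [tgt e] could start
    with [f] and also with [inv e], and by the exchange property these would span a square. *)
Lemma halfspace_nested e f : tgt e = src f -> f <> inv e ->
  ~ (exists e' f', square (inv e) f e' f') -> halfspace f `<=` halfspace e.
Proof.
move=> ef nef nS z fz; apply: contrapT => nez.
have [w W] := walk_connected (src f) z.
have {}W := walk_nf W; have red := @nf_reduced _ w.
have [r rf] := reduced_first red W fz.
have [||r' re] := @reduced_first (inv e) _ z red; first by rewrite src_inv ef.
  by rewrite halfspace_inv.
have [[E _]|[e' [f' [_ [S _ _]]]]] := exchange (sw_trans (sw_sym re) rf).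
  by apply: nef; rewrite E.
by apply: nS; exists e', f'.
Qed.

Definition closest x e p := walk x p (src e) /\
  forall e' q, par e e' -> walk x q (src e') -> (size p <= size q)%N.

(** Every hyperplane met on a shortest way to [e] separates [x] from [halfspace e]. The induction is
    on the part of the walk after [g]; a square of [g] with the last edge [e] would let a parallel
    copy of [e] be reached earlier. *)
Lemma closest_nested x e p a g b : ~ halfspace e x -> closest x e p ->
  p = a ++ g :: b -> halfspace e `<=` halfspace g.
Proof.
move=> nx; have [n le_n] := ubnP (size b).
elim: n => // n IHn in p a g b le_n *; move=> [W min] E; subst p.
have /walk_cat[z [Wa [sz Wb]]] := W; subst z.
case: b => [|g2 b] in le_n W min Wb *; rewrite /= in Wb.
  (* In this case [a] ends at [tgt e], inside the halfspace, so [a] has already met the class of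
     [e], against minimality. *)
  have [eg|neg] := pselect (e = inv g).
    have [|a1 [k [a2 [Ea ek]]]] := crossing_split (e := e) Wa.
      move=> [_ /(_ _) H]; apply/nx/H; rewrite -tgt_inv -eg; exact: halfspace_tgt.
    subst a; have /walk_cat[s [W1 [sk _]]] := Wa.
    case: ek => ek.
      rewrite -sk in W1; have := min _ _ ek W1; rewrite !size_cat /=; lia.
    have W2 : walk x (a1 ++ [:: k]) (src (inv k)).
      by apply/walk_cat; exists s; rewrite src_inv.
    have := min _ _ ek W2; rewrite !size_cat /=; lia.
  apply: halfspace_nested => // -[g' [e' S]].
  have pe : par e e' by apply: par_square (square_sym S).
  rewrite -(tgt_inv g) -(square_srcl (square_sym S)) in Wa.
  have := min _ _ pe Wa; rewrite !size_cat /=; lia.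
case: Wb => sg2 Wb.
have [E|ng2] := pselect (g2 = inv g).
  rewrite E tgt_inv in Wb; have W2 : walk x (a ++ b) (src e).
    by apply/walk_cat; exists (src g).
  have := min _ _ (par_refl e) W2; rewrite !size_cat /=; lia.
(* If there is a square, swapping across it replaces [g] by the parallel edge [inv k] one step later
   on a walk that is still shortest. If not, consecutive halfspaces are nested. *)
have [[k [h S]]|nS] := pselect (exists k h, square (inv g) g2 k h).
  have Sh := square_rot S; rewrite invK in Sh.
  have pp : sw (a ++ g :: g2 :: b) ((a ++ [:: h]) ++ inv k :: b).
    by rewrite -catA; apply/sw_catl/sw_head.
  have -> : halfspace g = halfspace (inv k) by apply: halfspace_par (par_square Sh).
  apply: (IHn _ (a ++ [:: h]) (inv k) b le_n _ erefl); split; first exact: sw_walk W.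
  by move=> e' q ee' /(min _ _ ee'); rewrite (sw_size pp).
apply: (@subset_trans _ (halfspace g2)); last exact: halfspace_nested.
by apply: (IHn _ (a ++ [:: g]) g2 b le_n _ erefl); rewrite -catA; split.
Qed.

End Halfspaces.

(** * Crossing halfspaces, dimension and orientations *)

Fixpoint all2P T S (r : T -> S -> Prop) (s : seq T) (t : seq S) : Prop :=
  match s, t with
  | [::], [::] => True
  | x :: s', y :: t' => r x y /\ all2P r s' t'
  | _, _ => False
  end.

Lemma all2P_size T S (r : T -> S -> Prop) s t : all2P r s t -> size s = size t.
Proof. by elim: s t => [|x s IH] [|y t] //= [_ /IH ->]. Qed.

Lemma allP_all2P T S (r : T -> S -> Prop) s :
  allP (fun x => exists y, r x y) s -> exists t, all2P r s t.
Proof.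
elim: s => [_|x s IH /= [[y xy] /IH[t st]]]; first by exists [::].
by exists (y :: t).
Qed.

Lemma all2P_trans T S U (r : T -> S -> Prop) (r' : S -> U -> Prop)
    (r'' : T -> U -> Prop) s t u :
  (forall x y z, r x y -> r' y z -> r'' x z) ->
  all2P r s t -> all2P r' t u -> all2P r'' s u.
Proof.
move=> H; elim: s t u => [|x s IH] [|y t] [|z u] //= [xy st] [yz tu].
by split; [exact: H xy yz|exact: IH st tu].
Qed.

Lemma allP_all2 T S (r : T -> S -> Prop) (P : T -> Prop) (Q : S -> Prop) s t :
  (forall x y, r x y -> P x -> Q y) -> all2P r s t -> allP P s -> allP Q t.
Proof.
move=> H; elim: s t => [|x s IH] [|y t] //= [xy st] [Px Ps].
by split; [exact: H xy Px|exact: IH st Ps].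
Qed.

Lemma pairP_all2 T S (r : T -> S -> Prop) (P : T -> T -> Prop)
    (Q : S -> S -> Prop) s t :
  (forall x y x' y', r x y -> r x' y' -> P x x' -> Q y y') ->
  all2P r s t -> pairP P s -> pairP Q t.
Proof.
move=> H; elim: s t => [|x s IH] [|y t] //= [xy st] [Px Ps].
split; last exact: IH st Ps.
apply: allP_all2 st Px => x' y'; exact: H.
Qed.

Lemma allPW T (P Q : T -> Prop) s : (forall x, P x -> Q x) -> allP P s -> allP Q s.
Proof. by move=> PQ; elim: s => //= x s IH [/PQ Qx /IH]. Qed.

Lemma allP_and T (P Q : T -> Prop) s : allP P s -> allP Q s ->
  allP (fun x => P x /\ Q x) s.
Proof. by elim: s => //= x s IH [Px Ps] [Qx Qs]; split=> //; apply: IH. Qed.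

Lemma ex_least (P : nat -> Prop) : (exists n, P n) ->
  exists2 n, P n & forall m, P m -> (n <= m)%N.
Proof.
move=> [n Pn]; have ex : exists n, `[<P n>] by exists n; apply/asboolP.
by case: (ex_minnP ex) => m /asboolP Pm min; exists m => // k /asboolP/min.
Qed.

Lemma finite_set_proper_ind_choice (T : choiceType) (P : set T -> Prop) :
  (forall A, finite_set A -> (forall B, B `<` A -> P B) -> P A) ->
  forall A, finite_set A -> P A.
Proof.
move=> H A finA.
have [n] := ubnP (#|` fset_set A|)%fset.
elim: n => // n IHn in A finA * => le_n; apply: H => // B BA.
have finB : finite_set B by apply: sub_finite_set finA; case: BA.
apply: (IHn _ finB); rewrite ltnS in le_n; apply: leq_trans le_n; apply: fproper_ltn_card.
rewrite fproperE; apply/andP; split.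
  apply/fsubsetP => x; rewrite (in_fset_set finA) (in_fset_set finB) => /set_mem Bx.
  by apply/mem_set; case: BA => + _; apply.
apply/negP => /fsubsetP AB; case: BA => _; apply=> x Ax.
have := AB x; rewrite (in_fset_set finA) (in_fset_set finB) => H.
exact/set_mem/H/mem_set.
Qed.

Lemma finite_set_proper_ind T (P : set T -> Prop) :
  (forall A, finite_set A -> (forall B, B `<` A -> P B) -> P A) ->
  forall A, finite_set A -> P A.
Proof. exact: (@finite_set_proper_ind_choice {classic T}). Qed.

Definition crossing T (A B : set T) :=
  [/\ ~ A `<=` B, ~ B `<=` A, ~ A `<=` ~` B & ~ ~` A `<=` B].

Lemma crossing_sym T (A B : set T) : crossing A B -> crossing B A.
Proof.
move=> [h1 h2 h3 h4]; split=> //; first by move=> /subsetC; rewrite setCK => /h3.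
by move/subsetC; rewrite setCK.
Qed.

Lemma crossingC T (A B : set T) : crossing A B -> crossing (~` A) B.
Proof.
move=> [h1 h2 h3 h4]; split=> //; last by rewrite setCK.
  by move/subsetC; rewrite setCK.
by move/subsetC; rewrite !setCK.
Qed.

Section Dimension.
Context {C : cat0_skeleton}.
Local Notation E := (edge C).
Local Notation V := (vert C).
Implicit Types (e f g : E).

Definition cross e f := crossing (halfspace e) (halfspace f).

Lemma cross_sym e f : cross e f -> cross f e.
Proof. exact: crossing_sym. Qed.

Lemma cross_upar e e' f : upar e e' -> cross e f -> cross e' f.
Proof.
by move=> /upar_sym/upar_halfspace; rewrite /cross => -[] -> // /crossingC.
Qed.

Lemma cross_irr e f : halfspace e `<=` halfspace f -> ~ cross e f.
Proof. by move=> ef []. Qed.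

Lemma cross_square e f : src e = src f -> cross e f ->
  exists e' f', square e f e' f'.
Proof.
move=> sef ef; apply: contrapT => nS.
have fe : halfspace f `<=` halfspace (inv e).
  apply: halfspace_nested; rewrite ?tgt_inv ?invK //.
  by move=> E; subst f; apply: cross_irr ef.
by rewrite halfspace_inv in fe; have := subsetC fe; rewrite setCK; case: ef.
Qed.

(** A Helly property: pairwise crossing hyperplanes meet in a common cube. Among the corners for [L]
    and the edges dual to [e0], take a pair at least distance. If [g] is the first edge of the walk
    between them, then [halfspace e] lies in [halfspace g]; each [f] of the corner crosses [e], so
    it spans a square with [g]. The whole corner can thus be pushed across [g], nearer to [e]. *)
Lemma cross_corner (v0 : V) L : pairP cross L ->
  exists v L', corner v L' /\ all2P upar L L'.
Proof.
elim: L => [_|e0 L IH /= [e0L /IH[v1 [L1 [cL1 LL1]]]]]; first by exists v0, [::].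
have [|n [v [L' [e [p [cL LL' ee W sz]]]]] min] := @ex_least (fun n =>
  exists v L' e p, [/\ corner v L', all2P upar L L', upar e0 e,
    walk v p (src e) & size p = n]).
  have [w W] := walk_connected v1 (src e0).
  by exists (size w), v1, L1, e0, w; split=> //; exact: upar_refl.
have eL : allP (cross e) L'.
  by apply: allP_all2 LL' e0L => f f' /cross_upar ff'
    /(cross_upar ee)/cross_sym/ff'/cross_sym.
have [/(allP_and eL) vL sqL] := cL.
case: p => [|g p] in W sz *.
  rewrite /= in W; subst v; exists (src e), (e :: L').
  split; last by [].
  split; first by split; last case: cL.
  split; last by case: cL.
  by apply: allPW vL => f [ef sf]; apply: cross_square.
have nxt e' q : upar e0 e' -> walk v q (src e') -> (n <= size q)%N.
  by move=> ee' Wq; apply: min; exists v, L', e', q.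
have nev : ~ halfspace e v.
  move=> ev; have [|a [f [b [E ef]]]] := crossing_split (e := e) W.
    by move=> [/(_ ev) + _]; apply: halfspace_src.
  have Wf : walk v a (src f).
    by move: W; rewrite E => /walk_cat[s [Wa [-> _]]].
  have := nxt _ _ (upar_trans ee ef) Wf.
  by rewrite -sz E size_cat /=; lia.
have cl : closest v e (g :: p).
  split=> // e' q ee' Wq; rewrite sz; apply: nxt Wq.
  by apply: upar_trans ee _; left.
have eg := closest_nested nev cl (a := [::]) erefl.
have {vL} /allP_all2P[L2 L'L2] :
    allP (fun f => exists f2, par f f2 /\ exists g', square f g f2 g') L'.
  apply: allPW vL => f [ef sf]; have [sg _] := W.
  have [f2 [g' S]] : exists f2 g', square f g f2 g'.
    apply: contrapT => nS; have gf : halfspace g `<=` halfspace (inv f).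
      apply: halfspace_nested; rewrite ?tgt_inv ?invK ?sf //.
      by move=> E; subst f; exact: cross_irr ef.
    case: ef => _ _ + _; apply; apply: (subset_trans eg).
    by rewrite -halfspace_inv.
  by exists f2; split; [exact: par_square S|exists g'].
have cL2 : corner (tgt g) L2.
  split.
    by apply: allP_all2 L'L2 (proj1 cL) => f f2 [_ [g' /square_srcl]].
  apply: pairP_all2 L'L2 sqL => f f2 h h2 [_ [g1 S1]] [_ [g2 S2]] [f' [h' S]].
  have [e3 [f3 [g3 [S3 _ _]]]] := square_cube S1 S (square_sym S2).
  by exists e3, g3.
have: (n <= size p)%N.
  apply: min; exists (tgt g), L2, e, p; split=> //; last by case: W.
  by apply: all2P_trans LL' L'L2 => f f1 f2 ff1 [+ _]; move/or_introl/(upar_trans ff1).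
by rewrite -sz /=; lia.
Qed.

Lemma cross_size (v0 : V) L : pairP cross L -> (size L <= dimension C)%N.
Proof.
by move=> /(cross_corner v0)[v [L' [/corner_size cL /all2P_size ->]]].
Qed.

(** Induction on the halfspaces of [U] that miss [x]. One that is nearest to [x] is dual to an edge
    at [x], and crossing this edge decreases the set. *)
Lemma orientation_vertex (U : set (set V)) (x : V) :
  (forall e f, halfspace e `<=` halfspace f -> U (halfspace e) -> U (halfspace f)) ->
  (forall e, U (halfspace e) \/ U (~` halfspace e)) ->
  (forall e, ~ (U (halfspace e) /\ U (~` halfspace e))) ->
  finite_set [set h | [/\ exists e, h = halfspace e, U h & ~ h x]] ->
  exists z, forall e, U (halfspace e) <-> halfspace e z.
Proof.
move=> up tot cons fin.
set D := fun y : V => [set h | [/\ exists e, h = halfspace e, U h & ~ h y]].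
rewrite -/(D x) in fin; have [A DA] : exists A, A = D x by eexists.
rewrite -DA in fin; elim/finite_set_proper_ind: fin x DA => {}A _ IH x DA.
have [[h [[e he] Uh hx]]|no] := pselect (exists h, D x h); last first.
  exists x => e; split=> [Ue|ex].
    by apply: contrapT => nex; apply: no; exists (halfspace e); split=> //; exists e.
  case: (tot e) => // Ue; case: no; exists (~` halfspace e); split=> //.
  by exists (inv e); rewrite halfspace_inv.
have [|n [e1 [p [Ue nx W sz]]] min] := @ex_least (fun n => exists e p,
    [/\ U (halfspace e), ~ halfspace e x, walk x p (src e) & size p = n]).
  have [w W] := walk_connected x (src e).
  by exists (size w), e, w; subst h.
have cl : closest x e1 p.
  split=> // e' q /halfspace_par ee' Wq; rewrite sz; apply: min.
  by exists e', q; rewrite -ee'.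
(* With an empty walk, [x] is the source of [e1], and the step to [tgt e1] changes only this
   halfspace. Otherwise the first edge [g] bounds a larger halfspace, again in [U] and missing [x],
   at distance 0. *)
case: p => [|g p] in W sz cl.
  rewrite /= in W; subst x; apply: (IH (D (tgt e1)) _ (tgt e1) erefl).
  rewrite DA; split=> [k [[f kf] Uk nk]|].
    split=> //; [by exists f|move=> ks; subst k].
    have [||a [f' [b [E ff']]]] := crossing_split (e := f) (x := src e1)
      (w := [:: e1]) (y := tgt e1) => //; first by move=> [/(_ ks)].
    case: a E => [|? []] //= [E _]; subst f'.
    case: (upar_halfspace ff') => E; rewrite E in ks nk Uk.
      by apply: nk; apply: halfspace_tgt.
    by apply: (cons e1).
  move/(_ (halfspace e1)) => []; last by move=> _ _; apply; apply: halfspace_tgt.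
  by split=> //; exists e1.
have eg := closest_nested nx cl (a := [::]) erefl.
have: (n <= 0)%N.
  apply: min; exists g, [::]; split=> //; first exact: up eg Ue.
    by case: W => <- _; apply: halfspace_src.
  by case: W.
by rewrite -sz.
Qed.

Lemma halfspace_separate (x y : V) : (forall e, halfspace e x <-> halfspace e y) -> x = y.
Proof.
move=> xy; have [w /walk_nf W] := walk_connected x y.
have red := @nf_reduced _ w; case: (nf w) red W => [//|e v] red W.
have [nx ey] := @reduced_crossing _ x [::] e v y red W.
by case: nx; apply/xy.
Qed.

Lemma halfspace_crossed (x y : V) : finite_set [set h |
  [/\ exists e, h = halfspace e, h x & ~ h y]].
Proof.
have [w W] := walk_connected x y.
apply: (@sub_finite_set _ _ [set h | exists2 f, List.In f w &
   h = halfspace f \/ h = ~` halfspace f]).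
  move=> h [[e ->] ex ey]; have [|a [f [b [-> ef]]]] := crossing_split (e := e) W.
    by move=> [/(_ ex)].
  exists f; last exact: upar_halfspace.
  by elim: a {W} => [|g a IH]; [left|right].
elim: w {W} => [|f w IH].
  by apply: (@sub_finite_set _ _ set0) => // h [].
apply: (@sub_finite_set _ _ ([set halfspace f; ~` halfspace f] `|`
   [set h | exists2 f, List.In f w & h = halfspace f \/ h = ~` halfspace f])).
  move=> h [g [<-|gw] hg]; first by left.
  by right; exists g.
by rewrite finite_setU.
Qed.

End Dimension.

Section Automorphisms.
Context {C : cat0_skeleton}.
Local Notation E := (edge C).
Local Notation V := (vert C).

Definition skeleton_map (fV : V -> V) (fE : E -> E) : Prop :=
  [/\ forall e, src (fE e) = fV (src e), forall e, fE (inv e) = inv (fE e) &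
      forall e f e' f', square e f e' f' -> square (fE e) (fE f) (fE e') (fE f')].

Lemma skeleton_map_walk fV fE x w y : skeleton_map fV fE ->
  walk x w y -> walk (fV x) (map fE w) (fV y).
Proof.
move=> [fs fi _]; elim: w x => [|e w IH] x /=; first by move=> ->.
by move=> [<- /IH]; rewrite fs -(src_inv (fE e)) -fi fs src_inv.
Qed.

Lemma skeleton_map_upar fV fE e f :
  skeleton_map fV fE -> upar e f -> upar (fE e) (fE f).
Proof.
move=> [_ fi fs]; rewrite /upar -fi.
suff H g g' : par g g' -> par (fE g) (fE g') by move=> [] /H; [left|right].
move=> [p [p' T]]; exists (map fE p), (map fE p').
elim: p g p' T => [|k p IH] g [|k' p'] //=; first by move=> ->.
by move=> [g1 /fs S /IH T]; exists (fE g1).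
Qed.

Lemma skeleton_map_halfspace fV fE gV gE e y :
  skeleton_map fV fE -> skeleton_map gV gE -> cancel fE gE ->
  halfspace (fE e) (fV y) <-> halfspace e y.
Proof.
move=> fm gm fK.
have [w W] := walk_connected (tgt e) y.
suff H : `[<halfspace (fE e) (fV y)>] = `[<halfspace e y>].
  by split=> /asboolP; [rewrite H|rewrite -H] => /asboolP.
have Wf : walk (tgt (fE e)) (map fE w) (fV y).
  have := skeleton_map_walk fm W; case: fm => fs fi _.
  by rewrite -(src_inv (fE e)) -fi fs src_inv.
rewrite (halfspaceE W) (halfspaceE Wf) /count_par count_map; congr (~~ odd _).
apply: eq_count => g /=; apply: asbool_equiv_eq; split.
  by move/(skeleton_map_upar gm); rewrite !fK.
by move/(skeleton_map_upar fm).
Qed.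

End Automorphisms.

(** * Groups and invariant orientations *)

Lemma infinite_distinct_seq T (A : set T) n : infinite_set A ->
  exists L, [/\ allP A L, pairP (fun x y => x <> y) L & size L = n].
Proof.
move=> infA; elim: n => [|n [L [AL dL <-]]]; first by exists [::].
suff [x Ax xL] : exists2 x, A x & allP (fun y => x <> y) L by exists (x :: L).
apply: contrapT => H; apply: infA.
have finL : finite_set [set x | ~ allP (fun y => x <> y) L].
  elim: L {AL dL H} => [|y L IH].
    by apply: (@sub_finite_set _ _ set0) => // x /= /(_ I).
  apply: (@sub_finite_set _ _ ([set y] `|` [set x | ~ allP (fun y => x <> y) L])).
    move=> x /= H; have [->|xy] := pselect (x = y); first by left.
    by right=> H'; apply: H.
  by rewrite finite_setU.
apply: sub_finite_set finL => x Ax xL; apply: H.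
by exists x.
Qed.

Lemma finite_set_bounded T (A : set T) n :
  (forall L, allP A L -> pairP (fun x y => x <> y) L -> (size L <= n)%N) ->
  finite_set A.
Proof.
move=> H; apply: contrapT => /(infinite_distinct_seq n.+1)[L [AL dL sL]].
by have := H L AL dL; rewrite sL ltnn.
Qed.

Lemma allP_In T (P : T -> Prop) s : (forall x, List.In x s -> P x) <-> allP P s.
Proof.
elim: s => [|x s IH] /=; first by split.
split=> [H|[Px /IH H] y [<-//|/H]//].
by split; [apply: H; left|apply/IH => y ys; apply: H; right].
Qed.

Lemma finite_set_In T (s : seq T) : finite_set [set x | List.In x s].
Proof.
elim: s => [|x s IH] /=; first by apply: (@sub_finite_set _ _ set0).
rewrite (_ : mkset _ = [set x] `|` [set y | List.In y s]) ?finite_setU //.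
by apply/seteqP; split=> y /= [<-|]; by [left|right].
Qed.

(* Ramsey's theorem for a triangle-free graph. *)
Lemma finite_triangle_free T (A : set T) (opp : T -> T -> Prop) n :
  (forall x y, opp x y -> opp y x) ->
  (forall x y z, A x -> A y -> A z -> opp x y -> opp x z -> opp y z -> False) ->
  (forall L, allP A L -> pairP (fun x y => x <> y /\ ~ opp x y) L ->
    (size L <= n)%N) -> finite_set A.
Proof.
move=> sym tri bnd.
(* Minimising [n - size M] selects a largest list of pairwise non-adjacent elements; [bnd] ensures
   that the subtraction does not truncate. Every element of [A] is then in [M] or adjacent to a
   member of [M]. *)
have [|k [M [AM M1 sM]] max] := @ex_least (fun k => exists M,
  [/\ allP A M, pairP (fun x y => x <> y /\ ~ opp x y) M & k = (n - size M)%N]).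
  by exists n, [::]; split=> //; rewrite subn0.
have fin1 x : A x -> finite_set [set y | A y /\ opp x y].
  move=> Ax; apply: (@finite_set_bounded _ _ n) => L AL dL; apply: bnd.
    by apply: allPW AL => y [].
  elim: L AL dL => //= y L IH [[Ay xy] AL] [yL /(IH AL) ?]; split=> //.
  apply: allPW (allP_and AL yL) => z [[Az xz] nyz]; split=> // yz.
  exact: tri xy xz yz.
apply: (@sub_finite_set _ _ ([set x | List.In x M] `|`
   \bigcup_(x in [set x | List.In x M]) [set y | A y /\ opp x y])).
  move=> x Ax; have [xM|nM] := pselect (List.In x M); first by left.
  have [[y yM yx]|nopp] := pselect (exists2 y, List.In y M & opp y x).
    by right; exists y.
  have xMs : pairP (fun x y => x <> y /\ ~ opp x y) (x :: M).
    split=> //; apply/allP_In => y yM; split=> [xy|/sym yx].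
      by apply: nM; rewrite xy.
    by apply: nopp; exists y.
  have AxM : allP A (x :: M) by [].
  have sz : (size M < n)%N := bnd _ AxM xMs.
  have /= := max _ (ex_intro _ (x :: M) (And3 AxM xMs erefl)).
  by rewrite sM; lia.
rewrite finite_setU; split; first exact: finite_set_In.
apply: bigcup_finite; first exact: finite_set_In.
by move=> x xM; apply: fin1; move/allP_In: AM; apply.
Qed.

Section FiniteIndex.
Context {G : groupType}.
Local Open Scope group_scope.
Implicit Types (A B : set G) (g h : G).

Lemma subgroup_setI A B : subgroup A -> subgroup B -> subgroup (A `&` B).
Proof.
move=> [A1 AM AV] [B1 BM BV]; split=> //.
  by move=> x y [Ax Bx] [Ay By]; split; [exact: AM|exact: BM].
by move=> x [Ax Bx]; split; [exact: AV|exact: BV].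
Qed.

Lemma coset_eq A g h : subgroup A -> A (g^-1 * h) ->
  [set g * a | a in A] = [set h * a | a in A].
Proof.
move=> [A1 AM AV] Agh; apply/seteqP; split=> _ [a Aa <-].
  exists (h^-1 * g * a); last by rewrite !mulgA mulgV mul1g.
  by apply: AM Aa; rewrite -[g]invgK -invgM; apply: AV.
exists (g^-1 * h * a); last by rewrite !mulgA mulgV mul1g.
exact: AM Aa.
Qed.

Lemma coset_eqP A g h : subgroup A ->
  [set g * a | a in A] = [set h * a | a in A] -> A (g^-1 * h).
Proof.
move=> [A1 AM AV] E; have : [set h * a | a in A] h by exists 1; rewrite ?mulg1.
by rewrite -E => -[a Aa <-]; rewrite mulgA mulVg mul1g.
Qed.

Lemma finite_index_fibers T (f : G -> T) A : subgroup A -> finite_set (range f) ->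
  (forall g h, f g = f h -> A (g^-1 * h)) -> finite_index A.
Proof.
move=> sA fin H.
pose k t := [set xget 1 [set g | f g = t] * a | a in A].
apply: sub_finite_set (finite_image k fin) => _ [g _ <-].
exists (f g) => //; rewrite /k; apply: coset_eq => //; apply: H.
exact: (@xgetPex _ 1 [set g' | f g' = f g] (ex_intro _ g erefl)).
Qed.

Lemma finite_index_setI A B : subgroup A -> subgroup B ->
  finite_index A -> finite_index B -> finite_index (A `&` B).
Proof.
move=> sA sB fA fB.
apply: (@finite_index_fibers _
  (fun g => ([set g * a | a in A], [set g * b | b in B]))).
- exact: subgroup_setI.
- apply: sub_finite_set (finite_setX fA fB) => _ [g _ <-].
  by split; exists g.
- by move=> g h [/(coset_eqP sA) ? /(coset_eqP sB)].
Qed.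

Context {T : Type} (act : G -> T -> T) (actP : group_action act).

Lemma actK g : cancel (act g) (act g^-1).
Proof. by case: actP => a1 aM x; rewrite -aM mulVg a1. Qed.

Lemma actVK g : cancel (act g^-1) (act g).
Proof. by case: actP => a1 aM x; rewrite -aM mulgV a1. Qed.

Definition stabilizer x : set G := [set g | act g x = x].

Lemma stabilizer_subgroup x : subgroup (stabilizer x).
Proof.
case: (actP) => a1 aM; split; rewrite /stabilizer /=; first exact: a1.
  by move=> g h /= gx hx; rewrite aM hx gx.
by move=> g /= gx; rewrite -{1}gx actK.
Qed.

Lemma stabilizer_finite_index x :
  finite_set [set act g x | g in [set: G]] -> finite_index (stabilizer x).
Proof.
move=> fin; apply: (finite_index_fibers (stabilizer_subgroup x) fin) => g h /= E.
by case: (actP) => a1 aM; rewrite /stabilizer /= aM -E actK.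
Qed.

(** The full orbit is covered by the translates of the orbit of [A] under the chosen representatives
    [r K] of the finitely many cosets. *)
Lemma finite_orbit A x : subgroup A -> finite_index A ->
  finite_set [set act g x | g in A] -> finite_set [set act g x | g in [set: G]].
Proof.
move=> sA fA fO; pose r (K : set G) := xget 1 K.
apply: sub_finite_set (finite_image2 act (finite_image r fA) fO) => _ [g _ <-].
pose K := [set g * a | a in A].
have [a Aa E] : K (r K).
  by apply: xgetPex; exists g; exists 1; rewrite ?mulg1; case: sA.
exists (r K); first by exists K => //; exists g.
exists (act (r K)^-1 (act g x)); last exact: actVK.
case: (actP) => a1 aM; exists ((r K)^-1 * g); last by rewrite aM.
by rewrite -E invgM -mulgA mulVg mulg1; case: sA => _ _; apply.
Qed.

End FiniteIndex.

(** * Abstract halfspaces: ordered sets with complementation *)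

Record pocset := Pocset {
  pocset_sort :> Type;
  le : pocset_sort -> pocset_sort -> Prop;
  st : pocset_sort -> pocset_sort;
  le_refl : forall h, le h h;
  le_anti : forall h k, le h k -> le k h -> h = k;
  le_trans : forall k h l, le h k -> le k l -> le h l;
  stK : involutive st;
  le_st2 : forall h k, le h k -> le (st k) (st h);
  le_not_st : forall h k, le h k -> ~ le h (st k);
  finite_interval : forall h k, finite_set [set l | le h l /\ le l k]
}.

Section Pocset.
Context {P : pocset}.
Implicit Types (h k l : P) (U W : set P) (c d : nat -> P).

Lemma le_stl h k : le (st h) k -> le (st k) h.
Proof. by move/le_st2; rewrite stK. Qed.

Lemma le_str h k : le h (st k) -> le k (st h).
Proof. by move/le_st2; rewrite stK. Qed.

Definition transverse h k :=
  [/\ ~ le h k, ~ le k h, ~ le h (st k) & ~ le (st h) k].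

Lemma transverse_sym h k : transverse h k -> transverse k h.
Proof. by move=> [h1 h2 h3 h4]; split=> // [/le_str|/le_stl]. Qed.

(* Members of a filter are pairwise non-disjoint: [st] is complementation. *)
Definition filtering U :=
  (forall h k, U h -> le h k -> U k) /\ (forall h k, U h -> U k -> ~ le h (st k)).

Definition undecided U h := ~ U h /\ ~ U (st h).

Lemma undecided_st U h : undecided U h -> undecided U (st h).
Proof. by move=> [a b]; split; rewrite ?stK. Qed.

Lemma undS U W h : U `<=` W -> undecided W h -> undecided U h.
Proof. by move=> UW [a b]; split=> /UW. Qed.

Definition dim_le U n := forall L, allP (undecided U) L -> pairP transverse L ->
  (size L <= n)%N.

(** The third clause keeps every undecided element from lying strictly below the whole sequence. It
    holds for a constant sequence at a minimal undecided element, and for a strictly descending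
    sequence, which has no lower bound since intervals are finite. *)
Definition chain U c := [/\ forall i, undecided U (c i), forall i, le (c i.+1) (c i) &
  forall k, undecided U k -> (forall i, le k (c i)) -> exists i, le (c i) k].

(* The limit of a descending sequence. *)
Definition germ c : set P := [set k | exists i, le (c i) k].

Lemma chain_mono U c i j : chain U c -> (i <= j)%N -> le (c j) (c i).
Proof.
move=> [_ dec _]; elim: j => [|j IH]; first by rewrite leqn0 => /eqP ->; apply: le_refl.
rewrite leq_eqVlt => /orP[/eqP ->|/IH]; first exact: le_refl.
exact: le_trans (dec j).
Qed.

Lemma injective_seq_infinite T (A : set T) (c : nat -> T) :
  injective c -> (forall i, A (c i)) -> infinite_set A.
Proof.
move=> ic Ac finA; apply: infinite_nat.
have <- : c @^-1` A = [set: nat] by apply/seteqP; split=> // i _; apply: Ac.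
by apply: finite_preimage finA => i j _ _ /ic.
Qed.

Lemma strict_chain_inj c : (forall i, le (c i.+1) (c i)) ->
  (forall i, ~ le (c i) (c i.+1)) -> injective c.
Proof.
move=> dec str.
have mono i j : (i <= j)%N -> le (c j) (c i).
  elim: j => [|j IH]; first by rewrite leqn0 => /eqP ->; apply: le_refl.
  rewrite leq_eqVlt => /orP[/eqP ->|/IH]; first exact: le_refl.
  exact: le_trans (dec j).
move=> i j E; case: (ltngtP i j) => // /mono; first by rewrite -E => /str.
by rewrite E => /str.
Qed.

Lemma strict_chain_Q c k : (forall i, le (c i.+1) (c i)) ->
  (forall i, ~ le (c i) (c i.+1)) -> ~ (forall i, le k (c i)).
Proof.
move=> dec str kc; apply: (injective_seq_infinite (strict_chain_inj dec str)).
  move=> i; instantiate (1 := [set l | le k l /\ le l (c 0)]); split=> //.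
  by elim: i => [|i IH]; [exact: le_refl|exact: le_trans IH].
exact: finite_interval.
Qed.

Lemma chain_ex U h0 : undecided U h0 -> exists c, chain U c.
Proof.
move=> uh0.
have [[h [uh hmin]]|nomin] :=
    pselect (exists h, undecided U h /\ forall k, undecided U k -> le k h -> le h k).
  exists (fun=> h); split=> // [i|k uk /(_ 0)]; first exact: le_refl.
  by exists 0; apply: hmin.
have step h : exists k, undecided U h -> [/\ undecided U k, le k h & ~ le h k].
  have [uh|] := pselect (undecided U h); last by exists h.
  apply: contrapT => H; apply: nomin; exists h; split=> // k uk kh.
  by apply: contrapT => nhk; apply: H; exists k.
have [f fP] := choice step; pose c i := iter i f h0.
have uc i : undecided U (c i) by elim: i => // i /fP[].
have dec i : le (c i.+1) (c i) by case: (fP _ (uc i)).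
have str i : ~ le (c i) (c i.+1) by case: (fP _ (uc i)).
by exists c; split=> // k uk /(strict_chain_Q dec str).
Qed.

Lemma filtering_germ U c : filtering U -> chain U c -> filtering (U `|` germ c).
Proof.
move=> [up cons] cc; have [uc _ _] := cc; split.
  move=> h k [Uh|[i ih]] hk; first by left; apply: up hk.
  by right; exists i; apply: le_trans hk.
have aux h k : U h -> germ c k -> ~ le h (st k).
  by move=> Uh [i ik] hk; case: (uc i) => _; apply; apply: up Uh (le_trans hk (le_st2 ik)).
move=> h k [Uh|gh] [Uk|gk]; [exact: cons|exact: aux|by move/le_str; apply: aux|].
case: gh gk => i ih [j jk] hk.
have [a b] := (chain_mono cc (leq_maxl i j), chain_mono cc (leq_maxr i j)).
apply: (@le_not_st _ (c (maxn i j)) (c (maxn i j))); first exact: le_refl.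
exact: le_trans a (le_trans ih (le_trans hk (le_trans (le_st2 jk) (le_st2 b)))).
Qed.

(** No [c i] is below [k] or [st k], as these are outside the limit; neither of these is below all
    [c i], by the third clause of [chain]. Hence a late term can be added to any transverse family
    that the limit leaves undecided, which is the drop of dimension. *)
Lemma undecided_germ U c k : chain U c -> undecided (U `|` germ c) k ->
  exists I, forall i, (I <= i)%N -> transverse k (c i).
Proof.
move=> cc [nk nsk]; have [uc _ Q] := cc.
have [uk usk] : ~ U k /\ ~ U (st k) by split=> ?; [apply: nk|apply: nsk]; left.
have gk i : ~ le (c i) k by move=> ik; apply: nk; right; exists i.
have gsk i : ~ le (c i) (st k) by move=> ik; apply: nsk; right; exists i.
have [i0 H0] : exists i, ~ le k (c i).
  by apply/existsNP => H; have [|i /gk] := Q k _ H.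
have [i1 H1] : exists i, ~ le (st k) (c i).
  by apply/existsNP => H; have [|i /gsk] := Q (st k) _ H => //; apply: undecided_st.
exists (maxn i0 i1) => i; rewrite geq_max => /andP[le0 le1]; split=> //.
- by move=> H; apply: H0; apply: le_trans H (chain_mono cc le0).
- by move/le_str/gsk.
- by move=> H; apply: H1; apply: le_trans H (chain_mono cc le1).
Qed.

Lemma undecided_germ_seq U c L : chain U c -> allP (undecided (U `|` germ c)) L ->
  exists I, forall i, (I <= i)%N -> allP (transverse (c i)) L.
Proof.
move=> cc; elim: L => [|k L IH] /=; first by exists 0.
move=> [/(undecided_germ cc)[I HI] /IH[J HJ]]; exists (maxn I J) => i.
by rewrite geq_max => /andP[/HI/transverse_sym ? /HJ].
Qed.

Lemma dim_le_germ U c n : chain U c -> dim_le U n -> dim_le (U `|` germ c) n.-1.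
Proof.
move=> cc dimU L uL tL; have [I /(_ I (leqnn I)) cL] := undecided_germ_seq cc uL.
suff: (size (c I :: L) <= n)%N by rewrite /=; lia.
apply: dimU; split=> //; first by case: cc.
by apply: allPW uL => k; apply: undS => l; left.
Qed.

Lemma germ_lt U c d : chain U c -> chain U d -> filtering U ->
  ~ germ d `<=` U `|` germ c ->
  (forall h, germ d h -> ~ germ c (st h)) ->
  exists J, forall j, (J <= j)%N -> undecided (U `|` germ c) (d j).
Proof.
move=> cc cd fU /existsNP[k /not_implyP[[j jk] nk]] nopp.
have [upF _] := filtering_germ fU cc.
exists j => j' jj'; have le_j := chain_mono cd jj'; split.
  by move=> H; apply: nk; apply: upF H (le_trans le_j jk).
case=> [|H]; first by case: cd => /(_ j')[].
by apply: nopp H; exists j'; apply: le_refl.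
Qed.

(** Two limits that do not contain one another and hold no complementary elements are in the
    position of crossing halfspaces: the late terms of each are undecided for the other. *)
Lemma germ_transverse U c d : chain U c -> chain U d -> filtering U ->
  ~ germ d `<=` U `|` germ c -> ~ germ c `<=` U `|` germ d ->
  (forall h, germ d h -> ~ germ c (st h)) ->
  exists M, forall i, (M <= i)%N -> transverse (c i) (d i).
Proof.
move=> cc cd fU ndc ncd nopp.
have [J HJ] := germ_lt cc cd fU ndc nopp.
have [I HI] := germ_lt cd cc fU ncd (fun h gc gd => nopp (st h) gd
  (eq_rect_r (germ c) gc (stK h))).
have [I' HI'] := undecided_germ cc (HJ J (leqnn J)).
exists (maxn (maxn I I') J) => i; rewrite !geq_max -andbA => /and3P[i1 i2 i3].
have [t1 t2 t3 t4] := HI' i i2; have ij := chain_mono cd i3.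
split.
- by move=> H; apply: t2; apply: le_trans H ij.
- by move=> H; case: (HI i i1) => + _; apply; right; exists i.
- move=> H; apply: (nopp (d i)); first by exists i; apply: le_refl.
  by exists i.
- by move=> /le_stl H; apply: t4; apply/le_stl; apply: le_trans (le_stl H) ij.
Qed.

End Pocset.

Definition pocset_action (G : groupType) (P : pocset) (act : G -> P -> P) :=
  [/\ group_action act, forall g h k, le h k -> le (act g h) (act g k) &
      forall g h, act g (st h) = st (act g h)].

Section Action.
Context {G : groupType} {P : pocset} {act : G -> P -> P}.
Context (actP : pocset_action act).
Local Open Scope group_scope.
Implicit Types (A : set G) (g : G) (h k l : P) (U W F : set P) (c d : nat -> P).

Let act1 h : act 1 h = h. Proof. by case: actP => [[]]. Qed.
Let actM g g' h : act (g * g') h = act g (act g' h).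
Proof. by case: actP => [[]]. Qed.
Let actK' g : cancel (act g) (act g^-1).
Proof. by case: actP => gP _ _; apply: actK. Qed.
Let actVK' g : cancel (act g^-1) (act g).
Proof. by case: actP => gP _ _; apply: actVK. Qed.

Lemma act_le g h k : le h k -> le (act g h) (act g k).
Proof. by case: actP => _ + _; apply. Qed.

Lemma act_st g h : act g (st h) = st (act g h).
Proof. by case: actP. Qed.

Lemma act_leV g h k : le (act g h) k <-> le h (act g^-1 k).
Proof. by split=> [/(act_le g^-1)|/(act_le g)]; rewrite ?actK' ?actVK'. Qed.

Definition invariant A U := forall g h, A g -> U h -> U (act g h).

(** An undecided [h] could be adjoined together with all its translates, unless two translates are
    disjoint; moving one of them back gives [act g h] below [st h]. *)
Lemma maximal_filter A U : subgroup A -> filtering U -> invariant A U ->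
  exists W, [/\ U `<=` W, filtering W, invariant A W &
    forall h, undecided W h -> exists2 g, A g & le (act g h) (st h)].
Proof.
move=> [A1 AM AV] fU iU.
(* Zorn's lemma is applied to the sets [M] that may be added to [U]: in this form the empty chain,
   whose union is empty, is accounted for by [U] itself. *)
have [|M [[fM iM] maxM]] :=
    @Zorn_bigcup P [set M | filtering (U `|` M) /\ invariant A (U `|` M)].
  move=> F FP tot; have [->|/set0P[M0 FM0]] := eqVneq F set0.
    by rewrite /= bigcup_set0 setU0.
  have mem h : (U `|` \bigcup_(X in F) X) h -> exists2 X, F X & (U `|` X) h.
    by case=> [Uh|[X FX Xh]]; [exists M0 => //; left|exists X => //; right].
  have inc X : F X -> U `|` X `<=` U `|` \bigcup_(X in F) X.
    by move=> FX h [Uh|Xh]; [left|right; exists X].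
  split; first split.
  - move=> h k /mem[X FX Xh] hk; apply: (inc X FX).
    by case: (FP X FX) => [[up _] _]; apply: up hk.
  - move=> h k /mem[X FX Xh] /mem[Y FY Yk].
    have [XY|YX] := tot X Y FX FY.
      by case: (FP Y FY) => [[_ cons] _]; apply: cons => //; case: Xh => [|/XY]; [left|right].
    by case: (FP X FX) => [[_ cons] _]; apply: cons => //; case: Yk => [|/YX]; [left|right].
  - by move=> g h Ag /mem[X FX Xh]; apply: (inc X FX); case: (FP X FX) => _; apply.
exists (U `|` M); split; [exact: subsetUl|exact: fM|exact: iM|].
set W := U `|` M in fM iM *; have [up cons] := fM.
move=> h [nh nsh]; apply: contrapT => no.
pose B := M `|` [set k | exists2 g, A g & le (act g h) k].
apply: (maxM B).
  split; first by move=> k; left.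
  by move=> /(_ h) H; apply: nh; right; apply: H; right; exists 1; rewrite ?act1 //; apply: le_refl.
have UB : U `|` B = W `|` [set k | exists2 g, A g & le (act g h) k].
  by rewrite setUA.
rewrite /= UB; have aux u k g : W u -> A g -> le (act g h) k -> ~ le u (st k).
  move=> Wu Ag hk uk; apply: nsh.
  rewrite -(actK' g (st h)) act_st; apply: iM; first exact: AV.
  exact: up Wu (le_trans uk (le_st2 hk)).
split; first split.
- move=> k l [Wk|[g Ag hk]] kl; first by left; apply: up kl.
  by right; exists g => //; apply: le_trans kl.
- move=> k l [Wk|[g Ag hk]] [Wl|[g' Ag' hl]]; [exact: cons|exact: aux Wk Ag' hl| |].
    by move/le_str; apply: aux Wl Ag hk.
  move=> kl; apply: no; exists (g'^-1 * g); first by apply: AM => //; apply: AV.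
  rewrite actM -[st h](actK' g') act_st; apply: act_le.
  exact: le_trans hk (le_trans kl (le_st2 hl)).
- move=> g k Ag [Wk|[g' Ag' hk]]; first by left; apply: iM.
  by right; exists (g * g'); [exact: AM|rewrite actM; apply: act_le].
Qed.

(* [Ap] and [Am] are the attracting and repelling halfspaces of [a], and [Bp],
   [Bm] those of [b]. *)
Lemma ping_pong a b Ap Am Bp Bm :
  le Ap (st Am) -> le Ap (st Bp) -> le Ap (st Bm) -> le Am (st Bp) ->
  le Am (st Bm) -> le Bp (st Bm) ->
  le (act a (st Am)) Ap -> le (act b (st Bm)) Bp ->
  contains_nonabelian_free_subgroup G.
Proof.
move=> d1 d2 d3 d4 d5 d6 aA bB.
have ab : a <> b.
  move=> E; subst b.
  have H1 : le (act a Ap) Ap by apply: le_trans (act_le a d1) aA.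
  have H2 : le (act a Ap) Bp by apply: le_trans (act_le a d3) bB.
  exact: (le_not_st H1) (le_trans H2 (le_str d2)).
pose S := [set a; b].
(* [D p] is the halfspace that attracts the letter [p], and [v p] its value. A letter maps
   everything outside the domain of its inverse into its own domain. *)
pose D (p : G * bool) := if p.1 == a then (if p.2 then Ap else Am)
  else (if p.2 then Bp else Bm).
pose v (p : G * bool) := if p.2 then p.1 else p.1^-1.
pose opp (p : G * bool) := (p.1, ~~ p.2).
have ba : (b == a) = false by apply/eqP => E; apply: ab.
have vD p : S p.1 -> le (act (v p) (st (D (opp p)))) (D p).
  case: p => x [] /= [] ->; rewrite /v /D /= ?eqxx ?ba //.
    by rewrite act_leV invgK; apply/le_stl; rewrite -act_st.
  by rewrite act_leV invgK; apply/le_stl; rewrite -act_st.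
have DD p q : S p.1 -> S q.1 -> p <> q -> le (D p) (st (D q)).
  case: p q => x s [y t] /= [] -> [] ->; rewrite /D /= ?eqxx ?ba;
  by case: s t => [] [] // _; apply/le_str.
have main w p : S p.1 -> (forall q, q \in w -> S q.1) -> reduced (p :: w) ->
    forall q, S q.1 -> q <> opp (last p w) -> le (act (word_value (p :: w)) (D q)) (D p).
  elim: w p => [|p2 w IH] p Sp Sw red q Sq nq.
    rewrite /word_value big_seq1; apply: le_trans (vD p Sp).
    by apply/act_le/DD.
  move: red; rewrite /reduced /= => /andP[pp2 red].
  have Sp2 : S p2.1 by apply: Sw; rewrite inE eqxx.
  rewrite /word_value big_cons actM; apply: le_trans (vD p Sp); apply: act_le.
  apply: le_trans (IH p2 Sp2 _ red q Sq nq) _.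
    by move=> r rw; apply: Sw; rewrite inE rw orbT.
  apply: DD => // E; move: pp2; rewrite E /opp /= eqxx.
  by case: (p.2).
have free w : reduced w -> w != [::] -> (forall p, p \in w -> S p.1) ->
    word_value w <> 1.
  case: w => // p w red _ Sw E.
  have Sp : S p.1 by apply: Sw; rewrite inE eqxx.
  have Sw' q : q \in w -> S q.1 by move=> qw; apply: Sw; rewrite inE qw orbT.
  (* There are four letters and two exclusions. As [q] is not the inverse of the last letter, the
     word maps [D q] into [D p]; as [q] is not [p], these are disjoint, so the word cannot be
     trivial. *)
  have [q [Sq qp ql]] : exists q, [/\ S q.1, q <> p & q <> opp (last p w)].
    have Sa : S a by left.
    have Sb : S b by right.
    move: (opp _) => r; clear -Sa Sb ab Sp.
    have [E|E] := pselect (a = p.1).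
      have [F|F] := pselect (r = (b, true)).
        by exists (b, false); split=> // H; [apply: ab; rewrite E -H|move: H; rewrite F].
      exists (b, true); split=> // H; [apply: ab; rewrite E -H|exact/F/esym].
      by [].
    have [F|F] := pselect (r = (a, true)).
      by exists (a, false); split=> // H; [apply: E; rewrite -H|move: H; rewrite F].
    by exists (a, true); split=> // H; [apply: E; rewrite -H|exact/F/esym].
  have := main w p Sp Sw' red q Sq ql; rewrite E act1 => /le_not_st; apply.
  exact: DD.
exists (generated S); split.
  split.
    split=> [H [[H1 _ _] _]//|x y Hx Hy H HS|x Hx H HS].
      by case: (HS) => [[_ HM _] _]; apply: HM; [exact: Hx|exact: Hy].
    by case: (HS) => [[_ _ HV] _]; apply: HV; exact: Hx.
  by exists S; split=> // x Sx H [_]; apply.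
have gS x : S x -> generated S x by move=> Sx H [_]; apply.
move=> /(_ a b (gS a (or_introl erefl)) (gS b (or_intror erefl))) cab.
(* If the generators commuted, their commutator would be a nonempty reduced word of value 1. *)
apply: (free [:: (a, true); (b, true); (a, false); (b, false)]) => //.
- by rewrite /reduced /= ba eq_sym ba.
- by move=> p; rewrite !inE => /or4P[] /eqP ->; [left|right|left|right].
- rewrite /word_value !big_cons big_nil /= mulg1 mulgA cab.
  by rewrite -mulgA (mulgA a) mulgV mul1g mulgV.
Qed.

(** The product [f1 * f2] has [h1] as attracting and [h2] as repelling halfspace. Its conjugate by
    [f3] has the images of these, both inside [h3], so all four are pairwise disjoint. *)
Lemma facing_triple_free h1 h2 h3 :
  le h1 (st h2) -> le h1 (st h3) -> le h2 (st h3) ->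
  (forall h, h = h1 \/ h = h2 \/ h = h3 -> exists f, le (act f (st h)) h) ->
  contains_nonabelian_free_subgroup G.
Proof.
move=> d12 d13 d23 flip.
have [f1 F1] := flip h1 (or_introl erefl).
have [f2 F2] := flip h2 (or_intror (or_introl erefl)).
have [f3 F3] := flip h3 (or_intror (or_intror erefl)).
have le3 h : le h (st h3) -> le (act f3 h) h3.
  by move=> hh3; apply: le_trans (act_le _ hh3) F3.
have aA : le (act (f1 * f2) (st h2)) h1.
  rewrite actM; apply: le_trans F1; apply: act_le.
  exact: le_trans F2 (le_str d12).
apply: (@ping_pong (f1 * f2) (f3 * (f1 * f2) * f3^-1) h1 h2 (act f3 h1) (act f3 h2)) => //.
- exact: le_trans d13 (le_st2 (le3 _ d13)).
- exact: le_trans d13 (le_st2 (le3 _ d23)).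
- exact: le_trans d23 (le_st2 (le3 _ d13)).
- exact: le_trans d23 (le_st2 (le3 _ d23)).
- by rewrite -act_st; apply: act_le.
- by rewrite -act_st -actM mulgVK actM; apply: act_le.
Qed.

End Action.
Arguments invariant {G P} act A U.

Lemma allP_map T S (f : T -> S) (Q : S -> Prop) s :
  allP Q (map f s) <-> allP (fun x => Q (f x)) s.
Proof.
by elim: s => //= x s [IH1 IH2]; split=> -[Qx H]; split=> //; [apply: IH1|apply: IH2].
Qed.

Lemma pairP_map T S (f : T -> S) (r : S -> S -> Prop) s :
  pairP r (map f s) <-> pairP (fun x y => r (f x) (f y)) s.
Proof.
by elim: s => //= x s [IH1 IH2]; split=> -[/allP_map xs ss]; split=> //;
  [apply: IH1|apply: IH2].
Qed.

Lemma pairPW T (r r' : T -> T -> Prop) s :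
  (forall x y, r x y -> r' x y) -> pairP r s -> pairP r' s.
Proof.
by move=> H; elim: s => //= x s IH [xs /IH]; split=> //; apply: allPW xs => y /H.
Qed.

Lemma pairP_eventually T (r : nat -> T -> T -> Prop) s :
  pairP (fun x y => exists M, forall i, (M <= i)%N -> r i x y) s ->
  exists M, pairP (r M) s.
Proof.
suff H : pairP (fun x y => exists M, forall i, (M <= i)%N -> r i x y) s ->
    exists M, forall i, (M <= i)%N -> pairP (r i) s.
  by move/H => [M /(_ M (leqnn M))]; exists M.
elim: s => [|x s IH] /=; first by exists 0.
move=> [xs /IH[M HM]].
have [M' HM'] : exists M', forall i, (M' <= i)%N -> allP (r i x) s.
  elim: s xs {IH HM} => [|y s IH] /=; first by exists 0.
  move=> [[a Ha] /IH[b Hb]]; exists (maxn a b) => i.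
  by rewrite geq_max => /andP[/Ha ? /Hb].
by exists (maxn M M') => i; rewrite geq_max => /andP[/HM ? /HM'].
Qed.

(** * An orientation fixed by a subgroup of finite index *)

Section FixedOrientation.
Context {G : groupType} {P : pocset} {act : G -> P -> P}.
Context (actP : pocset_action act).
Local Open Scope group_scope.
Implicit Types (A : set G) (g : G) (h k l : P) (U W F : set P) (c d : nat -> P).

Definition act_set g F : set P := [set k | F (act g^-1 k)].

Lemma act_set_action : group_action act_set.
Proof.
case: actP => [[a1 aM] _ _]; split.
  by move=> F; apply/seteqP; split=> k; rewrite /act_set /= invg1 a1.
by move=> g h F; apply/seteqP; split=> k; rewrite /act_set /= invgM aM.
Qed.

Lemma act_mulgV g h : act g (act g^-1 h) = h.
Proof. by case: actP => aP _ _; apply: actVK. Qed.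

Lemma act_mulVg g h : act g^-1 (act g h) = h.
Proof. by case: actP => aP _ _; apply: actK. Qed.

Lemma act_le_iff g h k : le (act g h) (act g k) <-> le h k.
Proof.
by split=> [/(act_le actP g^-1)|]; [rewrite !act_mulVg|apply: act_le].
Qed.

Lemma act_transverse g h k : transverse h k -> transverse (act g h) (act g k).
Proof. by move=> [t1 t2 t3 t4]; split; rewrite -?(act_st actP) act_le_iff. Qed.

Lemma act_set_st g F h : undecided (act_set g F) h <-> undecided F (act g^-1 h).
Proof. by rewrite /undecided /act_set /= (act_st actP). Qed.

Lemma dim_le_act g F n : dim_le F n -> dim_le (act_set g F) n.
Proof.
move=> dF L uL tL; rewrite -(size_map (act g^-1)); apply: dF.
  by apply/allP_map; apply: allPW uL => h /act_set_st.
by apply/pairP_map; apply: pairPW tL => h k; apply: act_transverse.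
Qed.

Section Germs.
Context (A : set G) (U : set P) (n : nat).
Context (sA : subgroup A) (fA : finite_index A) (fU : filtering U) (iU : invariant act A U).
Context (flip : forall h, undecided U h -> exists2 g, A g & le (act g h) (st h)).
Context (dU : dim_le U n.+1) (noF : ~ contains_nonabelian_free_subgroup G).
Context (m : nat) (minm : forall m', (exists2 c, chain U c & dim_le (U `|` germ c) m') ->
  (m <= m')%N).

Let Om := [set F | exists c, [/\ chain U c, F = U `|` germ c & dim_le F m]].

Let invU g h : A g -> U (act g^-1 h) <-> U h.
Proof.
move=> Ag; split; first by move/(iU Ag); rewrite act_mulgV.
by apply: iU; case: sA => _ _; apply.
Qed.

Lemma chain_act g c : A g -> chain U c -> chain U (act g \o c).
Proof.
move=> Ag [uc dec Q]; split.
- move=> i; case: (uc i) => u1 u2; split; rewrite /= -?(act_st actP).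
    by rewrite -(invU _ Ag) act_mulVg.
  by rewrite -(invU _ Ag) act_mulVg.
- by move=> i; apply: act_le.
- move=> k uk kc; have [||i ik] := Q (act g^-1 k).
  + by case: uk => u1 u2; split; rewrite -?(act_st actP) invU.
  + by move=> i; rewrite -(act_le_iff g) act_mulgV; apply: kc.
  + by exists i; rewrite -(act_le_iff g) act_mulgV in ik.
Qed.

Lemma germs_act g F : A g -> Om F -> Om (act_set g F).
Proof.
move=> Ag [c [cc -> dF]]; exists (act g \o c); split; first exact: chain_act.
  apply/seteqP; split=> k; rewrite /act_set /=.
    case=> [|[i ik]]; first by move/(invU _ Ag); left.
    by right; exists i; rewrite -(act_le_iff g) act_mulgV in ik.
  case=> [|[i ik]]; first by move/(invU _ Ag); left.
  by right; exists i; rewrite -(act_le_iff g) act_mulgV.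
exact: dim_le_act.
Qed.

(** If [F'] were strictly larger, late terms of [d] would be undecided for [F]. They are transverse
    to whatever [F'] leaves undecided, so the dimension of [F'] would be less than the minimum
    [m]. *)
Lemma germs_incl F F' : Om F -> Om F' -> F `<=` F' -> F' `<=` F.
Proof.
move=> [c [cc -> dF]] [d [cd -> dF']] FF'; apply: contrapT => nF.
have ndc : ~ germ d `<=` U `|` germ c.
  by move=> H; apply: nF => h [Uh|/H//]; left.
have [_ cons] := filtering_germ fU cd.
have [|J HJ] := germ_lt cc cd fU ndc.
  move=> h dh csh; apply: (cons h (st h)).
  - by right.
  - by apply: FF'; right.
  - by rewrite stK; apply: le_refl.
have m1 : (0 < m)%N.
  by apply: (dF [:: d J]) => //; split=> //; apply: HJ.
suff : (m <= m.-1)%N by lia.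
apply: minm; exists d => // L uL tL.
have [I HI] := undecided_germ_seq cd uL.
suff: (size (d (maxn I J) :: L) <= m)%N by rewrite /=; lia.
apply: dF; split=> //; [exact/HJ/leq_maxr| |exact/HI/leq_maxl].
by apply: allPW uL => k; apply: undS.
Qed.

Lemma opposite_germs c d h : chain U c -> chain U d ->
  (U `|` germ c) h -> (U `|` germ d) (st h) ->
  exists M, forall i, (M <= i)%N -> le (c i) (st (d i)).
Proof.
move=> cc cd Fc Fd.
have [_ consc] := filtering_germ fU cc; have [_ consd] := filtering_germ fU cd.
have [i ih] : germ c h.
  case: Fc => // Uh; case: (consd h (st h)) => //; first by left.
  by rewrite stK; apply: le_refl.
have [j jh] : germ d (st h).
  case: Fd => // Uh; case: (consc h (st h)) => //; first by left.
  by rewrite stK; apply: le_refl.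
exists (maxn i j) => k; rewrite geq_max => /andP[ik jk].
apply: le_trans (chain_mono cc ik) _; apply: le_trans ih _.
by apply/le_str; apply: le_trans (chain_mono cd jk) jh.
Qed.

(** Two limits are joined when they hold complementary halfspaces. A triangle yields three pairwise
    disjoint halfspaces, hence a free group by [flip]. Pairwise non-joined distinct limits are
    pairwise transverse, by minimality, and their late terms form a transverse family of at most
    [n.+1] undecided halfspaces. *)
Lemma finite_germs : finite_set Om.
Proof.
apply: (@finite_triangle_free _ _ (fun F F' => exists2 h, F h & F' (st h)) n.+1).
- by move=> F F' [h Fh F'h]; exists (st h); rewrite ?stK.
- move=> _ _ _ [c [cc -> _]] [d [cd -> _]] [e [ce -> _]].
  move=> [h1 h1c h1d] [h2 h2c h2e] [h3 h3d h3e].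
  have [M1 H1] := opposite_germs cc cd h1c h1d.
  have [M2 H2] := opposite_germs cc ce h2c h2e.
  have [M3 H3] := opposite_germs cd ce h3d h3e.
  pose M := maxn M1 (maxn M2 M3); apply: noF.
  have [l1 l2 l3] : [/\ M1 <= M, M2 <= M & M3 <= M]%N by rewrite /M; split; lia.
  apply: (facing_triple_free actP (H1 M l1) (H2 M l2) (H3 M l3)) => h hM.
  have uh : undecided U h.
    by case: hM => [->|[->|->]]; [case: cc|case: cd|case: ce].
  by have [f _] := flip (undecided_st uh); rewrite stK; exists f.
- move=> L OL pL.
  have [Lc LLc] := allP_all2P OL.
  have [|M tM] := @pairP_eventually _ (fun i c d => transverse (c i) (d i)) Lc.
    have pL' : pairP (fun F F' => [/\ Om F, Om F', F <> F' &
        ~ exists2 h, F h & F' (st h)]) L.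
      elim: L OL pL {LLc} => //= F L IH [OF OL] pL; have [FL LL] := pL.
      split; last exact: IH.
      by apply: allPW (allP_and OL FL) => F' [? []].
    apply: pairP_all2 LLc pL' => F c F' d [cc Ec dc] [cd Ed dd] [OF OF' FF' nopp].
    apply: (germ_transverse cc cd fU).
    + move=> H; apply: FF'; apply/seteqP; split; last first.
        by rewrite Ec Ed => h [Uh|/H//]; left.
      by apply: germs_incl => //; rewrite Ec Ed => h [Uh|/H//]; left.
    + move=> H; apply: FF'; apply/seteqP; split.
        by rewrite Ec Ed => h [Uh|/H//]; left.
      by apply: germs_incl => //; rewrite Ec Ed => h [Uh|/H//]; left.
    + move=> h dh csh; apply: nopp; exists (st h); first by rewrite Ec; right.
      by rewrite stK Ed; right.
  rewrite (all2P_size LLc) -(size_map (fun c => c M)); apply: dU.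
    by apply/allP_map; apply: allP_all2 LLc OL => F c [[uc _ _] _ _] _; apply: uc.
  by apply/pairP_map.
Qed.

End Germs.

Theorem fixed_orientation A U n : ~ contains_nonabelian_free_subgroup G ->
  subgroup A -> finite_index A -> filtering U -> invariant act A U -> dim_le U n ->
  exists B W, [/\ subgroup B, finite_index B, filtering W, invariant act B W &
    forall h, W h \/ W (st h)].
Proof.
move=> noF; elim: n => [|n IH] in A U *; move=> sA fA fU iU dU.
  exists A, U; split=> // h; apply: contrapT => /not_orP uh.
  by have := dU [:: h] (conj uh I) (conj I I).
have [W [UW fW iW flip]] := maximal_filter actP sA fU iU.
have [[h uh]|none] := pselect (exists h, undecided W h); last first.
  exists A, W; split=> // h; apply: contrapT => /not_orP uh.
  by apply: none; exists h.
have dW : dim_le W n.+1.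
  by move=> L uL; apply: dU; apply: allPW uL => k; apply: undS.
have [c0 cc0] := chain_ex uh.
(* The value [n] is attained because any limit lowers the bound [n.+1]. Only limits of least
   dimension are known to be finitely many, and [A] permutes these. *)
have [|m [c cc dc] minm] := @ex_least (fun m =>
    exists2 c, chain W c & dim_le (W `|` germ c) m).
  by exists n, c0 => //; apply: dim_le_germ dW.
pose F := W `|` germ c.
have fin := finite_germs fW flip dW noF minm.
have fO : finite_set [set act_set g F | g in A].
  apply: sub_finite_set fin => _ [g Ag <-].
  by apply: (germs_act sA iW) => //; exists c.
have fS := stabilizer_finite_index act_set_action
  (finite_orbit act_set_action sA fA fO).
have sS := stabilizer_subgroup act_set_action F.
apply: (IH (A `&` stabilizer act_set F) F).
- exact: subgroup_setI.
- exact: finite_index_setI.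
- exact: filtering_germ.
- move=> g k [_ gF] Fk; rewrite -gF /act_set /= act_mulVg; exact: Fk.
- exact: dim_le_germ dW.
Qed.

End FixedOrientation.
Arguments act_set {G P} act g F.

(** * Relative index of commensurable sets *)

Section Index.
Context {T : choiceType}.
Implicit Types X Y Z : set T.

Definition card X : nat := #|` fset_set X|%fset.

Lemma card0 : card set0 = 0%N.
Proof. by rewrite /card fset_set0 cardfs0. Qed.

Lemma card_setIDK X Z : finite_set X -> (card (X `&` Z) + card (X `\` Z))%N = card X.
Proof.
move=> fX; have fI : finite_set (X `&` Z) by apply: finite_setIl.
have fD : finite_set (X `\` Z) by apply: finite_setD.
rewrite /card -cardfsUI -fset_setU // -fset_setI // setUIDK.
rewrite (_ : _ `&` _ = set0) ?fset_set0 ?cardfs0 ?addn0 //.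
by apply/seteqP; split=> // x [[_ Zx] [_ /(_ Zx)]].
Qed.

Lemma card_image_inj (f : T -> T) X : injective f -> finite_set X ->
  card (f @` X) = card X.
Proof. by move=> fi fX; rewrite /card fset_set_image // card_imfset. Qed.

Lemma card_gt0 X x : finite_set X -> X x -> (0 < card X)%N.
Proof.
move=> fX Xx; rewrite /card cardfs_gt0; apply/fset0Pn; exists x.
by rewrite in_fset_set // mem_set.
Qed.

Definition commens X Y := finite_set (X `\` Y) /\ finite_set (Y `\` X).

Local Open Scope ring_scope.

(** A substitute for the difference of the cardinals of [X] and [Y], which it equals when both are
    finite; it remains meaningful for infinite sets with finite differences. *)
Definition index X Y : int := (card (X `\` Y))%:Z - (card (Y `\` X))%:Z.

Lemma commens_sym X Y : commens X Y -> commens Y X. Proof. by case. Qed.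

Lemma finite_setD_trans X Y Z :
  finite_set (X `\` Y) -> finite_set (Y `\` Z) -> finite_set (X `\` Z).
Proof.
move=> XY YZ; apply: (@sub_finite_set _ _ ((X `\` Y) `|` (Y `\` Z))).
  by move=> x [Xx Zx]; have [Yx|Yx] := pselect (Y x); [right|left].
by rewrite finite_setU.
Qed.

Lemma commens_trans X Y Z : commens X Y -> commens Y Z -> commens X Z.
Proof. by move=> [a b] [c d]; split; [exact: finite_setD_trans c|exact: finite_setD_trans b]. Qed.

(** Each of the six differences is split according to membership in the third set; the twelve pieces
    are equal in pairs. *)
Lemma index_trans X Y Z : commens X Y -> commens Y Z ->
  index X Y + index Y Z = index X Z.
Proof.
move=> [XY YX] [YZ ZY]; rewrite /index.
have XZ := finite_setD_trans XY YZ; have ZX := finite_setD_trans ZY YX.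
have E (A B C : set T) : finite_set (A `\` B) ->
    (card (A `\` B) = card ((A `\` B) `&` C) + card ((A `\` B) `\` C))%N.
  by move=> f; rewrite card_setIDK.
rewrite (E X Y Z XY) (E Y X Z YX) (E Y Z X YZ) (E Z Y X ZY) (E X Z Y XZ) (E Z X Y ZX).
have a : (X `\` Y) `&` Z = (Z `\` Y) `&` X.
  by apply/seteqP; split=> x; rewrite /setD /setI /=; tauto.
have b : (Y `\` X) `&` Z = (Z `\` X) `&` Y.
  by apply/seteqP; split=> x; rewrite /setD /setI /=; tauto.
have c : (Y `\` Z) `&` X = (X `\` Z) `&` Y.
  by apply/seteqP; split=> x; rewrite /setD /setI /=; tauto.
have d : (X `\` Y) `\` Z = (X `\` Z) `\` Y.
  by apply/seteqP; split=> x; rewrite /setD /=; tauto.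
have e : (Y `\` X) `\` Z = (Y `\` Z) `\` X.
  by apply/seteqP; split=> x; rewrite /setD /=; tauto.
have f : (Z `\` Y) `\` X = (Z `\` X) `\` Y.
  by apply/seteqP; split=> x; rewrite /setD /=; tauto.
rewrite a b c d e f; lia.
Qed.

Lemma index_self X : index X X = 0.
Proof. by rewrite /index GRing.subrr. Qed.

Lemma image_setD (f : T -> T) X Y : injective f ->
  f @` X `\` f @` Y = f @` (X `\` Y).
Proof.
move=> fi; apply/seteqP; split=> x.
  by move=> [[y Xy <-] nY]; exists y => //; split=> //.
by move=> [y [Xy nY] <-]; split; [exists y|move=> [z Yz /fi zy]; rewrite -zy in nY].
Qed.

Lemma image_setI_inj (f : T -> T) X Y : injective f ->
  f @` X `&` f @` Y = f @` (X `&` Y).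
Proof.
move=> fi; apply/seteqP; split=> x.
  by move=> [[y Xy <-] [z Yz /fi zy]]; exists y => //; split=> //; rewrite -zy.
by move=> [y [Xy Yy] <-]; split; exists y.
Qed.

Lemma commens_image (f : T -> T) X Y : injective f ->
  commens X Y -> commens (f @` X) (f @` Y).
Proof. by move=> fi [a b]; split; rewrite image_setD //; apply: finite_image. Qed.

Lemma index_image (f : T -> T) X Y : injective f -> commens X Y ->
  index (f @` X) (f @` Y) = index X Y.
Proof. by move=> fi [a b]; rewrite /index !image_setD // !card_image_inj. Qed.

Lemma index_proper X Y x : Y `<=` X -> finite_set (X `\` Y) -> X x -> ~ Y x ->
  1 <= index X Y.
Proof.
move=> YX fin Xx nYx; have := card_gt0 fin (conj Xx nYx).
rewrite /index (_ : Y `\` X = set0); last by apply/seteqP; split=> // y [/YX].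
by rewrite card0; lia.
Qed.

End Index.
Lemma finite_index_setT (G : groupType) : finite_index [set: G].
Proof.
by apply: (@finite_index_fibers _ _ (fun=> tt)).
Qed.

Lemma finite_index_bigcap (G : groupType) T (I : set T) (B : T -> set G) :
  finite_set I -> (forall i, I i -> subgroup (B i) /\ finite_index (B i)) ->
  subgroup (\bigcap_(i in I) B i) /\ finite_index (\bigcap_(i in I) B i).
Proof.
move=> fI; elim/finite_set_proper_ind: fI => {}I _ IH H.
have [I0|/set0P[i Ii]] := eqVneq I set0.
  by rewrite I0 bigcap_set0; split; [split|exact: finite_index_setT].
have [s1 f1] := H i Ii.
have Ii' : I `\ i `<` I by split=> [j []//|/(_ i Ii) [_]]; apply.
have [s2 f2] := IH _ Ii' (fun j jI => H j (proj1 jI)).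
rewrite (bigcap_setD1 i) //.
split; [exact: subgroup_setI|exact: finite_index_setI].
Qed.

Lemma finite_set_int_bound T (B : set T) (f : T -> int) : finite_set B ->
  exists m : int, forall b, B b -> (f b < m)%R.
Proof.
move=> fB; elim/finite_set_proper_ind: fB => {}B _ IH.
have [B0|/set0P[b Bb]] := eqVneq B set0; first by exists 0%R; rewrite B0.
have Bb' : B `\ b `<` B by split=> [c []//|/(_ b Bb) [_]]; apply.
have [m Hm] := IH _ Bb'.
exists (Num.max m (f b + 1))%R => c Bc; have [->|cb] := pselect (c = b); first by lia.
by have := Hm c (conj Bc cb); lia.
Qed.

(** * Ends of a fixed orientation and their characters *)

Section Stabilizer.
Context {G : groupType} {P : pocset} {V : Type}.
Context (act : G -> P -> P) (actV : G -> V -> V) (mem : V -> P -> Prop).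
Context (actP : pocset_action act).
Context (mem_st : forall x h, mem x (st h) <-> ~ mem x h).
Context (mem_le : forall x h k, le h k -> mem x h -> mem x k).
Context (mem_act : forall g x h, mem (actV g x) (act g h) <-> mem x h).
Context (mem_ex : forall h, exists x, mem x h).
Context (mem_sep : forall x y, finite_set [set h | mem x h /\ ~ mem y h]).
Context (N : nat).
Context (dimN : forall L : seq P, pairP transverse L -> (size L <= N)%N).
Context (A : set G) (sA : subgroup A) (xi : set P).
Context (fxi : filtering xi) (ixi : invariant act A xi).
Context (txi : forall h, xi h \/ xi (st h)).
Local Open Scope group_scope.
Implicit Types (g : G) (h k p q : P) (x y : V).

(** The halfspaces that separate [x] from the point, possibly at infinity, which [xi] represents.
    Incomparable ones are transverse, so antichains have at most [N] elements. *)
Definition away x : set P := [set h | xi h /\ ~ mem x h].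

Definition lt h k := le h k /\ ~ le k h.

Lemma away_transverse x h k : away x h -> away x k -> ~ le h k -> ~ le k h ->
  transverse h k.
Proof.
move=> [xh nxh] [xk nxk] hk kh; split=> //.
  by case: fxi => _ cons; apply: cons.
by move=> H; apply: nxk; apply: (mem_le H); apply/mem_st.
Qed.

Lemma away_width x L : allP (away x) L ->
  pairP (fun h k => ~ le h k /\ ~ le k h) L -> (size L <= N)%N.
Proof.
move=> aL pL; apply: dimN; elim: L aL pL => //= h L IH [ah aL] [hL /(IH aL) ?].
split=> //; apply: allPW (allP_and aL hL) => k [ak [hk kh]].
exact: away_transverse ah ak hk kh.
Qed.

Lemma away_up x h : finite_set [set k | away x k /\ le h k].
Proof.
have [y yh] := mem_ex h; apply: sub_finite_set (mem_sep y x) => k [[_ nk] hk].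
by split=> //; apply: mem_le yh.
Qed.

Lemma away_diff x y : finite_set (away x `\` away y).
Proof.
apply: sub_finite_set (mem_sep y x) => h [[xh nxh] nay]; split=> //.
by apply: contrapT => nyh; apply: nay.
Qed.

Lemma finite_set_max (B : set P) p : finite_set B -> B p ->
  exists q, [/\ B q, le p q & forall k, B k -> le q k -> le k q].
Proof.
move=> fB; elim/finite_set_proper_ind: fB p => {}B _ IH p Bp.
have [[p' [Bp' pp' np]]|none] := pselect (exists k, [/\ B k, le p k & ~ le k p]); last first.
  exists p; split=> // [|k Bk pk]; first exact: le_refl.
  by apply: contrapT => kp; apply: none; exists k.
have sub : [set q | B q /\ le p' q] `<` B.
  by split=> [q []//|/(_ p Bp) []].
have [q [[Bq p'q] _ qmax]] := IH _ sub p' (conj Bp' (le_refl p')).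
exists q; split=> // [|k Bk qk]; first exact: le_trans p'q.
by apply: qmax => //; split=> //; apply: le_trans qk.
Qed.

(** The step of a König argument: above each member there are finitely many others, so each is below
    a maximal one, and the maximal ones form a finite antichain. Some of them then has infinitely
    many members of [B] below it. *)
Lemma away_below x (B : set P) : B `<=` away x -> infinite_set B ->
  exists2 p, B p & infinite_set [set q | B q /\ lt q p].
Proof.
move=> Bx infB; apply: contrapT => none; apply: infB.
have finlt p : B p -> finite_set [set q | B q /\ lt q p].
  by move=> Bp; apply: contrapT => inf; apply: none; exists p.
pose M := [set p | B p /\ forall k, B k -> le p k -> le k p].
have finM : finite_set M.
  apply: (@finite_set_bounded _ _ N) => L ML dL; apply: (@away_width x).
    by apply: allPW ML => p [/Bx].
  elim: L ML dL => //= p L IH [[Bp pmax] ML] [pL /(IH ML) ?]; split=> //.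
  apply: allPW (allP_and ML pL) => q [[Bq qmax] pq].
  split=> H; apply: pq; first exact/(le_anti H)/pmax.
  exact/le_anti/H/qmax.
apply: (@sub_finite_set _ _ (\bigcup_(p in M) ([set p] `|` [set q | B q /\ lt q p]))).
  move=> q Bq.
  have finq : finite_set [set k | B k /\ le q k].
    by apply: sub_finite_set (away_up x q) => k [Bk qk]; split=> //; exact: Bx.
  have [p [[Bp _] qp pmax]] := finite_set_max finq (conj Bq (le_refl q)).
  exists p.
    by split=> // k Bk pk; apply: pmax => //; split=> //; apply: le_trans pk.
  have [pq|npq] := pselect (le p q); first by left; apply: le_anti.
  by right.
apply: bigcup_finite => // p [Bp _].
by rewrite finite_setU; split; [exact: finite_set1|exact: finlt].
Qed.

Lemma away_chain x (B : set P) : B `<=` away x -> infinite_set B ->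
  exists c : nat -> P, (forall i, B (c i)) /\ (forall i, lt (c i.+1) (c i)).
Proof.
move=> Bx infB.
have step (X : set P) : exists p, X `<=` away x -> infinite_set X ->
    X p /\ infinite_set [set q | X q /\ lt q p].
  have [[Xx infX]|H] := pselect (X `<=` away x /\ infinite_set X).
    by have [p Xp infp] := away_below Xx infX; exists p.
  have /infinite_setN0[p _] := infB.
  by exists p => Xx infX; case: H.
have [f fP] := choice step.
pose D i := iter i (fun X => [set q | X q /\ lt q (f X)]) B.
have DP i : [/\ D i `<=` B, D i `<=` away x & infinite_set (D i)].
  elim: i => [|i [D1 D2 D3]]; first by split.
  split; last by case: (fP _ D2 D3).
    by move=> q [/D1].
  by move=> q [/D2].
have DfD i : D i (f (D i)) by case: (DP i) => _ D2 D3; case: (fP _ D2 D3).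
exists (fun i => f (D i)); split=> i; first by case: (DP i) => D1 _ _; apply: D1.
by case: (DfD i.+1).
Qed.

Lemma lt_chain_inj (c : nat -> P) : (forall i, lt (c i.+1) (c i)) -> injective c.
Proof. by move=> H; apply: strict_chain_inj => i; case: (H i). Qed.

Lemma lt_chain_le (c : nat -> P) i j : (forall i, lt (c i.+1) (c i)) ->
  (i <= j)%N -> le (c j) (c i).
Proof.
move=> H; elim: j => [|j IH]; first by rewrite leqn0 => /eqP ->; apply: le_refl.
rewrite leq_eqVlt => /orP[/eqP ->|/IH]; first exact: le_refl.
by apply: le_trans; case: (H j).
Qed.

Definition down p : set P := [set q | xi q /\ le q p].

Lemma down_away p : exists y, down p `<=` away y.
Proof.
have [y yp] := mem_ex (st p); exists y => q [xq qp]; split=> // yq.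
by move/mem_st: yp; apply; apply: mem_le yq.
Qed.

(* p and q are equivalent if they lie above the same ends of xi. *)
Definition equiv p q := commens (down p : set {classic P}) (down q).

Lemma equiv_sym p q : equiv p q -> equiv q p. Proof. exact: commens_sym. Qed.

Lemma equiv_trans p q r : equiv p q -> equiv q r -> equiv p r.
Proof. exact: commens_trans. Qed.

Lemma equiv_refl p : equiv p p.
Proof. by split; rewrite setDv; exact: finite_set0. Qed.

Definition class p : set P := [set q | xi q /\ equiv p q].

Lemma class_eq p q : equiv p q -> class p = class q.
Proof.
move=> pq; apply/seteqP; split=> r [xr H]; split=> //.
  exact: equiv_trans (equiv_sym pq) H.
exact: equiv_trans pq H.
Qed.

(** The antichain is built from the small end of the chain upwards. The new [r] is taken below [c m]
    but not below [c m.+1], so it is not below the earlier members; it avoids the finitely many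
    elements above them. *)
Lemma incomparable_family (c : nat -> P) n m : (forall i, lt (c i.+1) (c i)) ->
  (forall i, infinite_set (down (c i) `\` down (c i.+1))) ->
  exists L, [/\ size L = n, pairP (fun h k => ~ le h k /\ ~ le k h) L &
    allP (fun r => exists2 i, (m <= i)%N & (down (c i) `\` down (c i.+1)) r) L].
Proof.
move=> cc infD; elim: n m => [|n IH] m; first by exists [::].
have [L [sL pL DL]] := IH m.+1; have [y Hy] := down_away (c m).
pose bad := \bigcup_(l in [set l | List.In l L]) [set r | away y r /\ le l r].
have finbad : finite_set bad.
  by apply: bigcup_finite => [|l _]; [exact: finite_set_In|exact: away_up].
have [r [rD rbad]] : exists r, (down (c m) `\` down (c m.+1)) r /\ ~ bad r.
  apply: contrapT => H; apply: (infD m); apply: sub_finite_set finbad => r rD.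
  by apply: contrapT => nb; apply: H; exists r.
exists (r :: L); split=> /=; first by rewrite sL.
  split=> //; apply/allP_In => l lL.
  have [i mi [[xl lci] _]] : exists2 i, (m < i)%N & (down (c i) `\` down (c i.+1)) l.
    by move: l lL; apply/allP_In.
  case: rD => [[xr rck] nr]; split=> [rl|lr].
    by apply: nr; split=> //; apply: le_trans rl (le_trans lci (lt_chain_le cc mi)).
  by apply: rbad; exists l => //; split=> //; apply: Hy; split.
split; first by exists m.
by apply: allPW DL => l [i mi Dl]; exists i => //; apply: ltnW.
Qed.

(** With infinitely many classes, representatives would form a descending chain of distinct classes.
    Consecutive down-sets would then differ by infinitely many elements, and an antichain of [N.+1]
    elements would appear. *)
Lemma finite_classes x : finite_set [set class p | p in away x].
Proof.
have [->|/set0P[p0 _]] := eqVneq (away x) set0.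
  by rewrite image_set0; exact: finite_set0.
pose rep (K : set P) := xget (p0 : {classic P}) [set q | away x q /\ class q = K].
have repP p : away x p -> away x (rep (class p)) /\ class (rep (class p)) = class p.
  move=> ap.
  by apply: (@xgetPex {classic P} p0 [set q | away x q /\ class q = class p]); exists p.
suff fin : finite_set [set rep (class p) | p in away x].
  apply: sub_finite_set (finite_image class fin) => _ [p /[dup] ap /repP[_ E] <-].
  by exists (rep (class p)) => //; exists p.
apply: contrapT => inf.
have Rx : [set rep (class p) | p in away x] `<=` away x.
  by move=> _ [p /repP[? _] <-].
have [c [cR cc]] := away_chain Rx inf.
have infD i : infinite_set (down (c i) `\` down (c i.+1)).
  move=> fin; have E : class (c i) = class (c i.+1).
    apply: class_eq; split=> //; rewrite (_ : _ `\` _ = set0); first exact: finite_set0.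
    apply/seteqP; split=> // q [[xq qc] []]; split=> //.
    by apply: le_trans qc _; case: (cc i).
  have E2 : c i = c i.+1.
    have [p ap rp] := cR i; have [q aq rq] := cR i.+1.
    have [_ Ep] := repP p ap; have [_ Eq] := repP q aq.
    by rewrite -rp -rq -Ep -Eq rp rq E.
  by case: (cc i); rewrite E2 => _; apply; apply: le_refl.
have [L [sL pL DL]] := incomparable_family N.+1 0 cc infD.
have [y Hy] := down_away (c 0).
suff: (size L <= N)%N by rewrite sL ltnn.
apply: away_width pL; apply: allPW DL => r [i _ [[xr rc] _]].
by apply: Hy; split=> //; apply: le_trans rc (lt_chain_le cc (leq0n i)).
Qed.

(** Classes with finite trace on [away x] are discarded: they contribute only finitely many
    halfspaces, and a change of [x] alters no trace by more than a finite set. *)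
Definition ends x : set (set P) :=
  [set K | (exists2 p, xi p & K = class p) /\ infinite_set (K `&` away x)].

Lemma finite_ends x : finite_set (ends x).
Proof.
apply: sub_finite_set (finite_classes x) => K [[p xp E] inf].
have /infinite_setN0[q [Kq aq]] := inf; exists q => //.
by move: Kq; rewrite E => -[_ /class_eq].
Qed.

Lemma ends_eq x y : ends x = ends y.
Proof.
suff H x' y' : ends x' `<=` ends y' by apply/seteqP.
move=> K [Kp inf]; split=> // fin; apply: inf.
apply: (@sub_finite_set _ _ ((K `&` away y') `|` (away x' `\` away y'))).
  by move=> p [Kp' ap]; have [a|a] := pselect (away y' p); [left|right].
by rewrite finite_setU; split=> //; exact: away_diff.
Qed.

Let AV g : A g -> A g^-1. Proof. by case: sA => _ _; apply. Qed.

Lemma xi_act g p : A g -> xi (act g p) <-> xi p.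
Proof.
move=> Ag; split=> [/(ixi (AV Ag))|]; last exact: ixi.
by rewrite (act_mulVg actP).
Qed.

Lemma act_set_image g X : act_set act g X = act g @` X.
Proof.
apply/seteqP; split=> p; first by exists (act g^-1 p) => //; rewrite (act_mulgV actP).
by move=> [q Xq <-]; rewrite /act_set /= (act_mulVg actP).
Qed.

Lemma act_inj g : injective (act g).
Proof. by apply: can_inj (act g^-1) _ => p; rewrite (act_mulVg actP). Qed.

Lemma act_away g x : A g -> act g @` away x = away (actV g x).
Proof.
move=> Ag; rewrite -act_set_image; apply/seteqP; split=> p; rewrite /act_set /away /=.
  move=> [xp np]; rewrite -(xi_act _ (AV Ag)); split=> // gp; apply: np.
  by rewrite -(mem_act g) (act_mulgV actP).
move=> [xp np]; rewrite (xi_act _ (AV Ag)); split=> // gp; apply: np.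
by rewrite -(mem_act g) (act_mulgV actP) in gp.
Qed.

Lemma act_down g p : A g -> act g @` down p = down (act g p).
Proof.
move=> Ag; rewrite -act_set_image; apply/seteqP; split=> q; rewrite /act_set /down /=.
  rewrite (xi_act _ (AV Ag)) => -[xq qp]; split=> //.
  by rewrite -(act_le_iff actP g) (act_mulgV actP) in qp.
rewrite (xi_act _ (AV Ag)) => -[xq qp]; split=> //.
by rewrite -(act_le_iff actP g) (act_mulgV actP).
Qed.

Lemma equiv_act g p q : A g -> equiv p q -> equiv (act g p) (act g q).
Proof.
by move=> Ag; rewrite /equiv -!act_down //; apply: commens_image; apply: act_inj.
Qed.

Lemma act_class g p : A g -> act g @` class p = class (act g p).
Proof.
move=> Ag; rewrite -act_set_image; apply/seteqP; split=> q; rewrite /act_set /class /=.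
  rewrite (xi_act _ (AV Ag)) => -[xq /(equiv_act Ag)].
  by rewrite (act_mulgV actP).
rewrite (xi_act _ (AV Ag)) => -[xq /(equiv_act (AV Ag))].
by rewrite (act_mulVg actP).
Qed.

Lemma ends_act g x K : A g -> ends x K -> ends x (act_set act g K).
Proof.
move=> Ag [[p xp ->] inf]; rewrite (ends_eq x (actV g x)) act_set_image; split.
  by exists (act g p); [apply/xi_act|exact: act_class].
rewrite -act_away // (image_setI_inj (T := {classic P})); last exact: act_inj.
move=> fin; apply: inf; apply: sub_finite_set (finite_image (act g^-1) fin) => q Kq.
by exists (act g q); [exists q|rewrite (act_mulVg actP)].
Qed.

Context (x0 : V).

Definition end_kernel : set G :=
  A `&` \bigcap_(K in ends x0) stabilizer (act_set act) K.

Lemma end_kernel_subgroup : finite_index A ->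
  subgroup end_kernel /\ finite_index end_kernel.
Proof.
move=> fA; have [|s f] := finite_index_bigcap (B := stabilizer (act_set act)) (finite_ends x0).
  move=> K eK; split; first exact: stabilizer_subgroup (act_set_action actP) _.
  apply: (stabilizer_finite_index (act_set_action actP)).
  apply: (finite_orbit (act_set_action actP) sA fA).
  by apply: sub_finite_set (finite_ends x0) => _ [g Ag <-]; apply: ends_act.
split; [exact: subgroup_setI|exact: finite_index_setI].
Qed.

Lemma end_kernel_act g K : end_kernel g -> ends x0 K -> act g @` K = K.
Proof. by move=> [_ H] /H; rewrite /stabilizer /= act_set_image. Qed.

Section Transfer.
Context (K : set P) (eK : ends x0 K).
Local Open Scope ring_scope.

Let M : set {classic P} := K `&` away x0.

(** The translation length of [g] along the end: it is positive when [g] maps [M] properly into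
    itself. It is additive because the relative index is additive and invariant under [act g]. *)
Definition transfer g : int := index M (act g @` M).

Lemma act_end g : end_kernel g -> act g @` M = K `&` away (actV g x0).
Proof.
move=> Bg; rewrite -(image_setI_inj (T := {classic P})); last exact: act_inj.
by rewrite end_kernel_act // act_away //; case: Bg.
Qed.

Lemma commens_transfer g : end_kernel g -> commens M (act g @` M).
Proof.
move=> Bg; rewrite act_end //.
split; [apply: sub_finite_set (away_diff x0 (actV g x0))|
        apply: sub_finite_set (away_diff (actV g x0) x0)];
by move=> p [[Kp ap] np]; split=> // H; apply: np.
Qed.

Lemma transferM (g h : G) : end_kernel g -> end_kernel h ->
  transfer (g * h)%g = transfer g + transfer h.
Proof.
move=> Bg Bh; rewrite /transfer.
have -> : act (g * h)%g @` M = act g @` (act h @` M).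
  rewrite image_comp; apply: eq_imagel => p _ /=.
  by case: actP => [[_ aM] _ _]; rewrite aM.
rewrite -(index_trans (commens_transfer Bg)).
  by rewrite index_image //; [exact: act_inj|exact: commens_transfer].
by apply: commens_image; [exact: act_inj|exact: commens_transfer].
Qed.

Lemma end_equiv p q : K p -> K q -> equiv p q.
Proof.
case: eK => [[r _ ->] _] [_ rp] [_ rq].
exact: equiv_trans (equiv_sym rp) rq.
Qed.

Lemma end_xi p : K p -> xi p.
Proof. by case: eK => [[r _ ->] _] []. Qed.

Definition low p : set {classic P} := K `&` down p.

(** Otherwise there is an infinite descending chain in the end, none of whose terms is below [p];
    all these terms lie below the first one, which is equivalent to [p]. *)
Lemma finite_not_below p : K p -> finite_set (M `\` down p).
Proof.
move=> Kp; apply: contrapT => inf.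
have Mx : M `\` down p `<=` away x0 by move=> q [[]].
have [c [cM cc]] := away_chain Mx inf.
have [[Kc0 _] _] := cM 0%N.
apply: (injective_seq_infinite (lt_chain_inj cc)) (proj1 (end_equiv Kc0 Kp)).
move=> i; have [[Kci _] ni] := cM i; split=> //; split; first exact: end_xi.
exact: lt_chain_le cc (leq0n i).
Qed.

Lemma commens_low p : K p -> commens M (low p).
Proof.
move=> Kp; split.
  apply: sub_finite_set (finite_not_below Kp) => q [[Kq aq] nq].
  by split=> // H; apply: nq.
have [y Hy] := down_away p.
apply: sub_finite_set (away_diff y x0) => q [[Kq dq] nq].
by split; [exact: Hy|move=> H; apply: nq].
Qed.

(** The position of [p] along the end, measured from [x0]; it grows as [p] gets smaller. Elements of
    [end_kernel] shift it by their transfer. *)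
Definition height p : int := index M (low p).

Lemma height_act g p : end_kernel g -> K p ->
  height (act g p) = transfer g + height p.
Proof.
move=> Bg Kp; rewrite /height.
have -> : low (act g p) = act g @` (low p).
  rewrite -(image_setI_inj (T := {classic P})); last exact: act_inj.
  by rewrite end_kernel_act // act_down //; case: Bg.
rewrite -(index_trans (commens_transfer Bg)).
  by rewrite index_image //; [exact: act_inj|exact: commens_low].
by apply: commens_image; [exact: act_inj|exact: commens_low].
Qed.

Lemma height_lt p q : K p -> K q -> lt q p -> height p + 1 <= height q.
Proof.
move=> Kp Kq [qp npq].
rewrite /height -(index_trans (commens_low Kp) (Z := low q)).
  rewrite Num.Theory.lerD2l; apply: (@index_proper {classic P} _ _ p).
  - by move=> r [Kr [xr rq]]; split=> //; split=> //; apply: le_trans qp.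
  - apply: (finite_setD_trans (proj2 (commens_low Kp)) (proj1 (commens_low Kq))).
  - by split=> //; split; [exact: end_xi|exact: le_refl].
  - by move=> [_ [_ /npq]].
exact: commens_trans (commens_sym (commens_low Kp)) (commens_low Kq).
Qed.

(** Elements of zero transfer preserve heights, so a member of [M] above a height bound can fail to
    stay there only by leaving [M]. Only the finitely many elements of [bad] do, and [m] exceeds
    their heights. *)
Lemma end_core (S : set G) : finite_set S ->
  (forall s, S s -> end_kernel s /\ transfer s = 0) ->
  exists D, [/\ D `<=` away x0, finite_set (M `\` D) &
    forall s p, S s -> D p -> D (act s p)].
Proof.
move=> fS HS.
pose bad := \bigcup_(s in S) (act s @^-1` (act s @` M `\` M)).
have fbad : finite_set bad.
  apply: bigcup_finite => // s /HS[Bs _].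
  apply: finite_preimage; first by move=> ? ? _ _; apply: act_inj.
  by case: (commens_transfer Bs).
have [m Hm] := finite_set_int_bound height fbad.
exists [set p | M p /\ m <= height p]; split.
- by move=> p [[]].
- have Mx : M `<=` away x0 by move=> q [].
  have [c [cM cc]] := away_chain Mx (proj2 eK).
  have hc i : height (c 0%N) + i%:Z <= height (c i).
    elim: i => [|i IH]; first by lia.
    by have := height_lt (proj1 (cM i)) (proj1 (cM i.+1)) (cc i); lia.
  (* Heights increase by at least 1 at each step of the chain, so [c i] has height at least [m], and
     with it everything below; the rest of [M] is finite. *)
  pose i := `|m - height (c 0%N)|%N.
  have hi : m <= height (c i) by have := hc i; rewrite /i; lia.
  have [Kci _] := cM i.
  apply: sub_finite_set (finite_not_below Kci) => q [[Kq aq] nq]; split=> // -[_ qc].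
  apply: nq; split=> //; have [cq|ncq] := pselect (le (c i) q).
    by rewrite (le_anti qc cq).
  by have := height_lt Kci Kq (conj qc ncq); lia.
- move=> s p Ss [Mp mp]; have [Bs ts] := HS s Ss.
  have Msp : M (act s p).
    apply: contrapT => nM; have : bad p by exists s => //; split=> //; exists p.
    by move/Hm; lia.
  by split=> //; rewrite height_act // ?ts //; case: Mp => Kp _ //; lia.
Qed.

End Transfer.

Definition transfer_kernel : set G :=
  [set g | end_kernel g /\ forall K, ends x0 K -> transfer K g = 0%R].

Context (fA : finite_index A).

Lemma transferV K g : ends x0 K -> end_kernel g ->
  transfer K g^-1 = (- transfer K g)%R.
Proof.
move=> eK Bg; have [[_ _ BV] _] := end_kernel_subgroup fA.
have := transferM eK Bg (BV _ Bg); rewrite mulgV.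
have -> : transfer K 1 = 0%R.
  rewrite /transfer (_ : act 1 @` _ = K `&` away x0) ?index_self //.
  by rewrite -[RHS]image_id; apply: eq_imagel => p _; case: actP => [[]].
lia.
Qed.

Lemma transfer_kernel_subgroup : subgroup transfer_kernel.
Proof.
have [[B1 BM BV] _] := end_kernel_subgroup fA; split.
- split=> // K eK; have := transferM eK B1 B1; rewrite mulg1; lia.
- move=> g h [Bg tg] [Bh th]; split=> [|K eK]; first exact: BM.
  by rewrite transferM // tg // th.
- by move=> g [Bg tg]; split=> [|K eK]; [exact: BV|rewrite transferV // tg].
Qed.

Lemma transfer_kernel_commutator (g h : G) : end_kernel g -> end_kernel h ->
  transfer_kernel (g^-1 * h^-1 * (g * h)).
Proof.
move=> Bg Bh; have [[_ BM BV] _] := end_kernel_subgroup fA.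
split; first by apply: (BM); apply: (BM) => //; apply: BV.
move=> K eK; rewrite !transferM //; try by [apply: BV|apply: (BM) => //; apply: BV].
by rewrite !transferV //; lia.
Qed.

Context (orient : forall (U : set P) x, (forall h k, le h k -> U h -> U k) ->
  (forall h, U h \/ U (st h)) -> (forall h, ~ (U h /\ U (st h))) ->
  finite_set [set h | U h /\ ~ mem x h] -> exists z, forall h, U h <-> mem z h).
Context (separate : forall x y, (forall h, mem x h <-> mem y h) -> x = y).
Context (proper : forall x, finite_set [set g | actV g x = x]).
Context (actVP : group_action actV).

Lemma invariant_core (S : set G) : finite_set S -> S `<=` transfer_kernel ->
  exists D, [/\ D `<=` away x0, finite_set (away x0 `\` D) &
    forall s p, S s -> D p -> D (act s p)].
Proof.
move=> fS SK.
have step K : exists D, ends x0 K -> [/\ D `<=` away x0,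
    finite_set ((K `&` away x0) `\` D) & forall s p, S s -> D p -> D (act s p)].
  have [eK|] := pselect (ends x0 K); last by exists set0.
  have [|D HD] := end_core eK fS; last by exists D.
  by move=> s /SK[Bs ts]; split=> //; apply: ts.
have [f fP] := choice step.
exists (\bigcup_(K in ends x0) f K); split.
- by move=> p [K eK]; case: (fP K eK) => + _ _; apply.
- apply: (@sub_finite_set _ _ (\bigcup_(K in [set class p | p in away x0])
    ((K `&` away x0) `\` \bigcup_(K in ends x0) f K))).
    move=> p [ap np]; exists (class p); first by exists p.
    by split=> //; split=> //; split; [case: ap|exact: equiv_refl].
  apply: bigcup_finite; first exact: finite_classes.
  move=> K [p ap pK].
  have [fin|inf] := pselect (finite_set (K `&` away x0)).
    exact: finite_setD.
  have eK : ends x0 K by split=> //; exists p => //; case: ap.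
  have [_ fin _] := fP K eK; apply: sub_finite_set fin => q [Kq nq].
  by split=> // H; apply: nq; exists K.
- move=> s p Ss [K eK Kp]; exists K => //.
  by case: (fP K eK) => _ _; apply.
Qed.

Theorem transfer_kernel_locally_finite (S : set G) : finite_set S ->
  S `<=` transfer_kernel -> finite_set (generated S).
Proof.
move=> fS SK; have [[_ BM BV] _] := end_kernel_subgroup fA.
(* Inverses are added so that [D] is preserved in both directions, as an equivalence. *)
pose S' := S `|` [set s^-1 | s in S].
have fS' : finite_set S' by rewrite finite_setU; split=> //; apply: finite_image.
have S'K : S' `<=` transfer_kernel.
  move=> s [/SK//|[t /SK[Bt tt] <-]]; split; first exact: BV.
  by move=> K eK; rewrite transferV // tt.
have [D [Dx fD SD]] := invariant_core fS' S'K.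
have genD g : generated S g -> forall p, D p <-> D (act g p).
  case: (actP) => [[a1 aM] _ _].
  move=> /(_ [set g | forall p, D p <-> D (act g p)]); apply; split; first split.
  - by move=> p; rewrite a1.
  - by move=> a b Ha Hb p; rewrite aM -Ha.
  - by move=> a Ha p; rewrite (Ha (act a^-1 p)) (act_mulgV actP).
  - move=> s Ss p; split; first by apply: SD; left.
    move=> /(SD s^-1)-/(_ (or_intror (ex_intro2 _ _ s Ss erefl))).
    by rewrite (act_mulVg actP).
have genA g : generated S g -> A g.
  by apply; split=> // s /SK[[]].
have [gen1 genM genV] : subgroup (generated S).
  split=> [H [[H1 _ _] _]//|a b Ha Hb H HS|a Ha H HS].
    by case: (HS) => [[_ HM _] _]; apply: HM; [exact: Ha|exact: Hb].
  by case: (HS) => [[_ _ HV] _]; apply: HV; exact: Ha.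
have Daway g p : generated S g -> D p -> ~ mem (actV g x0) p.
  move=> Sg Dp; have : away x0 (act g^-1 p).
    by apply: Dx; apply: (proj1 (genD _ (genV _ Sg) p)).
  by move=> [_]; rewrite -(mem_act g) (act_mulgV actP).
(* [U] is [xi] with every halfspace that the whole orbit of [x0] avoids replaced by its complement,
   so it is invariant. The members of [D] are avoided by the orbit; hence [U] differs from the
   orientation of [x0] only on [away x0] outside [D], a finite set, and is a fixed vertex. *)
pose U := [set h | xi h /\ (exists2 g, generated S g & mem (actV g x0) h) \/
  ~ xi h /\ forall g, generated S g -> mem (actV g x0) h].
have U1 h : U h -> exists2 f, generated S f & mem (actV f x0) h.
  by move=> [[_]//|[_ H]]; exists 1 => //; apply: H.
have xi_st h : ~ (xi h /\ xi (st h)).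
  by case: fxi => _ cons [/cons H /H]; apply; rewrite stK; apply: le_refl.
have [||||z zU] := @orient U x0.
- move=> h k hk; have [xk|nxk] := pselect (xi k).
    by move=> /U1[g Sg gh]; left; split=> //; exists g => //; apply: mem_le gh.
  have nxh : ~ xi h by move=> xh; apply: nxk; case: fxi => up _; apply: up xh hk.
  by move=> [[/nxh]//|[_ H]]; right; split=> // g /H; apply: mem_le.
- move=> h; have [xh|nxh] := pselect (xi h).
    have [[g Sg gh]|none] := pselect (exists2 g, generated S g & mem (actV g x0) h).
      by left; left; split=> //; exists g.
    right; right; split=> [xs|g Sg]; first exact: (xi_st h).
    by apply/mem_st => gh; apply: none; exists g.
  have xs : xi (st h) by case: (txi h).
  have [H|] := pselect (forall g, generated S g -> mem (actV g x0) h).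
    by left; right.
  move=> /existsNP[g /not_implyP[Sg ngh]]; right; left; split=> //; exists g => //.
  exact/mem_st.
- move=> h [[[xh [g Sg gh]]|[nxh H]] [[xs [g' Sg' gh']]|[nxs H']]].
  + exact: (xi_st h).
  + by have /mem_st := H' _ Sg.
  + by move/mem_st: gh'; apply; apply: H.
  + by have /mem_st := H' _ gen1; apply; apply: H.
- apply: sub_finite_set fD => h [Uh nh]; split.
    split=> //; case: Uh => [[]//|[_ /(_ 1 gen1)]].
    by case: actVP => a1 _; rewrite a1.
  by move=> Dh; have [g Sg gh] := U1 h Uh; apply: Daway Sg Dh gh.
apply: sub_finite_set (proper z) => g Sg; apply: separate => h.
have genU f k : generated S f -> U k -> U (act f k).
  move=> Sf [[xk [e Se ek]]|[nxk H]].
    left; split; first exact/xi_act/xk/genA.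
    exists (f * e); first exact: genM.
    by case: actVP => _ aM; rewrite aM mem_act.
  right; split; first by rewrite xi_act //; apply: genA.
  move=> e Se; have := H _ (genM _ _ (genV _ Sf) Se).
  by rewrite -(mem_act f); case: actVP => _ aM; rewrite -aM mulgA mulgV mul1g.
rewrite -(act_mulgV actP g h) mem_act -!zU; split; first exact: genU.
by move=> /(genU _ _ (genV _ Sg)); rewrite (act_mulVg actP).
Qed.

End Stabilizer.

(** * Passage to a normal subgroup *)

Section VirtuallyAbelianQuotient.
Context {G : groupType} (A K : set G).
Context (sA : subgroup A) (fA : finite_index A) (sK : subgroup K).
Context (lfK : forall S, finite_set S -> S `<=` K -> finite_set (generated S)).
Context (comK : forall g h : G, A g -> A h -> K (g^-1 * h^-1 * (g * h))%g).
Local Open Scope group_scope.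
Implicit Types g h x y : G.

(** The subgroups [A] and [K] depend on the choice of an orientation and a vertex and need not be
    normal; the core of [K] serves as the normal subgroup, the core of [A] as the source of the
    Abelian subgroup of the quotient. *)
Definition normal_core (B : set G) : set G := [set g | forall x, B (g ^ x)].

Lemma normal_core_sub (B : set G) : normal_core B `<=` B.
Proof. by move=> g /(_ 1); rewrite conjg1. Qed.

Lemma normal_core_subgroup (B : set G) : subgroup B -> subgroup (normal_core B).
Proof.
move=> [B1 BM BV]; split=> [x|g h Bg Bh x|g Bg x]; first by rewrite conj1g.
  by rewrite conjMg; apply: BM.
by rewrite conjVg; apply: BV.
Qed.

Lemma normal_core_normal (B : set G) g x : normal_core B g -> normal_core B (g ^ x).
Proof. by move=> Bg y; rewrite -conjgM. Qed.

(** The conjugate [cnj x] depends only on the left coset of [x], so the core is an intersection of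
    finitely many subgroups of finite index. *)
Lemma normal_core_finite_index (B : set G) : subgroup B -> finite_index B ->
  finite_index (normal_core B).
Proof.
move=> sB fB; have [B1 BM BV] := sB.
pose cnj x := [set g | B (g ^ x)].
have fin : finite_set (range cnj).
  apply: (@sub_finite_set _ _ ((fun C : set G => [set g | forall c, C c -> B (g ^ c)]) @`
      [set [set g * h | h in B] | g in [set: G]])); last exact: finite_image.
  move=> _ [x _ <-]; exists [set x * h | h in B]; first by exists x.
  apply/seteqP; split=> g /=.
    by move=> /(_ x); apply; exists 1; rewrite ?mulg1.
  move=> Bg _ [b Bb <-]; rewrite conjgM conjgE.
  by apply: (BM); [exact: BV|exact: BM].
have H X : range cnj X -> subgroup X /\ finite_index X.
  move=> [x _ <-]; have sX : subgroup (cnj x).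
    split; rewrite /cnj /=; first by rewrite conj1g.
      by move=> g h Bg Bh; rewrite conjMg; apply: BM.
    by move=> g Bg; rewrite conjVg; apply: BV.
  split=> //; apply: (finite_index_fibers (f := fun g => [set g ^ x * b | b in B])) => //.
    by apply: sub_finite_set fB => _ [g _ <-]; exists (g ^ x).
  by move=> g h /(coset_eqP sB); rewrite /cnj /= conjMg conjVg.
have [_] := finite_index_bigcap fin H; congr (finite_index _).
apply/seteqP; split=> g Bg; first by move=> x; apply: (Bg (cnj x)); exists x.
by move=> _ [x _ <-]; apply: Bg.
Qed.

Theorem locally_finite_by_virtually_abelianI : locally_finite_by_virtually_abelian G.
Proof.
pose N := NormalSubgroup (normal_core_subgroup sK) (@normal_core_normal K).
exists N; split.
  move=> S fS SN; apply: lfK => // s /SN; exact: normal_core_sub.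
have [C1 CM CV] := normal_core_subgroup sA.
have projM x y : quotient_proj N (x * y) = quotient_proj N x * quotient_proj N y.
  exact: quotient_projM.
have projV x : quotient_proj N x^-1 = (quotient_proj N x)^-1.
  exact: quotient_projV.
pose Q := [set a | exists2 c, normal_core A c & a = quotient_proj N c].
have sQ : subgroup Q.
  split; first by exists 1.
    by move=> _ _ [c Cc ->] [d Cd ->]; exists (c * d); [exact: CM|].
  by move=> _ [c Cc ->]; exists c^-1; [exact: CV|].
exists Q; split=> //.
  apply: (finite_index_fibers (f := fun a : quotient_group N =>
    [set repr a * c | c in normal_core A])) => //.
    apply: sub_finite_set (normal_core_finite_index sA fA) => _ [a _ <-].
    by exists (repr a).
  move=> a b /(coset_eqP (normal_core_subgroup sA)) Cab.
  exists ((repr a)^-1 * repr b) => //.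
  by rewrite projM projV !quotient_proj_repr.
(* The commutator must lie in [K] after conjugation by every [z]. Conjugation distributes over it,
   and the conjugates of [x] and [y] are still in [A]. *)
move=> _ _ [x Cx ->] [y Cy ->]; rewrite /commute -!projM.
apply/quotient_projP => z; rewrite invgM -mulgA.
have -> : (y^-1 * (x^-1 * (y * x))) = y^-1 * x^-1 * (y * x) by rewrite !mulgA.
by rewrite !conjMg !conjVg; apply: comK.
Qed.

End VirtuallyAbelianQuotient.

(** * The alternative for actions on a skeleton *)

Section TitsAlternative.
Context {C : cat0_skeleton} {G : groupType}.
Context (actV : G -> vert C -> vert C) (actE : G -> edge C -> edge C).
Context (actVP : group_action actV) (actEP : group_action actE).
Context (act_map : forall g, skeleton_map (actV g) (actE g)).
Context (proper : forall x, finite_set [set g | actV g x = x]).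
Context (x0 : vert C).

(** Halfspaces are taken as sets of vertices, so that parallel edges define the same element and the
    order is antisymmetric. *)
Definition hs := {h : set (vert C) | exists e, h = halfspace e}.

Lemma hs_inj (h k : hs) : sval h = sval k -> h = k.
Proof.
case: h k => h Hh [k Hk] /= E; subst k; congr exist; exact: Prop_irrelevance.
Qed.

Lemma hs_compl (h : hs) : exists e, ~` sval h = halfspace e.
Proof. by case: h => h [e E]; exists (inv e); rewrite halfspace_inv -E. Qed.

Definition hs_st (h : hs) : hs := exist _ _ (hs_compl h).

Definition hs_le (h k : hs) := sval h `<=` sval k.

Lemma hs_mem (h : hs) : exists x, sval h x.
Proof. by case: h => h [e E] /=; exists (tgt e); rewrite E; apply: halfspace_tgt. Qed.

Lemma hs_sep (x y : vert C) : finite_set [set h : hs | sval h x /\ ~ sval h y].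
Proof.
have := finite_preimage (f := sval : hs -> set (vert C)) _ (halfspace_crossed x y).
move=> /(_ (fun h k _ _ => @hs_inj h k)); apply: sub_finite_set => h [hx hy].
by split=> //; apply: (proj2_sig h).
Qed.

Lemma hs_le_not_st (h k : hs) : hs_le h k -> ~ hs_le h (hs_st k).
Proof. by move=> hk hsk; have [x hx] := hs_mem h; apply: (hsk x hx); apply: hk. Qed.

Lemma hs_interval (h k : hs) : finite_set [set l | hs_le h l /\ hs_le l k].
Proof.
have [[x hx] [y ky]] := (hs_mem h, hs_mem (hs_st k)).
by apply: sub_finite_set (hs_sep x y) => l [hl lk]; split; [exact: hl|move/lk].
Qed.

Definition hs_pocset : pocset.
Proof.
refine (@Pocset hs hs_le hs_st _ _ _ _ _ hs_le_not_st hs_interval).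
- by move=> h.
- by move=> h k hk kh; apply: hs_inj; apply/seteqP.
- by move=> k h l; apply: subset_trans.
- by move=> h; apply: hs_inj; rewrite /= setCK.
- by move=> h k; apply: subsetC.
Defined.

Lemma halfspace_act g e y : halfspace (actE g e) (actV g y) <-> halfspace e y.
Proof.
apply: (skeleton_map_halfspace _ _ (act_map g) (act_map g^-1%g)).
exact: (actK actEP).
Qed.

Lemma hs_act_subproof g (h : hs) :
  exists e, [set y | sval h (actV g^-1%g y)] = halfspace e.
Proof.
case: h => h [e E] /=; exists (actE g e); rewrite E; apply/seteqP; split=> y /=.
  by rewrite -(halfspace_act g) (actVK actVP).
by rewrite -(halfspace_act g e) (actVK actVP).
Qed.

Definition hs_act g (h : hs_pocset) : hs_pocset := exist _ _ (hs_act_subproof g h).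

Lemma hs_mem_act g x (h : hs) : sval (hs_act g h) (actV g x) <-> sval h x.
Proof. by rewrite /= (actK actVP). Qed.

Lemma hs_actP : pocset_action hs_act.
Proof.
case: actVP => a1 aM; split; first split.
- by move=> h; apply: hs_inj; apply/seteqP; split=> y /=; rewrite invg1 a1.
- by move=> g g' h; apply: hs_inj; apply/seteqP; split=> y /=; rewrite invgM aM.
- by move=> g h k hk y /=; apply: hk.
- by move=> g h; apply: hs_inj.
Qed.

Lemma hs_dim (L : seq hs_pocset) : pairP transverse L -> (size L <= dimension C)%N.
Proof.
move=> pL; have [Le LLe] : exists Le, all2P (fun (h : hs) e => sval h = halfspace e) L Le.
  apply: allP_all2P; elim: L {pL} => //= h L IH; split=> //; exact: (proj2_sig h).
rewrite (all2P_size LLe); apply: (cross_size x0); apply: pairP_all2 LLe pL.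
by move=> h e k f; rewrite /cross => <- <- [].
Qed.

Theorem tits_alternative :
  locally_finite_by_virtually_abelian G \/ contains_nonabelian_free_subgroup G.
Proof.
have [free|noF] := pselect (contains_nonabelian_free_subgroup G); [by right|left].
have [|||||B [xi [sB fB fxi ixi txi]]] :=
  fixed_orientation hs_actP (A := [set: G]) (U := set0) (n := dimension C) noF.
- by [].
- exact: finite_index_setT.
- by [].
- by [].
- by move=> L _; apply: hs_dim.
pose mem (x : vert C) (h : hs_pocset) := sval h x.
have mem_st x h : mem x (st h) <-> ~ mem x h by [].
have mem_le x h k : le h k -> mem x h -> mem x k by move=> hk; apply: hk.
have mem_sep := hs_sep : forall x y, finite_set [set h | mem x h /\ ~ mem y h].
have mem_ex := hs_mem : forall h, exists x, mem x h.
have [sA fA] := end_kernel_subgroup hs_actP mem_st mem_le hs_mem_act mem_ex mem_sep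
  hs_dim sB fxi ixi x0 fB.
apply: (locally_finite_by_virtually_abelianI sA fA
  (K := transfer_kernel hs_act mem B xi x0)).
- exact: (transfer_kernel_subgroup hs_actP mem_st mem_le hs_mem_act mem_ex mem_sep
    hs_dim sB fxi ixi x0 fB).
- apply: (transfer_kernel_locally_finite hs_actP mem_st mem_le hs_mem_act mem_ex mem_sep
    hs_dim sB fxi ixi txi fB _ _ proper actVP).
    move=> U x up tot cons fin.
    (* The orientation is carried over to sets of vertices, where [orientation_vertex] produces the
       vertex. *)
    pose W := [set h | exists2 k : hs, U k & h = sval k].
    have WU (k : hs) : W (sval k) <-> U k.
      by split=> [[l Ul /hs_inj ->]|Uk] //; exists k.
    pose H e : hs := exist _ (halfspace e) (ex_intro _ e erefl).
    have [||||z zW] := @orientation_vertex C W x.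
    + by move=> e f ef /(WU (H e)) /(up (H e) (H f) ef) /(WU (H f)).
    + by move=> e; case: (tot (H e)) => /WU; [left|right].
    + by move=> e [/(WU (H e)) He /(WU (hs_st (H e))) Hse]; apply: (cons (H e)).
    + apply: sub_finite_set (finite_image (sval : hs -> set (vert C)) fin).
      by move=> _ [_ [k Uk ->] nk]; exists k.
    exists z => h; rewrite -WU /mem; case: (proj2_sig h) => e ->; exact: zW.
  move=> x y xy; apply: halfspace_separate => e.
  exact: (xy (exist _ (halfspace e) (ex_intro _ e erefl))).
- exact: (transfer_kernel_commutator hs_actP mem_st mem_le hs_mem_act mem_ex mem_sep
    hs_dim sB fxi ixi fB).
Qed.

End TitsAlternative.

Import Order.TTheory GRing.Theory Num.Theory.
Import numFieldNormedType.Exports.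

Local Open Scope ring_scope.

(** * Isometries of cubes and the gluing of cells *)

Section CubeIsometries.
Context {R : realType}.

(* The point with coordinates [a] relative to the corner [e]; [rel_coord] is the
   inverse map. *)
Definition corner_pt n (e : 'I_n -> bool) (a : 'I_n -> R) : 'rV[R]_n :=
  \row_j (if e j then 1 - a j else a j).

Definition rel_coord n (e : 'I_n -> bool) (u : 'rV[R]_n) (j : 'I_n) : R :=
  if e j then 1 - u 0 j else u 0 j.

Lemma corner_ptK n (e : 'I_n -> bool) a j : rel_coord e (corner_pt e a) j = a j.
Proof. by rewrite /rel_coord mxE; case: (e j) => //; lra. Qed.

Lemma rel_coordK n (e : 'I_n -> bool) (u : 'rV[R]_n) : corner_pt e (rel_coord e u) = u.
Proof.
by apply/rowP => j; rewrite mxE /rel_coord; case: (e j) => //; lra.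
Qed.

Definition flip n (e : 'I_n -> bool) (i j : 'I_n) : bool :=
  if j == i then ~~ e j else e j.

Lemma flipK n (e : 'I_n -> bool) i : flip (flip e i) i = e.
Proof. by apply/funext => j; rewrite /flip; case: eqP => // _; rewrite negbK. Qed.

Lemma flipC n (e : 'I_n -> bool) i j : flip (flip e i) j = flip (flip e j) i.
Proof. by apply/funext => k; rewrite /flip; case: eqP => //; case: eqP. Qed.

Definition sqdist n (u v : 'rV[R]_n) : R := \sum_(i < n) (u 0 i - v 0 i) ^+ 2.

Lemma sqdist_ge0 n (u v : 'rV[R]_n) : 0 <= sqdist u v.
Proof. by apply: sumr_ge0 => i _; apply: sqr_ge0. Qed.

Lemma euclidean_dist_sq n (u v : 'rV[R]_n) : euclidean_dist u v ^+ 2 = sqdist u v.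
Proof. by rewrite /euclidean_dist sqr_sqrtr //; apply: sqdist_ge0. Qed.

Lemma coord_le_dist n (u v : 'rV[R]_n) i : `|u 0 i - v 0 i| <= euclidean_dist u v.
Proof.
rewrite -sqrtr_sqr ler_wsqrtr // (bigD1 i) //= lerDl.
by apply: sumr_ge0 => j _; apply: sqr_ge0.
Qed.

Definition compat n (F : face_code n) (e : 'I_n -> bool) :=
  forall i b, F i = Some b -> e i = b.

Definition free_dim n (F : face_code n) : nat := \sum_(i < n) (F i == None).

Lemma face_coord n (F : face_code n) (u : 'rV[R]_n) i : face F u -> 0 <= u 0 i <= 1.
Proof. by move=> [/(_ i)]. Qed.

Lemma compat_vertex n (F : face_code n) (e : 'I_n -> bool) :
  compat F e -> face F (cube_vertex e : 'rV[R]_n).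
Proof.
move=> Fe; split=> [i|i b /Fe <-]; rewrite mxE //.
by case: (e i); rewrite ?lexx ?ler01.
Qed.

Lemma sqdist_face n (F : face_code n) (u v : 'rV[R]_n) : face F u -> face F v ->
  sqdist u v <= (free_dim F)%:R /\
  (sqdist u v = (free_dim F)%:R ->
   forall i, F i = None -> (u 0 i - v 0 i) ^+ 2 = 1).
Proof.
move=> Fu Fv; rewrite /free_dim natr_sum.
have le i : (u 0 i - v 0 i) ^+ 2 <= (F i == None)%:R.
  case FE: (F i) => [b|] /=; first by rewrite (proj2 Fu _ _ FE) (proj2 Fv _ _ FE) subrr expr0n.
  by have := face_coord i Fu; have := face_coord i Fv; nra.
split; first by apply: ler_sum => i _; apply: le.
move=> E i FE; have := psumr_eq0P (P := xpredT)
  (F := fun i => (F i == None)%:R - (u 0 i - v 0 i) ^+ 2 : R).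
move=> /(_ _ _ i isT); rewrite FE eqxx => H; apply/eqP; rewrite eq_sym -subr_eq0.
apply/eqP; apply: H => [j _|]; first by rewrite subr_ge0; apply: le.
by rewrite sumrB -/(sqdist u v) E subrr.
Qed.

Definition antipode n (F : face_code n) (e : 'I_n -> bool) (i : 'I_n) : bool :=
  if F i is None then ~~ e i else e i.

Lemma antipode_compat n (F : face_code n) e : compat F e -> compat F (antipode F e).
Proof. by move=> Fe i b Fi; rewrite /antipode Fi; apply: Fe. Qed.

Lemma sqdist_antipode n (F : face_code n) e :
  sqdist (cube_vertex e : 'rV[R]_n) (cube_vertex (antipode F e)) = (free_dim F)%:R.
Proof.
rewrite /sqdist /free_dim natr_sum; apply: eq_bigr => i _; rewrite !mxE /antipode.
by case: (F i) => [b|]; case: (e i) => /=; ring.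
Qed.

Lemma compat_exists n (F : face_code n) : exists e, compat F e.
Proof. by exists (fun i => odflt false (F i)) => i b /= ->. Qed.

Lemma compat_flip n (F : face_code n) e i :
  compat F e -> F i = None -> compat F (flip e i).
Proof.
move=> Fe Fi j b Fj; rewrite /flip; case: eqP => [ji|_]; last exact: Fe.
by rewrite ji Fi in Fj.
Qed.

Lemma compat_flip_free n (F : face_code n) e i :
  compat F e -> compat F (flip e i) -> F i = None.
Proof.
move=> Fe Fei; case FE: (F i) => [b|//].
by have := Fei _ _ FE; have := Fe _ _ FE; rewrite /flip eqxx => ->; case: b {FE}.
Qed.

Lemma sqdist_vertex n (e e' : 'I_n -> bool) :
  sqdist (cube_vertex e : 'rV[R]_n) (cube_vertex e') = (\sum_(i < n) (e i != e' i))%:R.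
Proof.
rewrite /sqdist natr_sum; apply: eq_bigr => i _; rewrite !mxE.
by case: (e i); case: (e' i) => /=; ring.
Qed.

(** A coordinate is determined by the distances to two adjacent vertices; a distance-preserving map
    that matches these vertices therefore matches the coordinate. *)
Lemma sqdist_flip n (e : 'I_n -> bool) (u : 'rV[R]_n) i :
  sqdist u (cube_vertex e) - sqdist u (cube_vertex (flip e i)) =
  rel_coord e u i *+ 2 - 1.
Proof.
rewrite /sqdist -sumrB (bigD1 i) //= big1 => [|j ji].
  rewrite !mxE /flip eqxx /rel_coord; case: (e i) => /=; ring.
by rewrite !mxE /flip (negPf ji) subrr.
Qed.

(** A metric description of vertices: the squared diameter of a face is its dimension, and it is
    attained only at vertices. Isometries of faces hence preserve vertices. *)
Lemma face_far n (F : face_code n) (u v : 'rV[R]_n) : face F u -> face F v ->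
  sqdist u v = (free_dim F)%:R -> exists2 e, compat F e & u = cube_vertex e.
Proof.
move=> Fu Fv E; have [_ /(_ E) H] := sqdist_face Fu Fv.
have V i : u 0 i = 0 \/ u 0 i = 1.
  case FE: (F i) => [b|].
    by rewrite (proj2 Fu _ _ FE); case: b {FE}; [right|left].
  have := H i FE; have := face_coord i Fu; have := face_coord i Fv.
  move: (u 0 i) (v 0 i) => x y /andP[x0 x1] /andP[y0 y1] {}E.
  have : (x - y - 1) * (x - y + 1) = 0 by rewrite -[RHS](subrr 1) -{3}E; ring.
  by move/eqP; rewrite mulf_eq0 => /orP[] /eqP E2; [right|left]; lra.
exists (fun i => u 0 i == 1).
  move=> i b FE; move: (proj2 Fu _ _ FE) => ->.
  by case: b {FE}; rewrite ?eqxx // eq_sym oner_eq0.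
apply/rowP => i; rewrite mxE; case: (V i) => ->; rewrite ?eqxx //.
by rewrite eq_sym oner_eq0.
Qed.

Lemma sqdist_vertex_flip n (e : 'I_n -> bool) i :
  sqdist (cube_vertex (flip e i) : 'rV[R]_n) (cube_vertex e) = 1.
Proof.
rewrite sqdist_vertex (bigD1 i) //= big1 => [|j ji].
  by rewrite /flip eqxx addn0; case: (e i).
by rewrite /flip (negPf ji) eqxx.
Qed.

Lemma sqdist_sym n (u v : 'rV[R]_n) : sqdist u v = sqdist v u.
Proof. by apply: eq_bigr => i _; rewrite -sqrrN opprB. Qed.

Lemma sqdist_vertex1 n (e e' : 'I_n -> bool) :
  sqdist (cube_vertex e : 'rV[R]_n) (cube_vertex e') = 1 -> exists i, e' = flip e i.
Proof.
rewrite sqdist_vertex => /eqP; rewrite pnatr_eq1 => /eqP E.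
have [i ei] : exists i, e i != e' i.
  apply: contrapT => H; move: E; rewrite big1 // => i _.
  by apply/eqP; rewrite eqb0; apply/negP => ei; apply: H; exists i.
exists i; apply/funext => j; rewrite /flip; case: eqP => [->|/eqP ji].
  by move: ei; case: (e i); case: (e' i).
move: E; rewrite (bigD1 i) //= ei (bigD1 j) //=.
by case: (e j); case: (e' j).
Qed.

Section Isometry.
Context (m n : nat) (F : face_code m) (F' : face_code n) (h : 'rV[R]_m -> 'rV[R]_n).
Context (hP : isometry_onto (face F) (face F') h).

Let hF u : face F u -> face F' (h u).
Proof. by case: hP => <- _ Fu; exists u. Qed.

Let hD u v : face F u -> face F v -> sqdist (h u) (h v) = sqdist u v.
Proof. by case: hP => _ H Fu Fv; rewrite -!euclidean_dist_sq H. Qed.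

Let hV v : face F' v -> exists2 u, face F u & h u = v.
Proof. by case: hP => <- _ [u Fu <-]; exists u. Qed.

Lemma isometry_dim : free_dim F = free_dim F'.
Proof.
apply/eqP; rewrite -(eqr_nat R) eq_le; apply/andP; split.
  have [e Fe] := compat_exists F; rewrite -(sqdist_antipode F e).
  have V1 := compat_vertex Fe; have V2 := compat_vertex (antipode_compat Fe).
  by rewrite -hD //; have [] := sqdist_face (hF V1) (hF V2).
have [e Fe] := compat_exists F'; rewrite -(sqdist_antipode F' e).
have [u Fu <-] := hV (compat_vertex Fe).
have [v Fv <-] := hV (compat_vertex (antipode_compat Fe)).
by rewrite hD //; have [] := sqdist_face Fu Fv.
Qed.

Lemma isometry_vertex e : compat F e ->
  exists2 e', compat F' e' & h (cube_vertex e) = cube_vertex e'.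
Proof.
move=> Fe; have Fe' := antipode_compat Fe.
apply: (@face_far _ _ _ (h (cube_vertex (antipode F e)))).
- exact/hF/compat_vertex.
- exact/hF/compat_vertex.
- by rewrite hD ?sqdist_antipode ?isometry_dim //; apply: compat_vertex.
Qed.

Lemma isometry_flip e e' i j : h (cube_vertex e) = cube_vertex e' ->
  h (cube_vertex (flip e i)) = cube_vertex (flip e' j) ->
  compat F e -> F i = None ->
  forall u, face F u -> rel_coord e' (h u) j = rel_coord e u i.
Proof.
move=> he hi Fe Fi u Fu; have := sqdist_flip e u i; have := sqdist_flip e' (h u) j.
rewrite -he -hi !hD //; first by lra.
  exact/compat_vertex/compat_flip.
exact: compat_vertex.
Qed.

(** The gluing maps are only known to preserve distances; this makes them permutations of
    coordinates, relative to suitable corners. The matching [r] is a relation since it concerns the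
    free directions only. *)
Lemma isometry_coord e : compat F e ->
  exists (e' : 'I_n -> bool) (r : 'I_m -> 'I_n -> Prop),
  [/\ compat F' e',
      forall i j, r i j -> F i = None /\ F' j = None,
      (forall i, F i = None -> exists j, r i j) /\
      (forall j, F' j = None -> exists i, r i j),
      forall i j i' j', r i j -> r i' j' -> (i = i' <-> j = j') &
      forall u i j, face F u -> r i j -> rel_coord e' (h u) j = rel_coord e u i].
Proof.
move=> Fe; have [e' Fe' he] := isometry_vertex Fe.
exists e', (fun i j => [/\ F i = None, F' j = None &
  h (cube_vertex (flip e i)) = cube_vertex (flip e' j)]); split=> //.
- by move=> i j [].
- split=> [i Fi|j Fj].
    have Fei := compat_flip Fe Fi; have [e2 Fe2 he2] := isometry_vertex Fei.
    have [|j ej] := @sqdist_vertex1 _ e' e2.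
      rewrite -he -he2 hD; [|exact: compat_vertex|exact: compat_vertex].
      by rewrite sqdist_sym sqdist_vertex_flip.
    by exists j; subst e2; split=> //; apply: compat_flip_free Fe' Fe2.
  have Fej := compat_flip Fe' Fj.
  have [u Fu hu] := hV (compat_vertex Fej).
  have [v Fv hv] := hV (compat_vertex (antipode_compat Fej)).
  have [|e2 Fe2 ue2] := face_far Fu Fv.
    by rewrite -hD // hu hv sqdist_antipode isometry_dim.
  subst u; have [|i ei] := @sqdist_vertex1 _ e e2.
    rewrite -hD; [|exact: compat_vertex|exact: compat_vertex].
    by rewrite hu he sqdist_sym sqdist_vertex_flip.
  by exists i; subst e2; split=> //; apply: compat_flip_free Fe Fe2.
- have D1 k (f : 'I_k -> bool) (i j : 'I_k) :
      rel_coord f (cube_vertex (flip f i) : 'rV[R]_k) j = (j == i)%:R.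
    by rewrite /rel_coord mxE /flip; case: eqP => _; case: (f j) => //=; ring.
  move=> i j i' j' [Fi Fj hij] [Fi' Fj' hij'].
  have := isometry_flip he hij Fe Fi (compat_vertex (compat_flip Fe Fi')).
  rewrite hij' !D1; case: (i =P i') => [->|ii']; case: (j =P j') => [->|jj'] //.
    by move/eqP; rewrite eq_sym oner_eq0.
  by move/eqP; rewrite oner_eq0.
- by move=> u i j Fu [Fi Fj hij]; apply: isometry_flip.
Qed.

End Isometry.
End CubeIsometries.

Section Gluing.
Context {R : realType} {X : metricType R} (K : cube_complex X).
Implicit Types (c : cell K).
Local Notation code c := ('I_(cell_dim c) -> bool).
Local Notation coord c := ('I_(cell_dim c) -> R).

Definition pos c (e : code c) (a : coord c) : X := @chart _ _ K c (corner_pt e a).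

(* [in01 a] says that the corner e is a vertex of the carrier of the point with
   coordinates a relative to e; the support of a is then the set of directions
   of the carrier. *)
Definition in01 c (a : coord c) := forall i, 0 <= a i < 1.

Lemma unit_cube_corner_pt c (e : code c) (a : coord c) :
  (forall i, 0 <= a i <= 1) -> unit_cube (corner_pt e a).
Proof. by move=> a01 i; have := a01 i; rewrite mxE; case: (e i); lra. Qed.

Lemma in01W c (a : coord c) : in01 a -> forall i, 0 <= a i <= 1.
Proof. by move=> a01 i; have := a01 i; lra. Qed.

Lemma corner_exists c (u : 'rV[R]_(cell_dim c)) : unit_cube u ->
  exists (e : code c) (a : coord c), in01 a /\ u = corner_pt e a.
Proof.
move=> uu; exists (fun i => u 0 i == 1), (rel_coord (fun i => u 0 i == 1) u).
split; last by rewrite rel_coordK.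
by move=> i; rewrite /rel_coord; have := uu i; case: eqP => [->|]; lra.
Qed.

(* The points with coordinates a and a' relative to the corners e and e' of two
   cubes are identified in X, and so are these corners, the direction i of the
   carrier being identified with j when [r i j]. *)
Definition linked c c' (r : 'I_(cell_dim c) -> 'I_(cell_dim c') -> Prop)
    (e : code c) (a : coord c) (e' : code c') (a' : coord c') : Prop :=
  [/\ forall i j, r i j -> a i = a' j /\ a i <> 0,
      (forall i, a i <> 0 -> exists j, r i j) /\
      (forall j, a' j <> 0 -> exists i, r i j),
      forall i j i' j', r i j -> r i' j' -> (i = i' <-> j = j') &
      forall b b', (forall i, 0 <= b i <= 1) -> (forall i, a i = 0 -> b i = 0) ->
        (forall j, a' j = 0 -> b' j = 0) -> (forall i j, r i j -> b i = b' j) ->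
        pos e b = pos e' b'].

Lemma linked_sym c c' r (e : code c) a (e' : code c') a' : linked r e a e' a' ->
  linked (fun j i => r i j) e' a' e a.
Proof.
move=> [H1 [H2 H2'] H3 H4]; split=> //.
- by move=> j i ij; have [<-] := H1 _ _ ij.
- by move=> j i j' i' ij ij'; rewrite (H3 _ _ _ _ ij ij').
- move=> b' b b01 b'0 b0 bb'; apply/esym/H4 => // [i|i j ij].
    have [/b0 ->|/H2[j ij]] := pselect (a i = 0); first by rewrite lexx ler01.
    by rewrite -(bb' _ _ ij).
  by rewrite (bb' _ _ ij).
Qed.

Lemma linked_trans c1 c2 c3 r r' (e1 : code c1) a1 (e2 : code c2) a2
    (e3 : code c3) a3 : linked r e1 a1 e2 a2 -> linked r' e2 a2 e3 a3 ->
  linked (fun i k => exists2 j, r i j & r' j k) e1 a1 e3 a3.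
Proof.
move=> [H1 [H2 H2'] H3 H4] [I1 [I2 I2'] I3 I4]; split.
- by move=> i k [j /H1[-> ?] /I1[-> ?]].
- split=> [i /[dup] ai /H2[j ij]|k /[dup] ak /I2'[j jk]].
    have [k jk] : exists k, r' j k by apply: I2; have [<-] := H1 _ _ ij.
    by exists k, j.
  have [i ij] : exists i, r i j by apply: H2'; have [->] := I1 _ _ jk.
  by exists i, j.
- move=> i k i' k' [j ij jk] [j' ij' jk'].
  by rewrite (H3 _ _ _ _ ij ij') (I3 _ _ _ _ jk jk').
- move=> b b'' b01 b0 b0'' bb''.
  (* The intermediate point has its coordinates transported along [r], and 0 in the directions
     outside the carrier. *)
  pose b' j := if pselect (exists i, r i j) is left H then b (projT1 (cid H)) else 0.
  have b'E i j : r i j -> b' j = b i.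
    move=> ij; rewrite /b'; case: pselect => [H|H]; last by case: H; exists i.
    by case: cid => i' /= ij'; rewrite ((H3 _ _ _ _ ij ij').2 erefl).
  have b'0 j : a2 j = 0 -> b' j = 0.
    move=> aj; rewrite /b'; case: pselect => // -[i ij].
    by have [E] := H1 _ _ ij; rewrite E.
  rewrite (H4 b b') //; last by move=> i j /b'E.
  apply: I4 => // [j|j k jk].
    have [/b'0 ->|/H2'[i ij]] := pselect (a2 j = 0); first by rewrite lexx ler01.
    by rewrite (b'E _ _ ij).
  have [i ij] : exists i, r i j by apply: H2'; have [] := I1 _ _ jk.
  by rewrite (b'E _ _ ij); apply: bb''; exists j.
Qed.

Lemma linked_refl c (e : code c) a :
  linked (fun i j => i = j /\ a i <> 0) e a e a.
Proof.
split=> [i j [-> aj] //||i j i' j' [-> _] [-> _] //|b b' _ b0 b'0 bb'].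
  by split=> i ai; exists i.
congr (chart (corner_pt _ _)); apply/funext => i.
have [ai|ai] := pselect (a i = 0); first by rewrite b0 ?b'0.
exact: bb'.
Qed.

Lemma linked_pos c c' r (e : code c) a (e' : code c') a' : in01 a ->
  linked r e a e' a' -> pos e a = pos e' a'.
Proof.
move=> /in01W a01 [H1 _ _ H4]; apply: H4 => // i j /H1[] //.
Qed.

Lemma linked_corner c c' r (e : code c) a (e' : code c') a' :
  linked r e a e' a' -> pos e (fun=> 0) = pos e' (fun=> 0).
Proof. by move=> [_ _ _ H4]; apply: H4 => // i; rewrite lexx ler01. Qed.

Lemma linked_in01 c c' r (e : code c) a (e' : code c') a' : in01 a ->
  linked r e a e' a' -> in01 a'.
Proof.
move=> a01 [H1 [_ H2] _ _] j.
have [->|/H2[i /H1[<- _]]] := pselect (a' j = 0); first by rewrite lexx ltr01.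
exact: a01.
Qed.

Definition carrier_code c (e : code c) (a : coord c) : face_code (cell_dim c) :=
  fun i => if a i == 0 then Some (e i) else None.

Lemma carrier_codeP c (e : code c) (a b : coord c) : in01 a ->
  (forall i, 0 <= b i <= 1) -> (forall i, a i = 0 -> b i = 0) ->
  face (carrier_code e a) (corner_pt e b).
Proof.
move=> a01 b01 b0; split; first exact: unit_cube_corner_pt.
move=> i s; rewrite /carrier_code mxE; case: eqP => // /b0 -> [<-].
by case: (e i); rewrite ?subr0.
Qed.

Lemma carrier_interior c (e : code c) (a b : coord c) : in01 a ->
  (forall i, 0 <= b i < 1) -> (forall i, a i = 0 <-> b i = 0) ->
  face_interior (carrier_code e a) (corner_pt e b).
Proof.
move=> a01 b01 b0 i; rewrite /carrier_code mxE.
case: eqP => [/b0 ->|]; first by case: (e i); rewrite ?subr0.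
by rewrite b0; have := b01 i; case: (e i); lra.
Qed.

(** Points with the same image lie in open faces that [chart_glue] identifies by an isometry. This
    isometry matches coordinates, and injectivity of the chart on the open face shows that it sends
    the first point to [u']. *)
Lemma glue c c' (e : code c) a u' : in01 a -> unit_cube u' ->
  pos e a = @chart _ _ K c' u' ->
  exists r (e' : code c') a',
    [/\ in01 a', u' = corner_pt e' a' & linked r e a e' a'].
Proof.
move=> a01 uu' E; pose F := carrier_code e a.
have [e1 [a1 [a101 E1]]] := corner_exists uu'; pose F' := carrier_code e1 a1.
have Fa : face_interior F (corner_pt e a) by apply: carrier_interior.
have Fu' : face_interior F' u' by rewrite E1; apply: carrier_interior.
have [h [hP hE]] := chart_glue Fa Fu' E.
have Fe : compat F e by move=> i b; rewrite /F /carrier_code; case: eqP => // _ [].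
have [e' [r [Fe' rfree [rex rex'] rinj rh]]] := isometry_coord hP Fe.
have aF i : F i = None <-> a i <> 0.
  by rewrite /F /carrier_code; split; case: eqP.
have Fc (b : coord c) : (forall i, 0 <= b i <= 1) -> (forall i, a i = 0 -> b i = 0) ->
    face F (corner_pt e b) by apply: carrier_codeP.
have Fa' : face F (corner_pt e a) by apply: Fc => //; apply: in01W.
have hin : face F' (h (corner_pt e a)).
  by case: hP => <- _; exists (corner_pt e a).
have hE' (b : coord c) (b' : coord c') : (forall i, 0 <= b i <= 1) -> (forall i, a i = 0 -> b i = 0) ->
    (forall j, F' j <> None -> b' j = 0) -> (forall i j, r i j -> b i = b' j) ->
    h (corner_pt e b) = corner_pt e' b'.
  move=> b01 b0 b'0 bb'; rewrite -[LHS](rel_coordK e'); congr corner_pt.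
  apply/funext => j; case FE: (F' j) => [s|].
    rewrite b'0 ?FE //; have : face F' (h (corner_pt e b)).
      by case: hP => <- _; exists (corner_pt e b) => //; apply: Fc.
    move=> [_ /(_ _ _ FE)]; rewrite /rel_coord (Fe' _ _ FE) => ->.
    by case: s {FE}; rewrite ?subrr.
  have [i ij] := rex' _ FE; rewrite (rh _ _ _ (Fc _ b01 b0) ij) corner_ptK.
  exact: bb'.
pose a' := rel_coord e' u'.
have hu : h (corner_pt e a) = u'.
  apply: (@chart_inj _ _ K c' F').
  - rewrite inE => j; case FE: (F' j) => [s|]; first exact: (proj2 hin _ _ FE).
    have [i ij] := rex' _ FE; have := rh _ _ _ Fa' ij.
    have [/aF ai _] := rfree _ _ ij; have := a01 i.
    rewrite /rel_coord; rewrite -/(rel_coord e _ i) corner_ptK.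
    by case: (e' j) => ai1 E2; have /eqP : a i <> 0 by []; lra.
  - by rewrite inE.
  - by rewrite -hE.
have aa' i j : r i j -> a i = a' j.
  by move=> ij; rewrite /a' -hu (rh _ _ _ Fa' ij) corner_ptK.
have a'0 j : F' j <> None -> a' j = 0.
  case FE: (F' j) => [s|//] _; have [_ /(_ _ _ FE)] := hin.
  rewrite hu /a' /rel_coord (Fe' _ _ FE) => ->.
  by case: s {FE}; rewrite ?subrr.
have F'0 j : a' j = 0 -> F' j <> None.
  by move=> aj /rex'[i ij]; have [/aF + _] := rfree _ _ ij; rewrite (aa' _ _ ij).
exists r, e', a'; split; last split.
- move=> j; have [/rex'[i /aa' <-]|/a'0 ->] := pselect (F' j = None); first exact: a01.
  by rewrite lexx ltr01.
- by rewrite /a' rel_coordK.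
- by move=> i j ij; split; [exact: aa'|apply/aF; have [] := rfree _ _ ij].
- split=> [i /aF|j aj]; first exact: rex.
  by apply: rex'; apply: contrapT => /a'0.
- exact: rinj.
- move=> b b' b01 b0 b'0 bb'; rewrite /pos hE; last exact: Fc.
  by rewrite (hE' b b') // => j /a'0 /b'0.
Qed.

Lemma linked_uniq c c' r r' (e : code c) a (e1 e2 : code c') a1 a2 : in01 a ->
  linked r e a e1 a1 -> linked r' e a e2 a2 ->
  corner_pt e1 a1 = corner_pt e2 a2 -> e1 = e2 /\ a1 = a2.
Proof.
move=> a01 L1 L2 E.
have a101 := linked_in01 a01 L1; have a201 := linked_in01 a01 L2.
have Ej j : (if e1 j then 1 - a1 j else a1 j) = (if e2 j then 1 - a2 j else a2 j).
  by have := congr1 (fun u : 'rV_ _ => u 0 j) E; rewrite !mxE.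
have supp j : a1 j = 0 <-> a2 j = 0.
  by have := Ej j; have := a101 j; have := a201 j; case: (e1 j); case: (e2 j); lra.
have same j : a1 j = 0 -> e1 j = e2 j.
  move=> a0; have := Ej j; rewrite a0 (proj1 (supp j) a0).
  by case: (e1 j); case: (e2 j); lra.
suff ee : e1 = e2.
  split=> //; apply/funext => j; have := Ej j; rewrite ee.
  by case: (e2 j) => //; lra.
apply/funext => j; have [/same //|aj] := pselect (a1 j = 0).
(* A test point with the same carrier: since 1/4 differs from 1 - 1/4, its position in the cube
   reveals the corner, which the original coordinates fail to do when they equal 1/2. *)
pose q n (a' : 'I_n -> R) i : R := if a' i == 0 then 0 else 4^-1.
have q01 n (a' : 'I_n -> R) i : 0 <= q n a' i < 1 by rewrite /q; case: eqP; lra.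
have q0 n (a' : 'I_n -> R) i : a' i = 0 <-> q n a' i = 0.
  by rewrite /q; case: eqP => //; split=> //; lra.
have pq c2 (e3 : code c2) a3 rr : linked rr e a e3 a3 -> pos e (q _ a) = pos e3 (q _ a3).
  move=> [H1 _ _ H4]; apply: H4 => [i|i /q0//|i /q0//|i k /H1[aa _]].
    by have := q01 _ a i; lra.
  by rewrite /q aa.
have : corner_pt e1 (q _ a1) = corner_pt e2 (q _ a2).
  apply: (@chart_inj _ _ K c' (carrier_code e1 a1)).
  - by rewrite inE; apply: carrier_interior.
  - rewrite inE; have -> : carrier_code e1 a1 = carrier_code e2 a2.
      apply/funext => i; rewrite /carrier_code.
      case: eqP => [/[dup] /same -> /supp ->|ai]; first by rewrite eqxx.
      by case: eqP => // /supp.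
    exact: carrier_interior.
  - by rewrite -/(pos _ _) -(pq _ _ _ _ L1) (pq _ _ _ _ L2).
move=> /(congr1 (fun u : 'rV_ _ => u 0 j)); rewrite !mxE /q.
have [/eqP/negPf -> /eqP/negPf ->] : a1 j <> 0 /\ a2 j <> 0 by split=> // /supp.
by case: (e1 j); case: (e2 j) => //; lra.
Qed.

Definition flipc n (a : 'I_n -> R) (i j : 'I_n) : R := if j == i then 1 - a j else a j.

Lemma corner_pt_flip n (e : 'I_n -> bool) (a : 'I_n -> R) i :
  corner_pt (flip e i) (flipc a i) = corner_pt e a.
Proof.
apply/rowP => j; rewrite !mxE /flip /flipc; case: eqP => // _.
by case: (e j) => //=; lra.
Qed.

Lemma flipcK n (a : 'I_n -> R) i : flipc (flipc a i) i = a.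
Proof. by apply/funext => j; rewrite /flipc; case: eqP => // _; lra. Qed.

Lemma in01_flip c (a : coord c) i : in01 a -> a i <> 0 -> in01 (flipc a i).
Proof.
move=> a01 ai j; have := a01 j; rewrite /flipc; case: eqP => // ->.
by have /eqP := ai; lra.
Qed.

Lemma linked_flip c c' r (e : code c) a (e' : code c') a' i j : in01 a ->
  linked r e a e' a' -> r i j ->
  linked r (flip e i) (flipc a i) (flip e' j) (flipc a' j).
Proof.
move=> a01 L ij; have a01' := linked_in01 a01 L; case: (L) => H1 [H2 H2'] H3 H4.
have [aij ai0] := H1 _ _ ij.
have fa k : flipc a i k = 0 <-> a k = 0.
  by rewrite /flipc; case: eqP => // ->; have := a01 i; split; lra.
have fa' k : flipc a' j k = 0 <-> a' k = 0.
  by rewrite /flipc; case: eqP => // ->; have := a01' j; rewrite -aij; split; lra.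
have rE i' j' : r i' j' -> (i' == i) = (j' == j).
  by move=> ij'; apply/eqP/eqP; have [] := H3 _ _ _ _ ij' ij.
split.
- move=> i' j' ij'; have [aa ai'] := H1 _ _ ij'; split; last by rewrite fa.
  by rewrite /flipc (rE _ _ ij') aa.
- by split=> k; [rewrite fa; apply: H2|rewrite fa'; apply: H2'].
- exact: H3.
- move=> b b' b01 b0 b'0 bb'.
  rewrite /pos -(corner_pt_flip _ b i) -(corner_pt_flip _ b' j) !flipK.
  apply: H4.
  + by move=> k; have := b01 k; rewrite /flipc; case: eqP => _; lra.
  + move=> k ak; rewrite /flipc; case: eqP => [ki|_]; last by apply/b0/fa.
    by rewrite ki in ak.
  + move=> k ak; rewrite /flipc; case: eqP => [ki|_]; last by apply/b'0/fa'.
    by rewrite ki -aij in ak.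
  + by move=> i' j' ij'; rewrite /flipc (rE _ _ ij') (bb' _ _ ij').
Qed.

End Gluing.

(** * The skeleton of a cube complex *)

Section Skeleton.
Context {R : realType} {X : metricType R} (K : cube_complex X).
Implicit Types (c : cell K).
Local Notation code c := ('I_(cell_dim c) -> bool).
Local Notation coord c := ('I_(cell_dim c) -> R).

Definition clamp (t : R) : R := if t <= 0 then 0 else if 1 <= t then 1 else t.

Lemma clamp01 t : 0 <= clamp t <= 1.
Proof. by rewrite /clamp; case: ifP => H1; [|case: ifP => H2]; lra. Qed.

Lemma clamp_id t : 0 <= t <= 1 -> clamp t = t.
Proof. by rewrite /clamp; case: ifP => H1; [|case: ifP => H2]; lra. Qed.

Lemma clampN t : clamp (1 - t) = 1 - clamp t.
Proof.
by rewrite /clamp; do ?[case: ifP => ?]; lra.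
Qed.

Definition axis n (i : 'I_n) (t : R) (j : 'I_n) : R := if j == i then t else 0.

Lemma axis01 n (i : 'I_n) t : 0 <= t <= 1 -> forall j, 0 <= axis i t j <= 1.
Proof. by move=> t01 j; rewrite /axis; case: eqP => //; lra. Qed.

(* An oriented edge is the path that runs through it, made constant outside the
   unit interval. *)
Definition edge_path c (e : code c) i (t : R) : X := pos e (axis i (clamp t)).

Definition edge_type := {g : R -> X | exists c (e : code c) i, g = edge_path e i}.

Definition mk_edge c (e : code c) i : edge_type :=
  exist _ (edge_path e i) (ex_intro _ c (ex_intro _ e (ex_intro _ i erefl))).

Lemma edge_type_inj (g g' : edge_type) : sval g = sval g' -> g = g'.
Proof.
case: g g' => g Hg [g' Hg'] /= E; subst g'; congr exist; exact: Prop_irrelevance.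
Qed.

Lemma mk_edgeP (g : edge_type) : exists c (e : code c) i, g = mk_edge e i.
Proof.
case: (proj2_sig g) => c [e [i E]]; exists c, e, i; exact: edge_type_inj.
Qed.

Definition vert_type := {v : X | is_vertex K v}.

Lemma corner_pt0 n (e : 'I_n -> bool) : corner_pt e (fun=> 0) = cube_vertex e :> 'rV[R]_n.
Proof. by apply/rowP => i; rewrite !mxE; case: (e i); rewrite ?subr0. Qed.

Lemma is_vertex_pos c (e : code c) : is_vertex K (pos e (fun=> 0)).
Proof. by exists c, e; rewrite /corner_at /pos corner_pt0. Qed.

Definition mk_vert c (e : code c) : vert_type := exist _ _ (is_vertex_pos e).

Lemma vert_type_inj (v v' : vert_type) : sval v = sval v' -> v = v'.
Proof.
case: v v' => v Hv [v' Hv'] /= E; subst v'; congr exist; exact: Prop_irrelevance.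
Qed.

Lemma axis0 n (i : 'I_n) : axis i 0 = fun=> 0.
Proof. by apply/funext => j; rewrite /axis; case: eqP. Qed.

Lemma edge_path0 c (e : code c) i : edge_path e i 0 = pos e (fun=> 0).
Proof. by rewrite /edge_path clamp_id ?axis0 // lexx ler01. Qed.

Lemma flipc_axis n (i : 'I_n) t : flipc (axis i t) i = axis i (1 - t).
Proof. by apply/funext => j; rewrite /flipc /axis; case: eqP. Qed.

Lemma edge_path_flip c (e : code c) i t : edge_path (flip e i) i t = edge_path e i (1 - t).
Proof. by rewrite /edge_path clampN -flipc_axis /pos -{2}[e](flipK _ i) corner_pt_flip. Qed.

Lemma edge_path1 c (e : code c) i : edge_path e i 1 = pos (flip e i) (fun=> 0).
Proof. by rewrite -[1](subr0 1) -edge_path_flip edge_path0. Qed.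

Lemma edge_src_subproof (g : edge_type) : is_vertex K (sval g 0).
Proof. by have [c [e [i ->]]] := mk_edgeP g; rewrite /= edge_path0; exact: is_vertex_pos. Qed.

Lemma edge_tgt_subproof (g : edge_type) : is_vertex K (sval g 1).
Proof. by have [c [e [i ->]]] := mk_edgeP g; rewrite /= edge_path1; exact: is_vertex_pos. Qed.

Lemma edge_inv_subproof (g : edge_type) :
  exists c (e : code c) i, (fun t => sval g (1 - t)) = edge_path e i.
Proof.
have [c [e [i ->]]] := mk_edgeP g; exists c, (flip e i), i.
by apply/funext => t; rewrite edge_path_flip.
Qed.

Definition edge_src (g : edge_type) : vert_type := exist _ _ (edge_src_subproof g).
Definition edge_tgt (g : edge_type) : vert_type := exist _ _ (edge_tgt_subproof g).
Definition edge_inv (g : edge_type) : edge_type := exist _ _ (edge_inv_subproof g).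

Lemma edge_src_mk c (e : code c) i : edge_src (mk_edge e i) = mk_vert e.
Proof. by apply: vert_type_inj; rewrite /= edge_path0. Qed.

Lemma edge_inv_mk c (e : code c) i : edge_inv (mk_edge e i) = mk_edge (flip e i) i.
Proof. by apply: edge_type_inj; apply/funext => t; rewrite /= edge_path_flip. Qed.

Lemma edge_invK : involutive edge_inv.
Proof.
by move=> g; apply: edge_type_inj; apply/funext => t /=; congr (sval g _); lra.
Qed.

Lemma edge_src_inv g : edge_src (edge_inv g) = edge_tgt g.
Proof. by apply: vert_type_inj; rewrite /= subr0. Qed.

Lemma edge_tgt_mk c (e : code c) i : edge_tgt (mk_edge e i) = mk_vert (flip e i).
Proof. by rewrite -edge_src_inv edge_inv_mk edge_src_mk. Qed.

Definition edge_square (g f g' f' : edge_type) : Prop :=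
  exists c (e : code c) i j, i <> j /\
    [/\ g = mk_edge e i, f = mk_edge e j, g' = mk_edge (flip e j) i &
        f' = mk_edge (flip e i) j].

Lemma edge_square_src g f g' f' : edge_square g f g' f' -> edge_src f = edge_src g.
Proof. by move=> [c [e [i [j [_ [-> -> _ _]]]]]]; rewrite !edge_src_mk. Qed.

Lemma edge_square_srcl g f g' f' : edge_square g f g' f' -> edge_src g' = edge_tgt f.
Proof. by move=> [c [e [i [j [_ [_ -> -> _]]]]]]; rewrite edge_src_mk edge_tgt_mk. Qed.

Lemma edge_square_sym g f g' f' : edge_square g f g' f' -> edge_square f g f' g'.
Proof.
move=> [c [e [i [j [ij [-> -> -> ->]]]]]]; exists c, e, j, i; split=> // E.
by apply: ij.
Qed.

Lemma edge_square_rot g f g' f' :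
  edge_square g f g' f' -> edge_square (edge_inv g) f' (edge_inv g') f.
Proof.
move=> [c [e [i [j [ij [-> -> -> ->]]]]]]; exists c, (flip e i), i, j.
by rewrite !edge_inv_mk flipK (flipC e i j).
Qed.

Lemma corner_germP c (e : code c) (J : {set 'I_(cell_dim c)}) x : corner_germ e J x <->
  exists2 a : coord c, forall i, if i \in J then is_true (0 < a i < 2^-1) else a i = 0
    & x = pos e a.
Proof.
split=> [[u [uu uJ] <-]|[a aJ ->]].
  exists (rel_coord e u); last by rewrite /pos rel_coordK.
  move=> i; have := uJ i; have := uu i; rewrite /rel_coord.
  case: ifP => _ u01; last by move=> ->; case: (e i); rewrite ?subrr.
  case: (e i) => /=; last by rewrite subr0 ger0_norm //; lra.
  by rewrite ler0_norm; lra.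
exists (corner_pt e a) => //; split=> [i|i].
  have := aJ i; rewrite mxE; case: ifP => _ ai; case: (e i) => //; lra.
have := aJ i; rewrite mxE; case: ifP => _ ai; last by rewrite ai; case: (e i); rewrite ?subr0.
case: (e i) => /=; last by rewrite subr0 ger0_norm //; lra.
by rewrite ler0_norm; lra.
Qed.

Lemma germ_edge_path c (e : code c) i :
  corner_germ e [set i]%SET = edge_path e i @` [set t | 0 < t < 2^-1].
Proof.
apply/seteqP; split=> x.
  move=> /corner_germP[a ai ->]; have := ai i; rewrite inE eqxx => ai1.
  exists (a i) => //; rewrite /edge_path clamp_id; last by lra.
  congr pos; apply/funext => j; rewrite /axis; case: eqP => [->//|/eqP ji].
  by have := ai j; rewrite inE (negPf ji) => ->.
move=> [t /= t01 <-]; apply/corner_germP; exists (axis i t).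
  by move=> j; rewrite /axis inE; case: eqP.
by rewrite /edge_path clamp_id //; lra.
Qed.

Lemma linked_edge c c' r (e : code c) a (e' : code c') a' i j :
  linked r e a e' a' -> r i j -> mk_edge e i = mk_edge e' j.
Proof.
move=> [H1 _ H3 H4] ij; apply: edge_type_inj; apply/funext => t /=.
have [aij ai] := H1 _ _ ij.
apply: H4.
- exact/axis01/clamp01.
- by move=> k ak; rewrite /axis; case: eqP => // ki; rewrite ki in ak.
- by move=> k ak; rewrite /axis; case: eqP => // ki; rewrite ki -aij in ak.
- move=> i' j' ij'; rewrite /axis; have [H H'] := H3 _ _ _ _ ij' ij.
  by rewrite (_ : (i' == i) = (j' == j)) //; apply/eqP/eqP.
Qed.

(** Of [t] and [1 - t] at most one is below 1/2, so the corner produced by [glue] must be [e']. *)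
Lemma germ_linked c c' (e : code c) a (e' : code c') b :
  (forall i, 0 <= a i < 2^-1) -> (forall j, 0 <= b j < 2^-1) ->
  pos e a = pos e' b -> exists r, linked r e a e' b.
Proof.
move=> a2 b2 E.
have a01 : in01 a by move=> i; have := a2 i; lra.
have b01 : in01 b by move=> i; have := b2 i; lra.
have [r [e2 [a2' [a201 E2 L]]]] := glue a01 (unit_cube_corner_pt e' (in01W b01)) E.
have H j : e2 j = e' j /\ a2' j = b j.
  have := congr1 (fun u : 'rV_ _ => u 0 j) E2; rewrite !mxE.
  have : 0 <= a2' j < 2^-1.
    have [->|aj] := pselect (a2' j = 0); first by lra.
    by case: L => H1 [_ /(_ _ aj)[i /H1[<- _]]] _ _.
  have := b2 j; clear E E2 => b2j a2j.
  by case: (e' j); case: (e2 j) => H; split=> //; try lra; exfalso; lra.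
have ee : e' = e2 by apply/funext => j; case: (H j).
have ba : b = a2' by apply/funext => j; case: (H j).
by exists r; rewrite ee ba; exact L.
Qed.

Lemma germ_edge c c' (e : code c) (e' : code c') i j :
  corner_germ e [set i]%SET = corner_germ e' [set j]%SET -> mk_edge e i = mk_edge e' j.
Proof.
move=> E; have : corner_germ e [set i]%SET (pos e (axis i 4^-1)).
  by apply/corner_germP; exists (axis i 4^-1) => // k; rewrite inE /axis; case: eqP => // _; lra.
rewrite E => /corner_germP[b bj Eb].
have [||r L] := germ_linked _ _ Eb.
- by move=> k; rewrite /axis; case: eqP => _; lra.
- by move=> k; have := bj k; case: ifP => _; lra.
have [j' ij'] : exists j', r i j'.
  by case: L => _ [H _] _ _; apply: H; rewrite /axis eqxx; lra.
rewrite (linked_edge L ij'); congr mk_edge.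
case: L => H1 _ _ _; have [+ _] := H1 _ _ ij'; rewrite /axis eqxx.
have := bj j'; rewrite inE; case: eqP => // _ -> H; exfalso; move: H; lra.
Qed.

Lemma edge_germ c c' (e : code c) (e' : code c') i j :
  mk_edge e i = mk_edge e' j -> corner_germ e [set i]%SET = corner_germ e' [set j]%SET.
Proof. by move=> /(congr1 sval) /= E; rewrite !germ_edge_path E. Qed.

Lemma edge_corner_at c (e : code c) i v : edge_src (mk_edge e i) = v ->
  corner_at (sval v) e.
Proof. by rewrite edge_src_mk => <-; rewrite /corner_at /= /pos corner_pt0. Qed.

Context (flagK : forall v, is_vertex K v -> link_flag K v).

Lemma germ_inj c (e : code c) i j : mk_edge e i = mk_edge e j -> i = j.
Proof.
move=> /edge_germ; have [[H _] _] := flagK (is_vertex_pos e); apply: H.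
by rewrite /corner_at /pos corner_pt0.
Qed.

Lemma edge_square_neq g f g' f' : edge_square g f g' f' -> g <> f.
Proof. by move=> [c [e [i [j [ij [-> -> _ _]]]]]] /germ_inj. Qed.

Lemma corner_vertices2 c (e : code c) i j :
  corner_vertices e [set i; j]%SET = [set corner_germ e [set i]%SET; corner_germ e [set j]%SET].
Proof.
apply/seteqP; split=> A.
  by move=> [k /=]; rewrite !inE => /orP[] /eqP -> <-; [left|right].
by move=> [] ->; [exists i|exists j] => //=; rewrite !inE eqxx ?orbT.
Qed.

(** In a simplicial link two vertices determine the cell they span, so the two squares have the same
    germ. A point of this germ links the two corners, and the link is carried along the flips to the
    opposite edges. *)
Lemma edge_square_uniq g f g1 f1 g2 f2 :
  edge_square g f g1 f1 -> edge_square g f g2 f2 -> g1 = g2 /\ f1 = f2.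
Proof.
move=> [c [e [i [j [ij [-> -> -> ->]]]]]] [c' [e' [i' [j' [ij' [Ei Ej -> ->]]]]]].
have ce : corner_at (sval (mk_vert e)) e by rewrite /corner_at /= /pos corner_pt0.
have ce' : corner_at (sval (mk_vert e)) e'.
  by apply: (@edge_corner_at _ _ i'); rewrite -Ei edge_src_mk.
have [[_ H] _] := flagK (is_vertex_pos e).
have {}H := H _ _ [set i; j]%SET _ _ [set i'; j']%SET ce ce'.
rewrite !corner_vertices2 (edge_germ Ei) (edge_germ Ej) in H.
have {H} Eg := H erefl.
pose a k : R := if k == i then 4^-1 else if k == j then 3^-1 else 0.
have : corner_germ e [set i; j]%SET (pos e a).
  apply/corner_germP; exists a => // k; rewrite !inE /a.
  by case: eqP => _ /=; [lra|case: eqP => _ //=; lra].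
rewrite Eg => /corner_germP[b bj Eb].
have a2 k : 0 <= a k < 2^-1 by rewrite /a; case: eqP => _; [|case: eqP => _]; lra.
have b2 k : 0 <= b k < 2^-1 by have := bj k; case: ifP => _; lra.
have [r L] := germ_linked a2 b2 Eb; have [H1 [H2 _] H3 _] := L.
have a01 : in01 a by move=> k; have := a2 k; lra.
have ai0 : a i <> 0 by rewrite /a eqxx; lra.
have aj0 : a j <> 0 by rewrite /a eqxx; case: eqP => _; lra.
have rb k l : r k l -> l = i' \/ l = j'.
  move=> kl; have [akl ak] := H1 _ _ kl; have := bj l; rewrite !inE.
  case: eqP => [->|_]; first by left.
  by case: eqP => [->|_ /= b0]; [right|rewrite akl b0 in ak].
have [l il] := H2 _ ai0; have [m jm] := H2 _ aj0.
have lm : l <> m by move=> lm; apply: ij; apply/(H3 _ _ _ _ il jm).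
have li : l = i'.
  have [//|lj] := rb _ _ il; subst l; case: ij'; apply: (@germ_inj _ e').
  by rewrite -(linked_edge L il).
have mj : m = j' by have [mi|//] := rb _ _ jm; case: lm; rewrite li mi.
subst l m; split.
  exact: linked_edge (linked_flip a01 L jm) il.
exact: linked_edge (linked_flip a01 L il) jm.
Qed.

Definition germ_of (g : edge_type) : set X := sval g @` [set t | 0 < t < 2^-1].

Lemma germ_of_mk c (e : code c) i : germ_of (mk_edge e i) = corner_germ e [set i]%SET.
Proof. by rewrite germ_edge_path. Qed.

Lemma germ_of_inj g f : germ_of g = germ_of f -> g = f.
Proof.
have [c [e [i ->]]] := mk_edgeP g; have [c' [e' [i' ->]]] := mk_edgeP f.
by rewrite !germ_of_mk; apply: germ_edge.
Qed.

(* The flag condition: pairwise adjacent directions at a vertex span a cube. *)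
Lemma edges_in_cell v L : L <> [::] -> allP (fun g => edge_src g = v) L ->
  pairP (fun g f => exists g' f', edge_square g f g' f') L ->
  exists c (e : code c), allP (fun g => exists i, g = mk_edge e i) L.
Proof.
move=> L0 vL sL; have [_ flag] := flagK (proj2_sig v).
pose s := [set A | exists2 g, List.In g L & A = germ_of g].
have [||||c [e [J [ce J0 sE]]]] := flag s.
- rewrite (_ : s = germ_of @` [set g | List.In g L]); last first.
    apply/seteqP; split=> A; first by move=> [g gL ->]; exists g.
    by move=> [g gL <-]; exists g.
  apply: finite_image; elim: {vL sL s L0} L => [|g L IH].
    by apply: (@sub_finite_set _ _ set0).
  apply: (@sub_finite_set _ _ ([set g] `|` [set f | List.In f L])).
    by move=> f [<-|]; [left|right].
  by rewrite finite_setU.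
- by case: L L0 {vL sL} @s => // g L _; exists (germ_of g); exists g => //; left.
- move=> A [g gL ->]; have gv : edge_src g = v.
    elim: L vL gL {L0 sL s} => //= f L IH [fv vL] [<-//|]; exact: IH.
  have [c [e [i E]]] := mk_edgeP g; exists c, e, i; rewrite E germ_of_mk; split=> //.
  by apply: (@edge_corner_at _ _ i); rewrite -E.
- move=> A B [g gL ->] [f fL ->] AB.
  have [g' [f' S]] : exists g' f', edge_square g f g' f'.
    have gf : g <> f by move=> E; apply: AB; rewrite E.
    elim: L sL gL fL {vL L0 s} => //= k L IH [kL sL].
    have kLP h : List.In h L -> exists k' h', edge_square k h k' h'.
      by elim: L kL {IH sL} => //= h' L IH [Sh kL] [<-//|]; apply: IH.
    move=> [kg|gL] [kf|fL]; [by rewrite -kg -kf in gf|by subst k; apply: kLP| |exact: IH].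
    by subst k; have [k' [h' /edge_square_sym S]] := kLP _ gL; exists h', k'.
  have gv : edge_src g = v.
    elim: L vL gL {L0 sL s fL} => //= k L IH [kv vL] [<-//|]; exact: IH.
  case: S => c [e [i [j [ij [Eg Ef _ _]]]]].
  exists c, e, [set i; j]%SET; split.
  + by apply: (@edge_corner_at _ _ i); rewrite -Eg.
  + by rewrite cards2.
  + by rewrite Eg Ef !germ_of_mk corner_vertices2.
exists c, e.
have H g : List.In g L -> exists i, g = mk_edge e i.
  move=> gL; have : s (germ_of g) by exists g.
  by rewrite sE => -[i _ E]; exists i; apply: germ_of_inj; rewrite germ_of_mk.
elim: L H {L0 vL sL s sE} => //= g L IH H; split; first by apply: H; left.
by apply: IH => f fL; apply: H; right.
Qed.

Lemma edge_square_cube e f g e1 f1 e2 g1 f2 g2 :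
  edge_square e f e1 f1 -> edge_square e g e2 g1 -> edge_square f g f2 g2 ->
  exists e3 f3 g3, [/\ edge_square e1 g2 e3 g3, edge_square f1 g1 f3 g3 &
    edge_square e2 f2 e3 f3].
Proof.
move=> S1 S2 S3.
have [|||c [k [[i Ei] [[j Ej] [[l El] _]]]]] := @edges_in_cell (edge_src e) [:: e; f; g].
- by [].
- by rewrite /= (edge_square_src S1) (edge_square_src S2).
- by do !split; eexists; eexists; eassumption.
have ij : i <> j by move=> E; apply: (edge_square_neq S1); rewrite Ei Ej E.
have il : i <> l by move=> E; apply: (edge_square_neq S2); rewrite Ei El E.
have jl : j <> l by move=> E; apply: (edge_square_neq S3); rewrite Ej El E.
have sq (k' : code c) p q : p <> q -> edge_square (mk_edge k' p) (mk_edge k' q)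
    (mk_edge (flip k' q) p) (mk_edge (flip k' p) q).
  by move=> pq; exists c, k', p, q.
rewrite Ei Ej in S1; rewrite Ei El in S2; rewrite Ej El in S3.
have [-> ->] := edge_square_uniq S1 (sq k i j ij).
have [-> ->] := edge_square_uniq S2 (sq k i l il).
have [-> ->] := edge_square_uniq S3 (sq k j l jl).
exists (mk_edge (flip (flip k j) l) i), (mk_edge (flip (flip k i) l) j),
  (mk_edge (flip (flip k i) j) l); split.
- by rewrite (flipC k i j); apply: sq.
- exact: sq.
- by rewrite (flipC k j l) (flipC k i l); apply: sq.
Qed.

Definition flag_skeleton : square_complex :=
  SquareComplex edge_invK edge_src_inv edge_square_src edge_square_srcl
    edge_square_sym edge_square_rot edge_square_neq edge_square_uniq edge_square_cube.

Lemma flag_skeleton_corner (v : vert flag_skeleton) L N :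
  (forall c : cell K, (cell_dim c <= N)%N) -> corner v L -> (size L <= N)%N.
Proof.
move=> dimN [vL sL]; case: L => // g L in vL sL *.
have [//|c [e eL]] := edges_in_cell _ vL sL.
have [Is LI] := allP_all2P eL.
have uI : uniq Is.
  have : pairP (fun i j : 'I_(cell_dim c) => i <> j) Is.
    apply: pairP_all2 LI sL => f i h j -> -> [f' [h' /edge_square_neq fh]] ij.
    by apply: fh; rewrite ij.
  elim: Is {LI} => //= i I IH [iI /IH ->]; rewrite andbT.
  elim: I iI {IH} => //= j I IH [ij /IH]; rewrite inE negb_or => ->.
  by rewrite andbT; apply/eqP.
apply: leq_trans (dimN c); rewrite (all2P_size LI) -(card_uniqP uI).
by rewrite -[X in (_ <= X)%N](card_ord (cell_dim c)) max_card.
Qed.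

End Skeleton.

(** * Simple connectivity of the skeleton *)

Section Development.
Context {R : realType} {X : metricType R} (K : cube_complex X).
Context (flagK : forall v, is_vertex K v -> link_flag K v).
Implicit Types (c : cell K).
Local Notation code c := ('I_(cell_dim c) -> bool).
Local Notation coord c := ('I_(cell_dim c) -> R).
Local Notation S := (flag_skeleton flagK).
Local Notation word := (seq (edge S)).

Definition flips n (e : 'I_n -> bool) (s : seq 'I_n) := foldl (@flip n) e s.

Definition flipcs n (a : 'I_n -> R) (s : seq 'I_n) := foldl (@flipc R n) a s.

Lemma flipsE n (e : 'I_n -> bool) s j : flips e s j = e j (+) odd (count_mem j s).
Proof.
elim: s e => [|i s IH] e /=; first by rewrite addbF.
rewrite -/(flips _ _) IH /flip oddD eq_sym; case: (i == j) => //=.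
by rewrite addNb addbN.
Qed.

Lemma flips_cat n (e : 'I_n -> bool) s t : flips e (s ++ t) = flips (flips e s) t.
Proof. exact: foldl_cat. Qed.

Lemma flips_rev n (e : 'I_n -> bool) s : flips (flips e s) (rev s) = e.
Proof.
by apply/funext => j; rewrite !flipsE count_rev -addbA addbb addbF.
Qed.

Lemma flips_ex n (e e' : 'I_n -> bool) : exists2 s, flips e s = e' &
  forall i, i \in s -> e i != e' i.
Proof.
exists [seq i <- enum 'I_n | e i != e' i]; last by move=> i; rewrite mem_filter => /andP[].
apply/funext => j; rewrite flipsE.
have -> : count_mem j [seq i <- enum 'I_n | e i != e' i] = (e j != e' j).
  have u : uniq [seq i <- enum 'I_n | e i != e' i] by rewrite filter_uniq ?enum_uniq.
  by rewrite (count_uniq_mem _ u) mem_filter mem_enum andbT.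
by case: (e j); case: (e' j).
Qed.

Lemma corner_pt_flips n (e : 'I_n -> bool) (a : 'I_n -> R) s :
  corner_pt (flips e s) (flipcs a s) = corner_pt e a.
Proof.
by elim: s e a => //= i s IH e a; rewrite [LHS](IH (flip e i) (flipc a i)) corner_pt_flip.
Qed.

Lemma flipcs_rel n (e : 'I_n -> bool) (a : 'I_n -> R) s :
  flipcs a s = rel_coord (flips e s) (corner_pt e a).
Proof.
by rewrite -(corner_pt_flips e a s); apply/funext => j; rewrite corner_ptK.
Qed.

Fixpoint cube_word c (e : code c) (s : seq 'I_(cell_dim c)) : word :=
  if s is i :: s' then (mk_edge e i : edge S) :: cube_word (flip e i) s' else [::].

Lemma cube_word_cat c (e : code c) s t :
  cube_word e (s ++ t) = cube_word e s ++ cube_word (flips e s) t.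
Proof. by elim: s e => //= i s IH e; rewrite IH. Qed.

Lemma cube_walk c (e : code c) s :
  walk (mk_vert e : vert S) (cube_word e s) (mk_vert (flips e s)).
Proof.
elim: s e => //= i s IH e; split; first exact: edge_src_mk.
by rewrite edge_tgt_mk; apply: IH.
Qed.

Lemma cube_word_swap c (e : code c) i j s :
  homotopic (cube_word e (i :: j :: s)) (cube_word e (j :: i :: s)).
Proof.
have [->|ij] := eqVneq i j; first exact: hom_refl.
rewrite /= (flipC e i j); apply: hom_square.
by exists c, e, i, j; split=> //; apply/eqP.
Qed.

Lemma cube_word_cancel c (e : code c) i s :
  homotopic (cube_word e (i :: i :: s)) (cube_word e s).
Proof.
rewrite /= flipK.
have -> : mk_edge (flip e i) i = @inv S (mk_edge e i) by rewrite /= edge_inv_mk.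
exact: hom_cancel.
Qed.

Lemma cube_word_front c (e : code c) i s : i \in s -> exists2 t,
  homotopic (cube_word e s) (cube_word e (i :: t)) &
  (size t < size s)%N /\ forall e', flips e' s = flips e' (i :: t).
Proof.
elim: s e => // j s IH e; rewrite inE; case: eqVneq => [-> _|ij /= is_].
  by exists s; [exact: hom_refl|split].
have [t H [sz F]] := IH (flip e j) is_.
exists (j :: t); last by split=> // e'; rewrite /= -!/(flips _ _) F /= flipC.
apply: hom_trans (hom_cons _ H) _; exact: (cube_word_swap e j i t).
Qed.

(** Each direction occurs an even number of times, so the first letter occurs again; swaps bring
    that occurrence next to it and both cancel. *)
Lemma cube_word_closed c (e : code c) s : flips e s = e ->
  homotopic (cube_word e s) [::].
Proof.
have [n le_n] := ubnP (size s); elim: n => // n IHn in s e le_n *.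
case: s le_n => [|i s] le_n E; first exact: hom_refl.
have is_ : i \in s.
  have := congr1 (fun f : 'I_(cell_dim c) -> bool => f i) E.
  rewrite flipsE /= eqxx -has_pred1 has_count; case: (count_mem i s) => //=.
  by case: (e i).
have [t H [sz F]] := cube_word_front (flip e i) is_.
apply: hom_trans (hom_cons _ H) _; apply: hom_trans (cube_word_cancel e i t) _.
apply: IHn; first exact: ltn_trans sz le_n.
by move: E; rewrite /= -/(flips _ _) F /= flipK.
Qed.

Lemma rev_cube_word c (e : code c) s :
  rev_word (cube_word e s) = cube_word (flips e s) (rev s).
Proof.
elim: s e => //= i s IH e; rewrite rev_word_cons IH -/(flips _ _) rev_cons -cats1.
rewrite cube_word_cat flips_rev /=; congr (_ ++ [:: _]); exact: edge_inv_mk.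
Qed.

Lemma homotopic_closed (w w' : word) : homotopic (w ++ rev_word w') [::] -> homotopic w w'.
Proof.
move=> H; apply: hom_trans (hom_sym _) (homotopic_catr w' H).
rewrite -catA; rewrite -[X in homotopic _ X]cats0.
exact/homotopic_catl/homotopic_revl.
Qed.

Lemma cube_word_homotopic c (e : code c) s t : flips e s = flips e t ->
  homotopic (cube_word e s) (cube_word e t).
Proof.
move=> E; apply: homotopic_closed; rewrite rev_cube_word -E -cube_word_cat.
by apply: cube_word_closed; rewrite flips_cat E flips_rev.
Qed.

Record located := Located { lcell : cell K; lcode : code lcell; lcoord : coord lcell }.
Arguments lcode : clear implicits.
Arguments lcoord : clear implicits.

Lemma locate_ex (x : X) :
  exists p : located, in01 (lcoord p) /\ pos (lcode p) (lcoord p) = x.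
Proof.
have [c [u [uu <-]]] := chart_cover K x.
have [e [a [a01 ->]]] := corner_exists uu.
by exists (@Located c e a).
Qed.

(** An arbitrary choice, with no continuity in [x]: the vertex [base x] jumps from point to point,
    and the words of [conn] below record the jumps. *)
Definition locate x : located := projT1 (cid (locate_ex x)).

Lemma locate01 x : in01 (lcoord (locate x)).
Proof. by rewrite /locate; case: cid => p []. Qed.

Lemma locateE x : pos (lcode (locate x)) (lcoord (locate x)) = x.
Proof. by rewrite /locate; case: cid => p []. Qed.

Definition base x : vert S := mk_vert (lcode (locate x)).

(* The corner [e] and the coordinates [a] describe x in the way [locate x] does. *)
Definition lift x c (e : code c) (a : coord c) :=
  exists r, linked r (lcode (locate x)) (lcoord (locate x)) e a.

Lemma lift_locate x : lift x (lcode (locate x)) (lcoord (locate x)).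
Proof. by eexists; exact: linked_refl. Qed.

Lemma lift01 x c (e : code c) a : lift x e a -> in01 a.
Proof. by move=> [r]; apply: linked_in01; apply: locate01. Qed.

Lemma lift_pos x c (e : code c) a : lift x e a -> pos e a = x.
Proof. by move=> [r /linked_pos <-]; [exact: locateE|exact: locate01]. Qed.

Lemma lift_base x c (e : code c) a : lift x e a -> base x = mk_vert e.
Proof. by move=> [r L]; apply: vert_type_inj; exact: linked_corner L. Qed.

Lemma lift_trans x c (e : code c) a c' (e' : code c') a' r :
  lift x e a -> linked r e a e' a' -> lift x e' a'.
Proof. by move=> [q L] /(linked_trans L) H; eexists; exact: H. Qed.

Lemma lift_linked x c (e : code c) a c' (e' : code c') a' :
  lift x e a -> lift x e' a' -> exists r, linked r e a e' a'.
Proof. by move=> [q /linked_sym L] [q' /(linked_trans L) H]; eexists; exact: H. Qed.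

Lemma lift_ex c (u : 'rV[R]_(cell_dim c)) : unit_cube u ->
  exists (e : code c) a, u = corner_pt e a /\ lift (@chart _ _ K c u) e a.
Proof.
move=> uu; have [r [e [a [_ E L]]]] :=
  glue (@locate01 _) uu (locateE (@chart _ _ K c u)).
by exists e, a; split=> //; exists r.
Qed.

Lemma gap_ex x : exists g : R, [/\ 0 < g, g <= 1 &
  forall i, lcoord (locate x) i <> 0 -> g <= lcoord (locate x) i <= 1 - g].
Proof.
move: (lcoord (locate x)) (@locate01 x) => a a01.
pose f i := if a i == 0 then 1 else Num.min (a i) (1 - a i).
exists (\big[Num.min/1]_i f i); split.
- elim/big_ind: _ => [|y z y0 z0|i _]; [lra|by rewrite lt_min y0|].
  by rewrite /f; case: eqP => [_|ai]; [lra|rewrite lt_min; have := a01 i; lra].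
- elim/big_rec: _ => // i y _ y1; rewrite ge_min y1 orbT //.
- move=> i ai; have le : \big[Num.min/1]_i f i <= f i by rewrite (bigD1 i) //= ge_min lexx.
  have : f i <= a i /\ f i <= 1 - a i.
    by rewrite /f; case: eqP => // _; rewrite !ge_min !lexx orbT.
  lra.
Qed.

(* The coordinates of x keep a distance [gap x] from 0 and 1 unless they are 0.
   Lifts to one cube of a point within [eps x] of x then come from the same lift
   of x, with room to compare two of them. *)
Definition gap x : R := projT1 (cid (gap_ex x)).
Definition eps x : R := gap x / 4.

Lemma gapP x : [/\ 0 < gap x, gap x <= 1 &
  forall i, lcoord (locate x) i <> 0 -> gap x <= lcoord (locate x) i <= 1 - gap x].
Proof. by rewrite /gap; case: cid. Qed.

Lemma eps_gt0 x : 0 < eps x.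
Proof. by rewrite /eps; have [] := gapP x; lra. Qed.

Lemma lift_gap x c (e : code c) a i : lift x e a -> a i <> 0 -> gap x <= a i <= 1 - gap x.
Proof.
move=> [r [H1 [_ H2] _ _]] /[dup] ai /H2[j ji].
by have [E lj] := H1 _ _ ji; have [_ _ /(_ _ lj)] := gapP x; rewrite E.
Qed.

Definition close n (u v : 'rV[R]_n) (d : R) := forall i, `|u 0 i - v 0 i| < d.

Lemma close_corner_pt n (e : 'I_n -> bool) (a b : 'I_n -> R) d :
  close (corner_pt e a) (corner_pt e b) d <-> forall i, `|a i - b i| < d.
Proof.
have H i : `|corner_pt e a 0 i - corner_pt e b 0 i| = `|a i - b i|.
  rewrite !mxE; case: (e i) => //; rewrite -[RHS]normrN; congr `| _ |; lra.
by split=> H' i; have := H' i; rewrite H.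
Qed.

Lemma close_sym n (u v : 'rV[R]_n) d : close u v d -> close v u d.
Proof. by move=> H i; rewrite distrC; apply: H. Qed.

Lemma close_trans n (u v w : 'rV[R]_n) d d' : close u v d -> close v w d' ->
  close u w (d + d').
Proof.
move=> H H' i; have -> : u 0 i - w 0 i = (u 0 i - v 0 i) + (v 0 i - w 0 i) by lra.
by apply: le_lt_trans (ler_normD _ _) _; apply: ltrD.
Qed.

(** Nonzero coordinates of a lift stay [gap x] away from 0 and 1, so lifts this close lie in the
    same open face. There the chart is injective, and [linked_uniq] recovers the corner. *)
Lemma lift_uniq x c (e1 e2 : code c) a1 a2 : lift x e1 a1 -> lift x e2 a2 ->
  close (corner_pt e1 a1) (corner_pt e2 a2) (gap x) -> e1 = e2 /\ a1 = a2.
Proof.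
move=> L1 L2 cl; have a101 := lift01 L1; have a201 := lift01 L2.
have [g0 g1 _] := gapP x.
have H i (e e' : code c) a a' : lift x e a -> lift x e' a' ->
    close (corner_pt e a) (corner_pt e' a') (gap x) -> a i = 0 -> a' i = 0.
  move=> L L' cl' ai; apply: contrapT => ai'; have := lift_gap L' ai'.
  have := cl' i; rewrite !mxE ai ltr_norml; case: (e i); case: (e' i); lra.
have supp' i : a1 i = 0 <-> a2 i = 0.
  by split; [exact: H L1 L2 cl|exact: H L2 L1 (close_sym cl)].
have same i : a1 i = 0 -> e1 i = e2 i.
  move=> ai; have := cl i; rewrite !mxE ai (proj1 (supp' i) ai) ltr_norml.
  by case: (e1 i); case: (e2 i) => //; lra.
have E : corner_pt e1 a1 = corner_pt e2 a2.
  apply: (@chart_inj _ _ K c (carrier_code e1 a1)).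
  - by rewrite inE; apply: carrier_interior.
  - rewrite inE; have -> : carrier_code e1 a1 = carrier_code e2 a2.
      apply/funext => i; rewrite /carrier_code.
      case: eqP => [/[dup] /same -> /supp' ->|ai]; first by rewrite eqxx.
      by case: eqP => // /supp'.
    exact: carrier_interior.
  - by rewrite -/(pos _ _) -/(pos e2 a2) (lift_pos L1) (lift_pos L2).
case: L1 L2 => r L1 [r' L2].
exact: linked_uniq (@locate01 x) L1 L2 E.
Qed.

(** Restricts an identification of carriers to a face: it is used to move a lift of [x] to another
    cube along with a nearby point, whose carrier contains that of [x]. *)
Lemma linked_sub c c' r (e : code c) b (e' : code c') b' (a : coord c) :
  linked r e b e' b' -> (forall i, b i = 0 -> a i = 0) ->
  exists a', [/\ linked (fun i j => r i j /\ a i <> 0) e a e' a',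
    forall i j, r i j -> a i = a' j & forall j, b' j = 0 -> a' j = 0].
Proof.
move=> [H1 [H2 H2'] H3 H4] ba.
pose a' j := if pselect (exists i, r i j) is left H then a (projT1 (cid H)) else 0.
have a'E i j : r i j -> a i = a' j.
  move=> ij; rewrite /a'; case: pselect => [H|H]; last by case: H; exists i.
  by case: cid => i' /= ij'; rewrite ((H3 _ _ _ _ ij ij').2 erefl).
have a'0 j : b' j = 0 -> a' j = 0.
  move=> bj; rewrite /a'; case: pselect => // -[i ij].
  by have [E] := H1 _ _ ij; rewrite E.
exists a'; split=> //; split.
- by move=> i j [ij ai]; split=> //; apply: a'E.
- split=> [i ai|j aj].
    have [j ij] : exists j, r i j by apply: H2 => /ba.
    by exists j.
  have [i ij] : exists i, r i j by apply: H2' => /a'0.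
  by exists i; rewrite (a'E _ _ ij).
- by move=> i j i' j' [ij _] [ij' _]; apply: H3.
- move=> d d' d01 d0 d'0 dd'; apply: H4 => // [i /ba /d0 //|j /a'0 /d'0 //|i j ij].
  have [ai|ai] := pselect (a i = 0); last exact: dd'.
  by rewrite d0 // d'0 // -(a'E _ _ ij).
Qed.

Lemma linked_flips c c' r (e : code c) a (e' : code c') a' s s' : in01 a ->
  linked r e a e' a' -> all2P r s s' ->
  linked r (flips e s) (flipcs a s) (flips e' s') (flipcs a' s') /\
  cube_word e s = cube_word e' s'.
Proof.
elim: s s' e a e' a' => [|i s IH] [|j s'] e a e' a' //= a01 L [ij ss'].
have ai : a i <> 0 by case: L => H1 _ _ _; case: (H1 _ _ ij).
have [L' ->] := IH s' _ _ _ _ (in01_flip a01 ai) (linked_flip a01 L ij) ss'.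
by split=> //; rewrite (linked_edge L ij).
Qed.

Lemma linked_matched c c' r (e : code c) a (e' : code c') a' s :
  linked r e a e' a' -> (forall i, i \in s -> a i <> 0) -> exists s', all2P r s s'.
Proof.
move=> [_ [H2 _] _ _] sa; apply: allP_all2P; elim: s sa => //= i s IH sa.
split; first by apply/H2/sa; rewrite inE eqxx.
by apply: IH => j js; apply: sa; rewrite inE js orbT.
Qed.

Lemma all2P_rev T U (r : T -> U -> Prop) s s' : all2P r s s' -> all2P r (rev s) (rev s').
Proof.
have cat s1 t1 x y : all2P r s1 t1 -> r x y -> all2P r (rcons s1 x) (rcons t1 y).
  by elim: s1 t1 => [|a s1 IH] [|b t1] //= [ab /IH H] /H.
elim: s s' => [|x s IH] [|y s'] //= [xy /IH H]; rewrite !rev_cons; exact: cat.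
Qed.

Lemma flipcs0 n (a : 'I_n -> R) s i : (forall j, 0 <= a j < 1) ->
  (forall j, j \in s -> a j <> 0) -> flipcs a s i = 0 <-> a i = 0.
Proof.
elim: s a => //= j s IH a a01 sa.
have aj : a j <> 0 by apply: sa; rewrite inE eqxx.
have fa k : flipc a j k = 0 <-> a k = 0.
  by rewrite /flipc; case: eqP => // ->; have := a01 j; split; lra.
rewrite -/(flipcs _ _) IH ?fa // => k.
  have := a01 k; rewrite /flipc; case: eqP => // ->; have /eqP := aj; have := a01 j; lra.
by move=> ks; rewrite fa; apply: sa; rewrite inE ks orbT.
Qed.

Lemma flips_self n (e : 'I_n -> bool) (a : 'I_n -> R) s :
  flips (flips e s) (rev s) = e /\ flipcs (flipcs a s) (rev s) = a.
Proof.
rewrite flips_rev; split=> //; apply/funext => j.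
by rewrite (flipcs_rel (flips e s)) corner_pt_flips flips_rev corner_ptK.
Qed.

(* The developing map near x: inside one cube, p flips the corner of a lift of x
   into the corner of a lift of the nearby point y. *)
Definition conn x y (p : word) := exists c (e : code c) a b s,
  [/\ lift x e a, close (corner_pt e a) (corner_pt e b) (eps x),
      forall i, i \in s -> b i <> 0, lift y (flips e s) (flipcs b s) &
      in01 b /\ p = cube_word e s].

Lemma close_supp x c (e : code c) a b : lift x e a ->
  close (corner_pt e a) (corner_pt e b) (eps x) -> forall i, b i = 0 -> a i = 0.
Proof.
move=> L cl i bi; apply: contrapT => ai.
have := (close_corner_pt e a b (eps x)).1 cl i; have := lift_gap L ai.
by rewrite bi subr0 /eps ltr_norml; have [g0 _ _] := gapP x; lra.
Qed.

(** The word of [conn] may be read in any cube that contains a lift of [y]: the matching of the two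
    lifts transports the flips, and with them the lift of [x]. *)
Lemma conn_lift x y p c (e1 : code c) b1 : conn x y p -> lift y e1 b1 ->
  exists (e : code c) a s, [/\ lift x e a,
    close (corner_pt e a) (corner_pt e1 b1) (eps x), flips e s = e1 & p = cube_word e s].
Proof.
move=> [c0 [e0 [a0 [b0 [s [Lx cl sb Ly [b01 ->]]]]]]] L1.
have [r L] := lift_linked Ly L1.
have b01' := lift01 Ly.
have [s' ss'] := linked_matched L (s := s)
  (fun i is_ => fun E => sb i is_ ((flipcs0 i b01 sb).1 E)).
have [L' _] := linked_flips b01' L (all2P_rev ss').
move: L'; have [-> ->] := flips_self e0 b0 s.
set e := flips e1 (rev s'); set b := flipcs b1 (rev s') => L'.
have [a [La ra a00]] := linked_sub L' (close_supp Lx cl).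
exists e, a, s'; split.
- exact: lift_trans Lx La.
- rewrite -(corner_pt_flips e1 b1 (rev s')); apply/close_corner_pt => j.
  have [bj|bj] := pselect (b j = 0).
    by rewrite a00 // -/b bj subrr normr0; apply: eps_gt0.
  case: L' => H1 [_ H2] _ _; have [i ij] := H2 _ bj.
  have [E _] := H1 _ _ ij; rewrite -/b -E -(ra _ _ ij).
  exact: ((close_corner_pt e0 a0 b0 (eps x)).1 cl i).
- by rewrite /e -{2}(revK s') flips_rev.
- by have [_] := linked_flips b01 L' ss'.
Qed.

Lemma conn_refl x : conn x x [::].
Proof.
exists _, (lcode (locate x)), (lcoord (locate x)), (lcoord (locate x)), [::].
split=> //; [exact: lift_locate| |exact: lift_locate|split=> //; exact: locate01].
by move=> i; rewrite subrr normr0; apply: eps_gt0.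
Qed.

Lemma conn_trans x x' y p q r : eps x' <= eps x ->
  conn x x' p -> conn x' y q -> conn x y r -> homotopic r (p ++ q).
Proof.
move=> le_eps px [c [e2 [a2 [b2 [s2 [Lx' cl2 _ Ly [_ ->]]]]]]] ry.
have [e [a [s [Lx cl es ->]]]] := conn_lift px Lx'.
have [e' [a' [s' [Lx1 cl1 es' ->]]]] := conn_lift ry Ly.
rewrite corner_pt_flips in cl1.
(* The two lifts of [x] are joined by three displacements, each at most [eps x]; three quarters of
   [gap x] are less than [gap x]. *)
have [ee aa] : e = e' /\ a = a'.
  apply: (lift_uniq Lx Lx1) => i.
  have := close_trans (close_trans cl cl2) (close_sym cl1) i.
  by have := eps_gt0 x; move: le_eps; rewrite /eps; lra.
subst e' a' e2; rewrite -cube_word_cat; apply: cube_word_homotopic.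
by rewrite flips_cat.
Qed.

Lemma conn_cube x y y' p p' c (e e' : code c) b b' s : conn x y p -> conn x y' p' ->
  lift y e b -> lift y' e' b' -> flips e s = e' ->
  close (corner_pt e b) (corner_pt e' b') (eps x) ->
  homotopic (rev_word p ++ p') (cube_word e s).
Proof.
move=> py py' Ly Ly' es cl.
have [e1 [a1 [s1 [Lx1 cl1 es1 ->]]]] := conn_lift py Ly.
have [e2 [a2 [s2 [Lx2 cl2 es2 ->]]]] := conn_lift py' Ly'.
have [ee aa] : e1 = e2 /\ a1 = a2.
  apply: (lift_uniq Lx1 Lx2) => i.
  have := close_trans (close_trans cl1 cl) (close_sym cl2) i.
  by have := eps_gt0 x; rewrite /eps; lra.
subst e2 a2; apply: (@hom_trans S _ (rev_word (cube_word e1 s1) ++ cube_word e1 (s1 ++ s))).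
  by apply/homotopic_catl/cube_word_homotopic; rewrite flips_cat es1 es.
rewrite cube_word_cat catA es1 -[X in homotopic _ X]cat0s.
exact/homotopic_catr/homotopic_revl.
Qed.

Definition near_lift x y (d : R) := 0 <= d /\ exists c (e : code c) a b,
  [/\ lift x e a, forall i, 0 <= b i <= 1, pos e b = y & forall i, `|a i - b i| <= d].

Lemma near_lift01 x c (e : code c) a b d : lift x e a -> (forall i, 0 <= b i <= 1) ->
  (forall i, `|a i - b i| <= d) -> d < eps x -> in01 b.
Proof.
move=> L b01 ab deps i; have := ab i; have := b01 i; rewrite ler_norml.
have [g0 g1 _] := gapP x; move: deps; rewrite /eps.
have [->|ai] := pselect (a i = 0); first by lra.
by have := lift_gap L ai; lra.
Qed.

Lemma near_lift_glue x y d c' (u : 'rV[R]_(cell_dim c')) :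
  near_lift x y d -> d < eps x -> unit_cube u -> @chart _ _ K c' u = y ->
  exists (e : code c') a b, [/\ lift x e a, in01 b, u = corner_pt e b &
    forall i, `|a i - b i| <= d].
Proof.
move=> [d0 [c [e [a [b [L b01 Ey ab]]]]]] deps uu Eu.
have b01' := near_lift01 L b01 ab deps.
have [r [e' [b' [b'01 E L']]]] := glue b01' uu (etrans Ey (esym Eu)).
have ba i : b i = 0 -> a i = 0.
  move=> bi; apply: contrapT => ai; have := lift_gap L ai; have := ab i.
  by rewrite bi subr0 ler_norml; have [g0 _ _] := gapP x; move: deps; rewrite /eps; lra.
have [a' [La ra a00]] := linked_sub L' ba.
exists e', a', b'; split=> //; first exact: lift_trans L La.
move=> j; have [bj|bj] := pselect (b' j = 0).
  by rewrite a00 // bj subrr normr0.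
case: L' => H1 [_ H2] _ _; have [i ij] := H2 _ bj.
by have [E1 _] := H1 _ _ ij; rewrite -E1 -(ra _ _ ij).
Qed.

(** While the total length is below [eps x], the nonzero coordinates of [x] cannot become 0, so each
    new cube of the string still contains a lift of [x], to which [near_lift_glue] passes. *)
Lemma string_near x y0 y l : string_length (@chart _ _ K) y0 y l -> forall d,
  near_lift x y0 d -> d + l < eps x -> near_lift x y (d + l).
Proof.
elim=> [z d|c u v z l' uu vu str IH d ny dl]; first by rewrite addr0.
have l0 : 0 <= l'.
  by elim: str {IH dl} => // c1 u1 v1 y1 l1 _ _ _ IH; apply: addr_ge0 => //; apply: sqrtr_ge0.
have uv0 : 0 <= euclidean_dist u v by apply: sqrtr_ge0.
have [d0 _] := ny.
rewrite addrA; apply: IH; last by rewrite -addrA.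
split; first by lra.
have [|e [a [b [L b01 E ab]]]] := near_lift_glue ny _ uu erefl; first by lra.
exists c, e, a, (rel_coord e v); split=> //.
- by move=> i; have := vu i; rewrite /rel_coord; case: (e i) => //; lra.
- by rewrite /pos rel_coordK.
- move=> i; have := coord_le_dist u v i; have := ab i.
  rewrite {1}E mxE /rel_coord !ler_norml; case: (e i); lra.
Qed.

Lemma near_conn x y d : near_lift x y d -> d < eps x -> exists p, conn x y p.
Proof.
move=> [d0 [c [e [a [b [L b01 Ey ab]]]]]] deps.
have b01' := near_lift01 L b01 ab deps.
have [e' [b' [E L']]] := lift_ex (unit_cube_corner_pt e b01).
rewrite -/(pos e b) Ey in L'.
have [s es se] := flips_ex e e'.
exists (cube_word e s), c, e, a, b, s; split=> //.
- by apply/close_corner_pt => i; apply: le_lt_trans (ab i) deps.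
- move=> i /se; have := congr1 (fun u : 'rV_ _ => u 0 i) E; rewrite !mxE.
  move=> Ei ee bi; move: Ei ee; rewrite bi; have := lift01 L' i.
  by case: (e i); case: (e' i) => //; lra.
- have -> : flipcs b s = b'.
    rewrite (flipcs_rel e) E es; apply/funext => i; exact: corner_ptK.
  by rewrite es.
Qed.

Lemma conn_ex x y : mdist x y < eps x -> exists p, conn x y p.
Proof.
move=> xy; have : (ereal_inf (EFin @` string_length (@chart _ _ K) x y) < (eps x)%:E)%E.
  by rewrite -length_metric lte_fin.
move=> /ereal_inf_lt[_ [l str <-]]; rewrite lte_fin => leps.
apply: (@near_conn x y (0 + l)); last by rewrite add0r.
apply: string_near str _ _ _; last by rewrite add0r.
split=> //; exists _, (lcode (locate x)), (lcoord (locate x)), (lcoord (locate x)).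
split; [exact: lift_locate|exact/in01W/locate01|exact: locateE|].
by move=> i; rewrite subrr normr0.
Qed.

End Development.

(** * Monodromy along finite sequences of points *)

Section Monodromy.
Context {R : realType} {X : metricType R} (K : cube_complex X).
Context (flagK : forall v, is_vertex K v -> link_flag K v).
Implicit Types (c : cell K).
Local Notation code c := ('I_(cell_dim c) -> bool).
Local Notation coord c := ('I_(cell_dim c) -> R).
Local Notation S := (flag_skeleton flagK).
Local Notation word := (seq (edge S)).
Local Notation eps := (@eps R X K).
Local Notation conn := (@conn R X K flagK).
Local Notation base := (@base R X K flagK).

Lemma homotopic_rev (w w' : word) : homotopic w w' -> homotopic (rev_word w) (rev_word w').
Proof.
move=> H; have h := homotopic_catl (rev_word w) (hom_sym (homotopic_revr w')).
rewrite cats0 in h; apply: hom_trans h _; rewrite catA.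
apply: hom_trans (homotopic_catr _ (homotopic_catl _ (hom_sym H))) _.
rewrite -[X in homotopic _ X]cat0s; exact/homotopic_catr/homotopic_revl.
Qed.

(* The transition between the developments at y and y' does not depend on the
   point x near both from which they are compared. *)
Definition transition y y' (p : word) := exists x p1 p2,
  [/\ mdist x y < eps x / 3, mdist x y' < eps x / 3, conn x y p1, conn x y' p2 &
      p = rev_word p1 ++ p2].

Lemma eps3 x y : mdist x y < eps x / 3 -> mdist x y < eps x.
Proof. by have := eps_gt0 K x; lra. Qed.

Lemma transition_uniq y y' p q : transition y y' p -> transition y y' q -> homotopic p q.
Proof.
wlog: p q / exists x x' p1 p2 q1 q2, [/\ mdist x y < eps x / 3, mdist x' y < eps x' / 3,
    eps x' <= eps x, conn x y p1 /\ conn x y' p2 /\ p = rev_word p1 ++ p2 &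
    conn x' y q1 /\ conn x' y' q2 /\ q = rev_word q1 ++ q2].
  move=> H [x [p1 [p2 [xy xy' c1 c2 E]]]] [x' [q1 [q2 [x'y x'y' d1 d2 E']]]].
  have [le|/ltW le] := leP (eps x') (eps x).
    apply: H; [|by exists x, p1, p2|by exists x', q1, q2].
    by exists x, x', p1, p2, q1, q2.
  apply: hom_sym; apply: H; [|by exists x', q1, q2|by exists x, p1, p2].
  by exists x', x, q1, q2, p1, p2.
move=> [x [x' [p1 [p2 [q1 [q2 [xy x'y le [c1 [c2 ->]] [d1 [d2 ->]]]]]]]]] _ _.
(* Two thirds of the larger radius bound the distance from [x] to [x']; this is the origin of the
   factor 1/3 in [transition]. *)
have [r xx'] : exists r, conn x x' r.
  apply: conn_ex; apply: le_lt_trans (metric_triangle x y x') _.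
  by rewrite (metric_sym y); have := eps_gt0 K x; lra.
have h1 := conn_trans le xx' d1 c1; have h2 := conn_trans le xx' d2 c2.
apply: hom_trans (homotopic_cat (homotopic_rev h1) h2) _.
rewrite rev_word_cat -catA (catA _ r); apply: homotopic_catl.
rewrite -[X in homotopic _ X]cat0s; exact/homotopic_catr/homotopic_revl.
Qed.

Definition trans_word y y' : word :=
  if pselect (exists p, transition y y' p) is left H then projT1 (cid H) else [::].

Lemma trans_wordP x y y' p p' : mdist x y < eps x / 3 -> mdist x y' < eps x / 3 ->
  conn x y p -> conn x y' p' -> homotopic (trans_word y y') (rev_word p ++ p').
Proof.
move=> xy xy' c1 c2; have t : transition y y' (rev_word p ++ p') by exists x, p, p'.
rewrite /trans_word; case: pselect => [H|[]]; last by eexists; exact: t.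
by case: cid => q /= tq; apply: transition_uniq tq t.
Qed.

Lemma trans_word_comp x y y' y'' : mdist x y < eps x / 3 -> mdist x y' < eps x / 3 ->
  mdist x y'' < eps x / 3 ->
  homotopic (trans_word y y'') (trans_word y y' ++ trans_word y' y'').
Proof.
move=> d1 d2 d3; have [p1 c1] := conn_ex flagK (eps3 d1).
have [p2 c2] := conn_ex flagK (eps3 d2); have [p3 c3] := conn_ex flagK (eps3 d3).
apply: hom_trans (trans_wordP d1 d3 c1 c3) _; apply: hom_sym.
apply: hom_trans (homotopic_cat (trans_wordP d1 d2 c1 c2) (trans_wordP d2 d3 c2 c3)) _.
rewrite -catA (catA p2); apply: homotopic_catl.
rewrite -[X in homotopic _ X]cat0s; exact/homotopic_catr/homotopic_revr.
Qed.

Lemma trans_wordxx y : homotopic (trans_word y y) [::].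
Proof.
have d : mdist y y < eps y / 3 by rewrite mdistxx; have := eps_gt0 K y; lra.
exact: (trans_wordP d d (conn_refl _ _) (conn_refl _ _)).
Qed.

Fixpoint monodromy (f : nat -> X) n : word :=
  if n is n'.+1 then monodromy f n' ++ trans_word (f n') (f n'.+1) else [::].

Lemma eq_monodromy f g n : (forall i, (i <= n)%N -> f i = g i) -> monodromy f n = monodromy g n.
Proof.
elim: n => //= n IH fg; rewrite IH ?fg // => i /leqW; exact: fg.
Qed.

Lemma monodromy_add f m n : monodromy f (m + n) = monodromy f m ++ monodromy (fun i => f (m + i)%N) n.
Proof. by elim: n => [|n IH]; rewrite ?addn0 ?cats0 // addnS /= IH catA addnS. Qed.

Definition local4 y1 y2 y3 y4 := exists x, [/\ mdist x y1 < eps x / 3,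
  mdist x y2 < eps x / 3, mdist x y3 < eps x / 3 & mdist x y4 < eps x / 3].

Lemma monodromy_strip f g n :
  (forall i, (i < n)%N -> local4 (f i) (f i.+1) (g i) (g i.+1)) ->
  homotopic (monodromy f n ++ trans_word (f n) (g n)) (trans_word (f 0) (g 0) ++ monodromy g n).
Proof.
elim: n => [_|n IH H] /=; first by rewrite cats0; exact: hom_refl.
have [x [d1 d2 d3 d4]] := H n (ltnSn n).
rewrite catA; apply: hom_trans (homotopic_catr _ (IH _)); last first.
  by move=> i /ltnW; apply: H.
rewrite -!catA; apply: homotopic_catl.
apply: hom_trans (hom_sym (trans_word_comp d1 d2 d4)) (trans_word_comp d1 d3 d4).
Qed.

Lemma monodromy_homotopy f g n :
  (forall i, (i < n)%N -> local4 (f i) (f i.+1) (g i) (g i.+1)) ->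
  f 0 = g 0 -> f n = g n -> homotopic (monodromy f n) (monodromy g n).
Proof.
move=> /monodromy_strip H f0 fn; move: H; rewrite f0 fn => H.
have h := homotopic_catl (monodromy f n) (trans_wordxx (g n)).
have h' := homotopic_catr (monodromy g n) (trans_wordxx (g 0)).
rewrite cats0 in h; exact: hom_trans (hom_sym h) (hom_trans H h').
Qed.

Lemma monodromy_const y n : homotopic (monodromy (fun=> y) n) [::].
Proof.
elim: n => [|n IH] /=; first exact: hom_refl.
exact: homotopic_cat IH (trans_wordxx y).
Qed.

(** Closeness inside the cube is assumed besides closeness in X, because a chart may bring distant
    points of a cube together. *)
Lemma monodromy_cube c (u : nat -> 'rV[R]_(cell_dim c)) (e e' : code c) a b s n :
  (forall i, (i <= n)%N -> unit_cube (u i)) ->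
  (forall i, (i < n)%N -> exists x, [/\ mdist x (@chart _ _ K c (u i)) < eps x / 3,
     mdist x (@chart _ _ K c (u i.+1)) < eps x / 3 & close (u i) (u i.+1) (eps x)]) ->
  lift (@chart _ _ K c (u 0%N)) e a -> u 0%N = corner_pt e a ->
  lift (@chart _ _ K c (u n)) e' b -> u n = corner_pt e' b -> flips e s = e' ->
  homotopic (monodromy (fun i => @chart _ _ K c (u i)) n) (cube_word flagK e s).
Proof.
elim: n e' b s => [|n IH] e' b s uu H L E L' E' es.
  have [ee _] : e = e' /\ a = b.
    apply: lift_uniq L L' _ => i; rewrite -E -E' subrr normr0.
    by have [] := gapP K (@chart _ _ K c (u 0%N)).
  by apply: hom_sym; apply: cube_word_closed; rewrite es ee.
have [e1 [b1 [E1 L1]]] := lift_ex (uu n (leqnSn n)).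
have [s1 es1 _] := flips_ex e e1; have [s2 es2 _] := flips_ex e1 e'.
have [x [d1 d2 cl]] := H n (ltnSn n).
have [p1 c1] := conn_ex flagK (eps3 d1); have [p2 c2] := conn_ex flagK (eps3 d2).
have h1 : homotopic (monodromy (fun i => @chart _ _ K c (u i)) n) (cube_word flagK e s1).
  apply: (IH e1 b1) => //; [by move=> i /leqW; exact: uu|by move=> i /leqW; exact: H].
have h2 : homotopic (trans_word (@chart _ _ K c (u n)) (@chart _ _ K c (u n.+1)))
    (cube_word flagK e1 s2).
  apply: hom_trans (trans_wordP d1 d2 c1 c2) _.
  by apply: (conn_cube c1 c2 L1 L' es2); rewrite -E1 -E'.
apply: hom_trans (homotopic_cat h1 h2) _; rewrite -es1 -cube_word_cat.
by apply: cube_word_homotopic; rewrite flips_cat es1 es2 es.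
Qed.

End Monodromy.

(** * Subdivision of homotopies and paths along words *)

Section MetricPaths.
Context {R : realType} {X : metricType R}.

(** The clause [d <= r x] makes a mesh below [d] smaller than the radius as well, as needed to
    control the steps inside a cube. *)
Lemma lebesgue_number (H : R * R -> X) (r : X -> R) (A : set (R * R)) :
  (forall x, 0 < r x) -> compact A -> {within A, continuous H} ->
  exists2 d, 0 < d & forall z, A z -> exists x, d <= r x /\
    forall z', A z' -> `|z.1 - z'.1| <= d -> `|z.2 - z'.2| <= d -> mdist x (H z') < r x.
Proof.
move=> r0 /compact_near_coveringP cA /subspace_continuousP cH.
pose P (d : R) z := exists x, d <= r x /\ forall z', A z' -> `|z.1 - z'.1| <= d ->
  `|z.2 - z'.2| <= d -> mdist x (H z') < r x.
have near : \forall d \near 0^'+, A `<=` P d.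
  apply: cA => z Az; pose x := H z.
  have : (within A (nbhs z)) (H @^-1` ball x (r x)).
    by apply: cH => //; apply: nbhsx_ballx; exact: r0.
  move=> /nbhs_ballP[e /= e0 ze].
  exists (ball z (e / 2), [set d | d < Num.min (e / 2) (r x)]).
    split=> /=; first by apply: nbhsx_ballx; rewrite divr_gt0.
    by apply: nbhs_right_lt; rewrite lt_min r0 divr_gt0.
  move=> [y d] /= [[zy1 zy2]]; rewrite lt_min => /andP[de dr]; exists x; split; first exact: ltW.
  move=> y' Ay' y1 y2; have : ball x (r x) (H y').
    apply: ze => //; split=> /=.
    - suff: `|z.1 - y'.1| < e by [].
      have -> : z.1 - y'.1 = (z.1 - y.1) + (y.1 - y'.1) by lra.
      apply: le_lt_trans (ler_normD _ _) _; move: zy1; rewrite /ball /=; lra.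
    - suff: `|z.2 - y'.2| < e by [].
      have -> : z.2 - y'.2 = (z.2 - y.2) + (y.2 - y'.2) by lra.
      apply: le_lt_trans (ler_normD _ _) _; move: zy2; rewrite /ball /=; lra.
  by rewrite ballEmdist.
have [d [/= d0 Pd]] := filter_ex (filterI (nbhs_right_gt 0) near).
by exists d.
Qed.

Lemma lipschitz_within (f : R -> X) (k : R) (A : set R) : 0 < k ->
  (forall s t, mdist (f s) (f t) <= k * `|s - t|) -> {within A, continuous f}.
Proof.
move=> k0 fk; apply: continuous_subspaceT => s U /nbhs_ballP[e /= e0 eU].
apply/nbhs_ballP; exists (e / k) => /=; first by rewrite divr_gt0.
move=> t /= st; apply: eU; rewrite ballEmdist /=; apply: le_lt_trans (fk _ _) _.
by rewrite mulrC -ltr_pdivlMr.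
Qed.

Context (K : cube_complex X).
Context (flagK : forall v, is_vertex K v -> link_flag K v).
Implicit Types (c : cell K).
Local Notation code c := ('I_(cell_dim c) -> bool).
Local Notation S := (flag_skeleton flagK).
Local Notation word := (seq (edge S)).

Lemma mdist_chart c (u v : 'rV[R]_(cell_dim c)) : unit_cube u -> unit_cube v ->
  mdist (@chart _ _ K c u) (@chart _ _ K c v) <= euclidean_dist u v.
Proof.
move=> uu vu; rewrite -lee_fin (length_metric K); apply: ereal_inf_lbound.
exists (euclidean_dist u v + 0); last by rewrite addr0.
by apply: string_cons => //; exact: string_nil.
Qed.

Lemma dist_axis n (e : 'I_n -> bool) i (s t : R) :
  euclidean_dist (corner_pt e (axis i s)) (corner_pt e (axis i t)) = `|s - t|.
Proof.
rewrite /euclidean_dist (bigD1 i) //= big1 => [|j /negPf ji].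
  rewrite addr0 sqrtr_sqr !mxE /axis eqxx; case: (e i) => //.
  by rewrite -[RHS]normrN; congr `| _ |; lra.
by rewrite !mxE /axis ji subrr expr0n.
Qed.

Lemma clamp_dist (s t : R) : `|clamp s - clamp t| <= `|s - t|.
Proof.
rewrite /clamp; case: (leP s 0) => s0; case: (leP t 0) => t0;
  case: (leP 1 s) => s1; case: (leP 1 t) => t1; rewrite ?subrr ?normr0 ?normr_ge0 //;
  rewrite ler_norml; case: (ger0P (s - t)); lra.
Qed.

Lemma edge_lipschitz (g : edge S) s t : mdist (sval g s) (sval g t) <= `|s - t|.
Proof.
have [c [e [i ->]]] := mk_edgeP g; apply: le_trans (clamp_dist s t).
rewrite -(dist_axis e i); apply: mdist_chart; apply: unit_cube_corner_pt;
  apply: axis01; exact: clamp01.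
Qed.

Fixpoint word_path (x : X) (w : word) (t : R) : X :=
  if w is g :: w' then
    if t <= 1 then sval g t else word_path (sval g 1) w' (t - 1)
  else x.

Lemma word_path0 (x y : vert S) w : walk x w y -> word_path (sval x) w 0 = sval x.
Proof. by case: w => //= g w [<- _]; rewrite ler01. Qed.

Lemma word_path1 (x y : vert S) w : walk x w y ->
  word_path (sval x) w (size w)%:R = sval y.
Proof.
elim: w x => [x -> //|g w IH] x [_ W] /=; case: (leP (size w).+1%:R 1) => h.
  have : size w = 0%N.
    by apply/eqP; move: h; rewrite (_ : 1 = 1%:R) // ler_nat ltnS leqn0.
  by move/size0nil => w0; move: W; rewrite w0 /= => <-.
by rewrite -addn1 natrD addrK; exact: (IH (tgt g)).
Qed.

Lemma word_path_lipschitz (x y : vert S) w s t : walk x w y ->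
  mdist (word_path (sval x) w s) (word_path (sval x) w t) <= `|s - t|.
Proof.
wlog le_st : s t / s <= t.
  move=> H W; have [/H|/ltW/H] := leP s t; first by apply.
  by rewrite metric_sym distrC; apply.
elim: w x s t le_st => [x s t _ _|g w IH] /=; first by rewrite mdistxx.
move=> x s t st [_ W]; have [t1|t1] := leP t 1.
  by rewrite (le_trans st t1); exact: edge_lipschitz.
have [s1|s1] := leP s 1; last first.
  have -> : s - t = (s - 1) - (t - 1) by lra.
  by apply: (IH (tgt g)) => //; lra.
apply: le_trans (metric_triangle _ (sval g 1) _) _.
have h1 := edge_lipschitz g s 1.
have h2 : mdist (word_path (sval (tgt g)) w 0) (word_path (sval (tgt g)) w (t - 1)) <= `|0 - (t - 1)|.
  by apply: (IH (tgt g)) => //; lra.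
rewrite (word_path0 W) in h2; have h3 := lerD h1 h2; apply: le_trans h3 _.
rewrite !ler0_norm; lra.
Qed.

End MetricPaths.

(** * Contraction of closed walks *)

Section Homotopy.
Context {R : realType} {X : metricType R} (K : cube_complex X).
Context (flagK : forall v, is_vertex K v -> link_flag K v).
Implicit Types (c : cell K).
Local Notation code c := ('I_(cell_dim c) -> bool).
Local Notation S := (flag_skeleton flagK).
Local Notation word := (seq (edge S)).
Local Notation eps := (@eps R X K).
Local Notation base := (@base R X K flagK).
Local Notation monodromy := (monodromy flagK).

Lemma lift_vertex c (e : code c) : lift (pos e (fun=> 0)) e (fun=> 0).
Proof.
have [|e' [a [E L]]] := @lift_ex _ _ K c (corner_pt e (fun=> 0)).
  by apply: unit_cube_corner_pt => i; lra.
have H i : e' i = e i /\ a i = 0.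
  have := congr1 (fun u : 'rV_ _ => u 0 i) E; rewrite !mxE; have := lift01 L i.
  clear E L.
  by case: (e i); case: (e' i) => //; split=> //; lra.
have [ee aa] : e' = e /\ a = fun=> 0.
  by split; apply/funext => i; case: (H i).
by subst e' a.
Qed.

Lemma base_vertex (v : vert S) : base (sval v) = v.
Proof.
apply: vert_type_inj; case: v => v /= [c [e <-]]; rewrite -corner_pt0 -/(pos e _).
exact: (congr1 sval (lift_base flagK (lift_vertex e))).
Qed.

Lemma string_walk (x y : X) l : string_length (@chart _ _ K) x y l ->
  exists w, walk (base x) w (base y).
Proof.
elim=> [z|c u v z l' uu vu _ [w W]]; first by exists [::].
have [e [a [_ L]]] := lift_ex uu; have [e' [b [_ L']]] := lift_ex vu.
have [s es _] := flips_ex e e'; exists (cube_word flagK e s ++ w).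
apply/walk_cat; exists (base (@chart _ _ K c v)); split=> //.
rewrite (lift_base flagK L) (lift_base flagK L') -es; exact: cube_walk.
Qed.

Lemma flag_skeleton_connected (x y : vert S) : exists w, walk x w y.
Proof.
have : (ereal_inf (EFin @` string_length (@chart _ _ K) (sval x) (sval y)) <
    (mdist (sval x) (sval y) + 1)%:E)%E.
  by rewrite -length_metric lte_fin ltrDl.
by move=> /ereal_inf_lt[_ [l /string_walk[w W] _] _]; exists w; rewrite !base_vertex in W.
Qed.

Lemma monodromy_edge (g : edge S) (h : R) Q : Q%:R * h = 1 -> 0 <= h ->
  (forall i, (i < Q)%N -> exists z, [/\ mdist z (sval g (i%:R * h)) < eps z / 3,
     mdist z (sval g (i.+1%:R * h)) < eps z / 3 & h < eps z]) ->
  homotopic (monodromy (fun i => sval g (i%:R * h)) Q) [:: g].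
Proof.
move=> Qh h0 H; have [c [e [k E]]] := mk_edgeP g.
have ih i : (i <= Q)%N -> 0 <= i%:R * h <= 1.
  by move=> iQ; rewrite mulr_ge0 //= -[leRHS]Qh ler_wpM2r // ler_nat.
pose u i := corner_pt e (axis k (i%:R * h)).
have gE i : (i <= Q)%N -> sval g (i%:R * h) = @chart _ _ K c (u i).
  by move=> /ih i01; rewrite E /= /edge_path clamp_id.
rewrite (eq_monodromy flagK (g := fun i => @chart _ _ K c (u i))) //.
have -> : [:: g] = cube_word flagK e [:: k] by rewrite E.
apply: (@monodromy_cube _ _ _ flagK c u e (flip e k) (fun=> 0) (fun=> 0)) => //.
- by move=> i /ih i01; apply: unit_cube_corner_pt; apply: axis01.
- move=> i iQ; have [z [z1 z2 hz]] := H i iQ; exists z; split.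
  + by rewrite -gE // ltnW.
  + by rewrite -gE.
  + apply/close_corner_pt => j; rewrite /axis; case: eqP => _.
      by rewrite -mulrBl -[i.+1]addn1 natrD opprD addNKr mulN1r normrN ger0_norm.
    by rewrite subrr normr0 eps_gt0.
- by rewrite /u mul0r axis0; exact: lift_vertex.
- by rewrite /u mul0r axis0.
- rewrite /u Qh -[1]subr0 -flipc_axis -{1}(flipK e k) corner_pt_flip axis0.
  exact: lift_vertex.
- by rewrite /u Qh -[1]subr0 -flipc_axis -{1}(flipK e k) corner_pt_flip axis0.
Qed.

Lemma monodromy_word (x y : vert S) w (h : R) Q : Q%:R * h = 1 -> 0 <= h -> walk x w y ->
  (forall i, (i < size w * Q)%N -> exists z,
     [/\ mdist z (word_path (sval x) w (i%:R * h)) < eps z / 3,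
     mdist z (word_path (sval x) w (i.+1%:R * h)) < eps z / 3 & h < eps z]) ->
  homotopic (monodromy (fun i => word_path (sval x) w (i%:R * h)) (size w * Q)) w.
Proof.
move=> Qh h0; elim: w x => [|g w IH] x; first by move=> _ _; exact: hom_refl.
move=> [_ W] H; rewrite [size (g :: w)]/= mulSn monodromy_add.
have hpos : 0 < h.
  by rewrite lt0r h0 andbT; apply/eqP => h1; move: Qh; rewrite h1 mulr0; lra.
have le1 i : (i%:R * h <= 1) = (i <= Q)%N.
  by rewrite -[X in _ <= X]Qh ler_pM2r // ler_nat.
have first i : (i <= Q)%N -> word_path (sval x) (g :: w) (i%:R * h) = sval g (i%:R * h).
  by move=> iQ; rewrite /= le1 iQ.
have rest i : word_path (sval x) (g :: w) ((Q + i)%:R * h) =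
    word_path (sval (tgt g)) w (i%:R * h).
  case: i => [|i]; first by rewrite addn0 first // Qh mul0r (word_path0 W).
  rewrite [LHS]/= le1 (_ : (Q + i.+1 <= Q)%N = false); last by rewrite addnS ltnNge leq_addr.
  by rewrite natrD mulrDl Qh (addrC 1) addrK.
rewrite -[X in homotopic _ X]cat1s; apply: homotopic_cat.
  rewrite (eq_monodromy flagK first); apply: monodromy_edge => // i iQ.
  rewrite -!first // ?(ltnW iQ) //; apply: H.
  by rewrite /= mulSn; apply: leq_trans iQ (leq_addr _ _).
rewrite (eq_monodromy flagK (g := fun i => word_path (sval (tgt g)) w (i%:R * h))) //.
apply: IH W _ => i iQ; rewrite -!rest addnS; apply: H.
by rewrite /= mulSn ltn_add2l.
Qed.

Lemma closed_walk_homotopic (x : vert S) w : simply_connected R X ->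
  walk x w x -> homotopic w [::].
Proof.
case: w => [_ _|g w']; first exact: hom_refl.
set w := g :: w' => -[_ _ sc] W.
pose m := size w; have m0 : 0 < m%:R :> R by rewrite ltr0n.
pose p t := word_path (sval x) w (m%:R * t).
have p0 : p 0 = sval x by rewrite /p mulr0 (word_path0 W).
have p1 : p 1 = sval x by rewrite /p mulr1 (word_path1 W).
have [||H [cH Hb Ht Hs]] := sc p.
- apply: (lipschitz_within m0) => s t.
  by rewrite -(ger0_norm (ltW m0)) -normrM mulrBr; exact: word_path_lipschitz W.
- by rewrite p0 p1.
have r0 z : 0 < eps z / 3 by have := eps_gt0 K z; lra.
have [d d0 Hd] := lebesgue_number r0
  (compact_setX (@segment_compact R 0 1) (@segment_compact R 0 1)) cH.
have [q qd] := ltr_add_invr d0; rewrite add0r in qd.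
(* Each of the [m] edges of the walk takes [Q] steps, so that vertices are grid points: a step has
   length [h] along an edge and [k = h / m] in the parameter of the loop, and both are below [d]. *)
pose Q := q.+1; pose h : R := Q%:R^-1; pose n := (m * Q)%N; pose k : R := n%:R^-1.
have Qh : Q%:R * h = 1 by rewrite mulfV // pnatr_eq0.
have h0 : 0 < h by rewrite invr_gt0 ltr0n.
have n0 : (0 < n)%N by rewrite muln_gt0.
have k0 : 0 < k by rewrite invr_gt0 ltr0n.
have nk : n%:R * k = 1 by rewrite mulfV // pnatr_eq0 -lt0n.
have mk : m%:R * k = h by rewrite /k natrM invfM mulrA mulfV ?mul1r // gt_eqF.
have kh : k <= h by rewrite -mk ler_peMl ?(ltW k0) // ler1n.
have I1 i : (i <= n)%N -> `[(0 : R), 1]%classic (i%:R * k).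
  move=> iN; rewrite /= in_itv /= mulr_ge0 ?(ltW k0) //= -[leRHS]nk.
  by rewrite ler_wpM2r ?(ltW k0) // ler_nat.
have near_grid i i' : (i <= i')%N -> (i' <= i.+1)%N -> `|i%:R * k - i'%:R * k| <= d.
  move=> ii' i'i; rewrite -mulrBl normrM (gtr0_norm k0) distrC.
  rewrite -natrB // ger0_norm ?ler0n // (le_trans _ (ltW (le_lt_trans kh qd))) //.
  by rewrite ler_piMl ?(ltW k0) // (_ : 1 = 1%:R) // ler_nat leq_subLR addn1.
pose f j i := H (i%:R * k, j%:R * k).
have loc i j : (i < n)%N -> (j < n)%N -> exists z, h < eps z /\
    forall i' j', (i <= i' <= i.+1)%N -> (j <= j' <= j.+1)%N -> mdist z (f j' i') < eps z / 3.
  move=> iN jN; have [|z [dz zH]] := Hd (i%:R * k, j%:R * k).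
    by split; apply: I1; exact: ltnW.
  exists z; split; first by apply: lt_le_trans qd (le_trans dz _); have := eps_gt0 K z; lra.
  move=> i' j' /andP[ii' i'i] /andP[jj' j'j]; apply: zH; try exact: near_grid.
  by split; apply: I1; [exact: leq_trans i'i iN|exact: leq_trans j'j jN].
(* Each small square of the grid lies in a ball where transitions compose. *)
have strip j : (j < n)%N -> homotopic (monodromy (f j) n) (monodromy (f j.+1) n).
  move=> jN; have side i : (i <= n)%N -> f i 0%N = sval x /\ f i n = sval x.
    by move=> /I1/Hs; rewrite /f mul0r nk p0.
  have [s0 s1] := side j (ltnW jN); have [s2 s3] := side _ jN.
  apply: monodromy_homotopy; rewrite ?s0 ?s1 ?s2 ?s3 // => i iN.
  by have [z [_ zf]] := loc i j iN jN; exists z; split; apply: zf; rewrite ?leqnn ?leqnSn.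
have bottom : homotopic (monodromy (f 0%N) n) w.
  have fw i : (i <= n)%N -> f 0%N i = word_path (sval x) w (i%:R * h).
    by move=> iN; rewrite /f mul0r Hb; [rewrite /p mulrCA mk|exact: I1].
  rewrite (eq_monodromy flagK (g := fun i => word_path (sval x) w (i%:R * h))).
    apply: (monodromy_word Qh (ltW h0) W) => i iN; have [z [hz zf]] := loc i 0%N iN n0.
    exists z; split=> //.
    - have := zf i 0%N; rewrite (fw i (ltnW iN)); apply; rewrite ?leqnn ?leqnSn //.
    - have := zf i.+1 0%N; rewrite (fw i.+1 iN); apply; rewrite ?leqnn ?leqnSn //.
  exact: fw.
have top : homotopic (monodromy (f n) n) [::].
  rewrite (eq_monodromy flagK (g := fun=> sval x)); first exact: monodromy_const.
  by move=> i iN; rewrite /f nk Ht ?p0 //; exact: I1.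
apply: hom_trans (hom_sym bottom) (hom_trans _ top).
have H' j : (j <= n)%N -> homotopic (monodromy (f 0%N) n) (monodromy (f j) n).
  elim: j => [_|j IH jN]; first exact: hom_refl.
  exact: hom_trans (IH (ltnW jN)) (strip j jN).
exact: H'.
Qed.

End Homotopy.

(** * Cubical actions *)

Section CubicalMaps.
Context {R : realType} {X : metricType R} (K : cube_complex X).
Implicit Types (c : cell K).
Local Notation code c := ('I_(cell_dim c) -> bool).

(* The map g sends the cube spanned by the corner [e] into the one spanned by
   the corner [e'], the i-th coordinate becoming the (r i)-th one. *)
Definition maps_corner (g : X -> X) c (e : code c) c' (e' : code c')
    (r : 'I_(cell_dim c) -> 'I_(cell_dim c')) :=
  injective r /\ forall a a', (forall i, 0 <= a i <= 1) -> (forall i, a' (r i) = a i) ->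
    (forall j, (forall i, r i <> j) -> a' j = 0) -> g (pos e a) = pos e' a'.

(** All directions of the source cube are free, so the relation given by [isometry_coord] can be
    turned into a function. *)
Lemma maps_corner_ex g c (e : code c) : cubical_map K g ->
  exists c' (e' : code c') r, maps_corner g e e' r.
Proof.
move=> /(_ c)[c' [F' [h [hI hg]]]].
have F0 : @unit_cube R _ = face (fun _ : 'I_(cell_dim c) => None).
  by apply/seteqP; split=> u; [split|case].
rewrite F0 in hI; have [|e' [r [Fe' rF [rl rr] ri rE]]] := isometry_coord hI (e := e).
  by [].
have [f fr] := choice (fun i => rl i erefl).
exists c', e', f; split=> [i j ij|a a' a01 a'f a'0].
  by apply/(ri _ _ _ _ (fr i) (fr j)).
have uu := unit_cube_corner_pt e a01.
rewrite /pos (hg _ uu) -[h _](rel_coordK e'); congr (chart (corner_pt _ _)).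
rewrite F0 in uu; apply/funext => j; have [[i <-]|ij] := pselect (exists i, f i = j).
  by rewrite a'f (rE _ _ _ uu (fr i)) corner_ptK.
rewrite a'0; last by move=> i ?; apply: ij; exists i.
have : face F' (h (corner_pt e a)) by rewrite -hI.1; exists (corner_pt e a).
case=> _ /(_ j); rewrite /rel_coord; case E : (F' j) => [b|].
  move=> /(_ b erefl) ->; rewrite (Fe' _ _ E); case: b {E} => /=; lra.
have [i rij] := rr _ E; case: ij; exists i.
exact/(ri _ _ _ _ (fr i) rij).
Qed.

Lemma maps_corner_flip g c (e : code c) c' (e' : code c') r i : maps_corner g e e' r ->
  maps_corner g (flip e i) (flip e' (r i)) r.
Proof.
move=> [ri gE]; split=> // a a' a01 a'r a'0.
rewrite -(flipcK a i) -(flipcK a' (r i)) /pos !corner_pt_flip; apply: gE.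
- by move=> j; rewrite /flipc; have := a01 j; case: eqP => //; lra.
- by move=> j; rewrite /flipc (inj_eq ri) a'r.
- by move=> j nj; rewrite /flipc; case: eqP => [/esym/nj //|_]; exact: a'0.
Qed.

Lemma maps_corner_vertex g c (e : code c) c' (e' : code c') r : maps_corner g e e' r ->
  g (pos e (fun=> 0)) = pos e' (fun=> 0).
Proof. by move=> [_ gE]; apply: gE => // i; rewrite lexx ler01. Qed.

Lemma maps_corner_edge g c (e : code c) c' (e' : code c') r i : maps_corner g e e' r ->
  (fun t => g (edge_path e i t)) = edge_path e' (r i).
Proof.
move=> [ri gE]; apply/funext => t; apply: gE => j.
- by apply: axis01; exact: clamp01.
- by rewrite /axis (inj_eq ri).
- by rewrite /axis => /(_ i); case: eqP => // ->.
Qed.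

Section Map.
Context (g : X -> X) (gK : cubical_map K g).

Lemma vert_map_subproof (v : vert_type K) : is_vertex K (g (sval v)).
Proof.
case: v => v /= [c [e <-]]; have [c' [e' [r m]]] := maps_corner_ex e gK.
rewrite -corner_pt0 -/(pos e _) (maps_corner_vertex m); exact: is_vertex_pos.
Qed.

Lemma edge_map_subproof (f : edge_type K) :
  exists c (e : code c) i, (fun t => g (sval f t)) = edge_path e i.
Proof.
have [c [e [i ->]]] := mk_edgeP f; have [c' [e' [r m]]] := maps_corner_ex e gK.
by exists c', e', (r i); exact: maps_corner_edge m.
Qed.

Definition vert_map (v : vert_type K) : vert_type K := exist _ _ (vert_map_subproof v).
Definition edge_map (f : edge_type K) : edge_type K := exist _ _ (edge_map_subproof f).

Lemma edge_map_mk c (e : code c) c' (e' : code c') r i : maps_corner g e e' r ->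
  edge_map (mk_edge e i) = mk_edge e' (r i).
Proof. by move=> m; apply: edge_type_inj; exact: maps_corner_edge m. Qed.

End Map.

Section Cat0.
Context (cK : CAT0_cube_complex K) (N : nat) (dimN : forall c, (cell_dim c <= N)%N).

Lemma flag_skeleton_homotopic (x y : vert (flag_skeleton cK.2)) w w' :
  walk x w y -> walk x w' y -> homotopic w w'.
Proof.
move=> W W'; apply: homotopic_closed; apply: closed_walk_homotopic cK.1 _.
by apply/walk_cat; exists y; split; last exact: (walk_rev W').
Qed.

Definition skeleton_of_complex : cat0_skeleton :=
  Cat0Skeleton (@flag_skeleton_connected _ _ _ cK.2) flag_skeleton_homotopic
    (fun v L => @flag_skeleton_corner _ _ _ cK.2 v L N dimN).

Lemma flag_skeleton_map g (gK : cubical_map K g) :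
  @skeleton_map skeleton_of_complex (vert_map gK) (edge_map gK).
Proof.
split.
- by move=> e; apply: vert_type_inj.
- by move=> e; apply: edge_type_inj.
- move=> _ _ _ _ [c [e [i [j [ij [-> -> -> ->]]]]]].
  have [c' [e' [r m]]] := maps_corner_ex e gK.
  exists c', e', (r i), (r j); split; first by move=> /m.1.
  by split; apply: edge_map_mk => //; exact: maps_corner_flip.
Qed.

End Cat0.
End CubicalMaps.

Theorem corollary7 (R : realType) (X : metricType R) (K : cube_complex X)
    (G : groupType) (act : G -> X -> X) :
  CAT0_cube_complex K -> finite_dimensional K ->
  group_action act -> (forall g : G, cubical_automorphism K (act g)) ->
  proper_action act ->
  locally_finite_by_virtually_abelian G \/ contains_nonabelian_free_subgroup G.
Proof.
move=> cK [N dimN] [act1 actM] actK proper.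
have gK g : cubical_map K (act g) by have [? []] := actK g.
have [[x _] _ _] := cK.1.
have [c _] := chart_cover K x.
pose x0 : vert (skeleton_of_complex cK dimN) := mk_vert (fun _ : 'I_(cell_dim c) => false).
apply: (@tits_alternative (skeleton_of_complex cK dimN) G
  (fun g => vert_map (gK g)) (fun g => edge_map (gK g)) _ _ _ _ x0).
- split=> [v|g h v]; apply: vert_type_inj; [exact: act1|exact: actM].
- split=> [e|g h e]; apply: edge_type_inj; apply/funext => t; [exact: act1|exact: actM].
- by move=> g; apply: flag_skeleton_map.
(* An element fixing [v] moves the ball around [v] to a set that still contains [v], so properness
   bounds the stabilizer. *)
- move=> v; have [r r0 fin] := proper (sval v); apply: sub_finite_set fin => g /= gv.
  exists (sval v); split; last exact: ballxx.
  by exists (sval v); [exact: ballxx|rewrite -[in RHS]gv].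
Qed.
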